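(* Let $(\Omega,\mathcal T,\Sigma,\mu)$ be a quasi-Radon probability space and let $X$ be a Banach space such that the closed unit ball $B_{X^*}$ of the dual $X^*$ is separable in the weak$^*$ topology. Then a multifunction $F:\Omega\to cwk(X)$ is McShane integrable if and only if $F$ is Birkhoff integrable. In this case, the two integrals coincide, i.e. $(McS)\int_\Omega F\,d\mu=(B)\int_\Omega F\,d\mu$.
   Context: Banach spaces are real. $cwk(X)$ is the family of all nonempty convex weakly compact subsets of $X$, $h$ is the Hausdorff distance, and sums and scalar multiples of sets are Minkowski sums and multiples. Quasi-Radon measure space: $\mathcal T$ is a topology on the nonempty set $\Omega$, $\mu$ is a complete, locally determined measure on a $\sigma$-algebra $\Sigma\supseteq\mathcal T$, $\mu$ is $\tau$-additive ($\mu(\bigcup\mathcal G)=\sup_{G\in\mathcal G}\mu(G)$ for every nonempty upwards directed $\mathcal G\subseteq\mathcal T$), inner regular with respect to closed sets, and effectively locally finite (every set of positive measure meets some open set of finite measure in a set of positive measure). The standing assumption is also that the space is outer regular: $\mu(B)=\inf\{\mu(G): B\subseteq G\in\mathcal T\}$ for all $B\in\Sigma$. McShane integral. A generalized McShane partition of $\Omega$ is a sequence $(E_i,t_i)_{i\in\mathbb N}$ where the $E_i\in\Sigma$ are pairwise disjoint with finite measure, $t_i\in\Omega$ (not necessarily $t_i\in E_i$), and $\mu(\Omega\setminus\bigcup_iE_i)=0$. A gauge is a function $\Delta:\Omega\to\mathcal T$ with $s\in\Delta(s)$ for all $s\in\Omega$; the partition is $\Delta$-fine if $E_i\subseteq\Delta(t_i)$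 for all $i$. $F:\Omega\to cwk(X)$ is McShane integrable if there is $I\in cwk(X)$ such that for every $\varepsilon>0$ there is a gauge $\Delta$ with $\limsup_n h\big(I,\sum_{i=1}^n\mu(E_i)F(t_i)\big)\le\varepsilon$ for every $\Delta$-fine generalized McShane partition $(E_i,t_i)_i$ of $\Omega$; then $(McS)\int_\Omega F\,d\mu:=I$. Birkhoff integral. Let $Z$ be a Banach space. A function $f:\Omega\to Z$ is summable with respect to a countable partition $\Gamma=(A_n)_n$ of $\Omega$ into sets of $\Sigma$ if for every choice of $t_n\in A_n$ the series $\sum_n\mu(A_n)f(t_n)$ converges unconditionally; then $J(f,\Gamma)=\{\sum_n\mu(A_n)f(t_n): t_n\in A_n\}$. $f$ is Birkhoff integrable if for every $\varepsilon>0$ there is a countable partition $\Gamma$ of $\Omega$ in $\Sigma$ with respect to which $f$ is summable and $\sup_{x,y\in J(f,\Gamma)}\|x-y\|\le\varepsilon$; its integral is the unique element of $\bigcap\{\overline{\mathrm{co}}(J(f,\Gamma)): f \text{ is summable with respect to }\Gamma\}$. Let $\ell_\infty(B_{X^*})$ be the Banach space of bounded real functions on $B_{X^*}$ with the supremum norm, and let $j:cwk(X)\to\ell_\infty(B_{X^*})$ be the isometric (R{\aa}dstr\''om) embedding $j(A)(x^* )=\delta^*(x^*,A):=\sup_{x\in A}x^*(x)$. A multifunction $F:\Omega\to cwk(X)$ is Birkhoff integrable if $j\circ F:\Omega\to\ell_\infty(B_{X^*})$ is Birkhoff integrable; since $j(cwk(X))$ is a closed convex cone, there is a unique $(B)\int_\Omega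 F\,d\mu\in cwk(X)$ with $j\big((B)\int_\Omega F\,d\mu\big)=(B)\int_\Omega j\circ F\,d\mu$. *)

(* Defs.v *)
From HB Require Import structures.
From mathcomp Require Import all_boot all_order all_algebra.
From mathcomp Require Import all_classical all_reals all_analysis.

Set Implicit Arguments.
Unset Strict Implicit.
Unset Printing Implicit Defensive.

Import Order.TTheory GRing.Theory Num.Theory.
Import numFieldNormedType.Exports.

Local Open Scope classical_set_scope.
Local Open Scope ring_scope.

(* Completeness of a space of functions whose norm is the least C with
   |f| <= C * w pointwise. *)
Lemma complete_from_eval (R : realType) (V : normedModType R) (T : Type)
    (ev : V -> T -> R) (w : T -> R) :
  (forall t, 0 <= w t) ->
  (forall f g t, ev (f - g) t = ev f t - ev g t) ->
  (forall f t, `|ev f t| <= `|f| * w t) ->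
  (forall f C, 0 <= C -> (forall t, `|ev f t| <= C * w t) -> `|f| <= C) ->
  (forall (F : set_system V) (l : T -> R), ProperFilter F ->
     (forall t, ev f t @[f --> F] --> l t) ->
     (exists C, forall t, `|l t| <= C * w t) -> exists g, ev g = l) ->
  forall F : set_system V, ProperFilter F -> cauchy F -> cvg F.
Proof.
move=> w0 evB ev_le le_norm evlim F FF cF.
have near_pt e : 0 < e -> exists p, \forall f \near F, `|p - f| < e.
  move=> e0; have [p Fp] := (cauchyP F).1 cF e e0; exists p.
  by move: Fp; rewrite -ball_normE.
have cvt t : cvg (ev f t @[f --> F]).
  apply: cauchy_cvg; apply: cauchy_exP => e e0.
  have w1 : 0 < w t + 1 by rewrite ltr_wpDl.
  have [p Fp] := near_pt _ (divr_gt0 e0 w1); exists (ev p t).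
  rewrite /fmap /= /nbhs /=; near=> f; rewrite /= -ball_normE /= -evB.
  apply: (le_lt_trans (ev_le _ _)).
  have pf : `|p - f| < e / (w t + 1) by near: f.
  apply: (@le_lt_trans _ _ (`|p - f| * (w t + 1))).
    by rewrite ler_wpM2l// lerDl.
  by rewrite -ltr_pdivlMr.
pose l t := lim (ev f t @[f --> F]).
have lbound p e : (\forall f \near F, `|p - f| < e) ->
    forall t, `|ev p t - l t| <= e * w t.
  move=> Fp t.
  have cn : `|ev p t - ev f t| @[f --> F] --> `|ev p t - l t|.
    by apply: cvg_norm; apply: cvgB; [exact: cvg_cst|exact: cvt].
  apply: (@closed_cvg _ _ F FF _ [set x | x <= e * w t] _ _ _ cn).
    exact: closed_le.
  near=> f; rewrite /= -evB; apply: (le_trans (ev_le _ _)).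
  rewrite ler_wpM2r// ltW//; near: f; exact: Fp.
have [g gl] : exists g, ev g = l.
  apply: (evlim F) => //.
  have [p Fp] := near_pt 1 ltr01; exists (`|p| + 1) => t.
  rewrite -[l t](subKr (ev p t)) (le_trans (ler_normB _ _))// mulrDl lerD//.
  exact: lbound.
apply/cvg_ex; exists g; apply/cvgrPdist_le => e e0.
have e2 : 0 < e / 2 by rewrite divr_gt0.
have [p Fp] := near_pt _ e2.
have gp : `|g - p| <= e / 2.
  apply: le_norm; first exact: ltW.
  by move=> t; rewrite evB gl distrC; exact: lbound.
near=> f; rewrite -(subrK p g) -addrA (le_trans (ler_normD _ _))//.
rewrite [leRHS]splitr lerD// ltW//; near: f; exact: Fp.
Unshelve. all: by end_near. Qed.

Section linfty.
Variables (R : realType) (S : Type).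

Definition bounded_pred : {pred S -> R} :=
  mem [set f : S -> R | exists C, forall s, `|f s| <= C].

Record linfty := Linfty {
  linfty_fun :> S -> R ; linfty_subproof : linfty_fun \in bounded_pred }.

HB.instance Definition _ := [isSub for linfty_fun].
HB.instance Definition _ := [Choice of linfty by <:].

Lemma bounded_submod_closed : submod_closed bounded_pred.
Proof.
split; first by rewrite inE; exists 0 => s; rewrite normr0.
move=> a f g; rewrite !inE => -[C fC] [D gD]; exists (`|a| * C + D) => s.
by rewrite (le_trans (ler_normD _ _))// lerD// normrM ler_wpM2l.
Qed.

HB.instance Definition _ :=
  GRing.isSubmodClosed.Build _ _ bounded_pred bounded_submod_closed.
HB.instance Definition _ := [SubChoice_isSubLmodule of linfty by <:].

Lemma linfty_bounded (f : linfty) : exists C, forall s, `|f s| <= C.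
Proof. by have := valP f; rewrite inE. Qed.

Definition linfty_norm (f : linfty) : R := sup (range (fun s => `|f s|)).

Lemma le_linfty_norm (f : linfty) s : `|f s| <= linfty_norm f.
Proof.
have [C fC] := linfty_bounded f.
by apply: ub_le_sup; [exists C => _ [t _ <-]|exists s].
Qed.

Lemma linfty_norm_le (f : linfty) C :
  0 <= C -> (forall s, `|f s| <= C) -> linfty_norm f <= C.
Proof.
move=> C0 fC; rewrite /linfty_norm.
have [->|/set0P r0] := eqVneq (range (fun s => `|f s|)) set0.
  by rewrite sup0.
by apply: ge_sup => // _ [s _ <-].
Qed.

Lemma linfty_norm_ge0 f : 0 <= linfty_norm f.
Proof.
have [[s _]|/forallNP S0] := pselect (exists s : S, True).
  exact: le_trans (normr_ge0 _) (le_linfty_norm f s).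
rewrite /linfty_norm (_ : range (fun s => `|f s|) = set0) ?sup0//.
by rewrite -subset0 => ? [s _ _]; exact: (S0 s).
Qed.

Lemma linfty_normD f g : linfty_norm (f + g) <= linfty_norm f + linfty_norm g.
Proof.
apply: linfty_norm_le => [|s]; first by rewrite addr_ge0// linfty_norm_ge0.
by rewrite (le_trans (ler_normD _ _))// lerD// le_linfty_norm.
Qed.

Lemma linfty_normZ a f : linfty_norm (a *: f) = `|a| * linfty_norm f.
Proof.
have le b g : linfty_norm (b *: g) <= `|b| * linfty_norm g.
  apply: linfty_norm_le => [|s]; first by rewrite mulr_ge0// linfty_norm_ge0.
  by rewrite normrM ler_wpM2l// le_linfty_norm.
apply/eqP; rewrite eq_le le /=.
have [->|a0] := eqVneq a 0; first by rewrite normr0 mul0r linfty_norm_ge0.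
rewrite -ler_pdivlMl ?normr_gt0// -normfV (le_trans _ (le _ _))//.
by rewrite scalerA mulVf// scale1r.
Qed.

Lemma linfty_norm_eq0 f : linfty_norm f = 0 -> f = 0.
Proof.
move=> f0; apply/val_inj/funext => s; rewrite -[RHS]/(0 : R); apply/eqP.
by rewrite -normr_le0 -f0; exact: le_linfty_norm.
Qed.

HB.instance Definition _ := Lmodule_isNormed.Build R linfty
  linfty_normD linfty_normZ linfty_norm_eq0.

Lemma linfty_complete (F : set_system linfty) :
  ProperFilter F -> cauchy F -> cvg F.
Proof.
move: F; apply: (@complete_from_eval R linfty S linfty_fun (fun=> 1)) => //.
- by move=> f s; rewrite mulr1 le_linfty_norm.
- by move=> f C C0 fC; apply: linfty_norm_le => // s; rewrite -[C]mulr1.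
- move=> F l FF _ [C lC].
  have lb : l \in bounded_pred.
    by rewrite inE; exists C => s; rewrite -[C]mulr1.
  by exists (Linfty lb).
Qed.

HB.instance Definition _ := Uniform_isComplete.Build linfty linfty_complete.

End linfty.
Arguments bounded_pred : clear implicits.

Section dual.
Variables (R : realType) (X : normedModType R).

Definition dual_pred : {pred X -> R} :=
  mem [set f : X -> R | linear f /\ continuous f].

Record dual := Dual {
  dual_fun :> X -> R ; dual_subproof : dual_fun \in dual_pred }.

HB.instance Definition _ := [isSub for dual_fun].
HB.instance Definition _ := [Choice of dual by <:].

Lemma dual_submod_closed : submod_closed dual_pred.
Proof.
split.
  by rewrite inE; split=> [a x y|]; [rewrite scaler0 addr0|exact: cst_continuous].
move=> a f g; rewrite !inE => -[lf cf] [lg cg]; split=> [b x y|x].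
  rewrite !fctE lf lg /GRing.scale/=.
  rewrite !mulrDr !mulrA (mulrC a b) -!addrA; congr (_ + _).
  by rewrite addrCA.
by apply: cvgD; [apply: cvgZr; exact: cf|exact: cg].
Qed.

HB.instance Definition _ :=
  GRing.isSubmodClosed.Build _ _ dual_pred dual_submod_closed.
HB.instance Definition _ := [SubChoice_isSubLmodule of dual by <:].

Lemma dual_linear (f : dual) : linear f.
Proof. by have := valP f; rewrite inE => -[]. Qed.

Lemma dual_continuous (f : dual) : continuous f.
Proof. by have := valP f; rewrite inE => -[]. Qed.

Lemma dualZ (f : dual) a x : f (a *: x) = a * f x.
Proof.
have f0 : f 0 = 0.
  by have := dual_linear f (-1) 0 0; rewrite scaler0 addr0 scaleN1r addNr.
by have := dual_linear f a x 0; rewrite !addr0 f0 addr0.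
Qed.

Lemma dual_bounded (f : dual) : exists C, forall x, `|x| <= 1 -> `|f x| <= C.
Proof.
pose lf : {linear X -> R} :=
  HB.pack (f : X -> R) (GRing.isLinear.Build _ _ _ _ _ (dual_linear f)).
have c0 : {for 0, continuous lf} by exact: dual_continuous.
have /linear_boundedP[M [_ /(_ (M + 1))]] := continuous_linear_bounded 0 c0.
rewrite ltrDl => /(_ ltr01) fM; exists (`|M + 1|) => x x1.
rewrite (le_trans (fM x))// (le_trans (ler_wpM2r _ (ler_norm _)))//.
by rewrite -[leRHS]mulr1 ler_wpM2l.
Qed.

Definition dual_norm (f : dual) : R := sup [set `|f x| | x in [set x | `|x| <= 1]].

Lemma le_dual_norm1 (f : dual) x : `|x| <= 1 -> `|f x| <= dual_norm f.
Proof.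
have [C fC] := dual_bounded f; move=> x1.
by apply: ub_le_sup; [exists C => _ [t t1 <-]; exact: fC|exists x].
Qed.

Lemma dual_norm_ge0 f : 0 <= dual_norm f.
Proof. by apply: le_trans (@le_dual_norm1 f 0 _); rewrite ?normr0. Qed.

Lemma le_dual_norm (f : dual) x : `|f x| <= dual_norm f * `|x|.
Proof.
have [->|x0] := eqVneq x 0.
  by rewrite -(scale0r 0) dualZ mul0r normr0 mulr_ge0// dual_norm_ge0.
have x1 : `| `|x|^-1 *: x| <= 1 by rewrite normfZV.
have := le_dual_norm1 f x1; rewrite dualZ normrM normfV normr_id mulrC.
by rewrite ler_pdivrMr ?normr_gt0.
Qed.

Lemma dual_norm_le (f : dual) C :
  0 <= C -> (forall x, `|f x| <= C * `|x|) -> dual_norm f <= C.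
Proof.
move=> C0 fC; apply: ge_sup.
  by exists `|f 0|, 0 => //=; rewrite normr0.
move=> _ [x /= x1 <-]; apply: (le_trans (fC x)).
by rewrite -[leRHS]mulr1 ler_wpM2l.
Qed.

Lemma dual_normD f g : dual_norm (f + g) <= dual_norm f + dual_norm g.
Proof.
apply: dual_norm_le => [|x]; first by rewrite addr_ge0// dual_norm_ge0.
by rewrite (le_trans (ler_normD _ _))// mulrDl lerD// le_dual_norm.
Qed.

Lemma dual_normZ a f : dual_norm (a *: f) = `|a| * dual_norm f.
Proof.
have le b g : dual_norm (b *: g) <= `|b| * dual_norm g.
  apply: dual_norm_le => [|x]; first by rewrite mulr_ge0// dual_norm_ge0.
  by rewrite normrM -mulrA ler_wpM2l// le_dual_norm.
apply/eqP; rewrite eq_le le /=.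
have [->|a0] := eqVneq a 0; first by rewrite normr0 mul0r dual_norm_ge0.
rewrite -ler_pdivlMl ?normr_gt0// -normfV (le_trans _ (le _ _))//.
by rewrite scalerA mulVf// scale1r.
Qed.

Lemma dual_norm_eq0 f : dual_norm f = 0 -> f = 0.
Proof.
move=> f0; apply/val_inj/funext => x; rewrite -[RHS]/(0 : R); apply/eqP.
by rewrite -normr_le0 (le_trans (le_dual_norm f x))// f0 mul0r.
Qed.

HB.instance Definition _ := Lmodule_isNormed.Build R dual
  dual_normD dual_normZ dual_norm_eq0.

Lemma dual_complete (F : set_system dual) :
  ProperFilter F -> cauchy F -> cvg F.
Proof.
move: F.
apply: (@complete_from_eval R dual X dual_fun (fun x => `|x|)) => //.
- exact: le_dual_norm.
- exact: dual_norm_le.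
move=> F l FF Fl [C lC].
have linl : linear l.
  move=> a x y; apply: (@cvg_unique _ (@Rhausdorff R) (dual_fun f (a *: x + y) @[f --> F])).
    exact: Fl.
  rewrite (_ : (fun f : dual => _) = (fun f : dual => a *: f x + f y)); last first.
    by apply/funext => f; exact: dual_linear.
  by apply: cvgD; [apply: cvgZr|]; exact: Fl.
pose ll : {linear X -> R} := HB.pack l (GRing.isLinear.Build _ _ _ _ _ linl).
have ld : l \in dual_pred.
  rewrite inE; split=> //.
  apply: (@bounded_linear_continuous _ _ _ ll).
  apply/linear_boundedP; exists C; rewrite num_real; split=> // D CD x.
  by rewrite (le_trans (lC x))// ler_wpM2r// ltW.
by exists (Dual ld).
Qed.

HB.instance Definition _ := Uniform_isComplete.Build dual dual_complete.

End dual.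

Section weak_topologies.
Variables (R : realType) (X : normedModType R).

Definition weak_space : Type := @initial_topology X
  (prod_topology (fun=> R : topologicalType)) (fun (x : X) (f : dual X) => f x).
HB.instance Definition _ := Topological.on weak_space.

Definition weak_star_dual : Type := @initial_topology (dual X)
  (prod_topology (fun=> R : topologicalType)) (fun (f : dual X) (x : X) => f x).
HB.instance Definition _ := Topological.on weak_star_dual.

Definition dual_ball : set (dual X) := [set f | `|f| <= 1].

End weak_topologies.
Arguments dual_ball {R} X.

Definition separable_set (T : topologicalType) (B : set T) :=
  exists D : set T, [/\ countable D, D `<=` B & B `<=` closure D].

Section cwk.
Variables (R : realType) (X : completeNormedModType R).

Record cwk := Cwk {
  cwk_set :> set X ;
  cwk_nonempty : cwk_set !=set0 ;
  cwk_convex : convex_set cwk_set ;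
  cwk_weakly_compact : compact (cwk_set : set (weak_space X)) }.

Lemma weak_continuous (f : dual X) : continuous (f : weak_space X -> R).
Proof.
move=> x.
apply: (@continuous_comp (weak_space X) (prod_topology (fun=> R : topologicalType)) R
  (fun (x : X) (f : dual X) => f x) (proj f)).
  exact: initial_continuous.
exact: proj_continuous.
Qed.

Lemma cwk_bounded (A : cwk) :
  exists C, forall x (f : dual X), cwk_set A x -> `|f| <= 1 -> `|f x| <= C.
Proof.
pose F : set (dual X -> R) := [set (fun f : dual X => f x) | x in cwk_set A].
have Flin phi : F phi -> bounded_fun_norm phi /\ linear phi.
  move=> [x _ <-]; split=> // r; exists (r * `|x|) => f fr.
  by rewrite (le_trans (le_dual_norm f x))// ler_wpM2r.
have Fptw : pointwise_bounded F.
  move=> f.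
  have : compact (f @` (cwk_set A : set (weak_space X))).
    apply: continuous_compact (@cwk_weakly_compact A).
    exact/continuous_subspaceT/weak_continuous.
  move=> /compact_bounded[M [_ /(_ (M + 1))]].
  rewrite ltrDl => /(_ ltr01) fM; exists (M + 1) => _ [x Ax <-].
  by apply: fM; exists x.
have [M FM] := Banach_Steinhauss Flin Fptw 1.
by exists M => x f Ax f1; apply: (FM (fun f : dual X => f x)) => //; exists x.
Qed.

Definition support_fun (A : set X) (f : dual X) : R := sup [set f x | x in A].

Lemma support_fun_bounded (A : cwk) :
  (fun f : dual_ball X => support_fun A (val f)) \in bounded_pred R (dual_ball X).
Proof.
rewrite inE; have [C AC] := cwk_bounded A; exists C => -[f /= /set_mem/= f1].
have [x Ax] := cwk_nonempty A.
have fC y : cwk_set A y -> f y <= C by move=> Ay; rewrite (le_trans (ler_norm _))// AC.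
have fA : has_ubound [set f x | x in cwk_set A] by exists C => _ [y Ay <-]; exact: fC.
rewrite ler_norml; apply/andP; split.
  apply: (@le_trans _ _ (f x)); last by apply: ub_le_sup => //; exists x.
  by rewrite lerNl (le_trans (ler_norm _))// normrN AC.
by apply: ge_sup => [|_ [y Ay <-]]; [exists (f x), x|exact: fC].
Qed.

Definition radstrom (A : cwk) : linfty R (dual_ball X) :=
  Linfty (support_fun_bounded A).

End cwk.

Section set_operations.
Variables (R : realType) (X : normedModType R).

Definition hausdorff_dist (A B : set X) : \bar R :=
  maxe (ereal_sup [set ereal_inf [set `|a - b|%:E | b in B] | a in A])
       (ereal_sup [set ereal_inf [set `|a - b|%:E | a in A] | b in B]).

Definition minkowski_add (A B : set X) : set X :=
  [set a + b | a in A & b in B].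

Definition minkowski_scale (c : R) (A : set X) : set X :=
  [set c *: a | a in A].

Definition minkowski_sum (n : nat) (A : nat -> set X) : set X :=
  \big[minkowski_add/[set 0]]_(i < n) A i.

Definition closed_convex_hull (A : set X) : set X :=
  closure (\bigcap_(C in [set C : set X | convex_set C /\ A `<=` C]) C).

End set_operations.

#[short(type="topMeasurableType")]
HB.structure Definition TopMeasurable d := {T of Topological T & Measurable d T}.

Section quasi_radon.
Context (d : measure_display) (T : topMeasurableType d) (R : realType).
Local Open Scope ereal_scope.

Record quasi_radon (mu : {measure set T -> \bar R}) : Prop := QuasiRadon {
  qr_open_measurable : forall U : set T, open U -> measurable U ;
  qr_complete : measure_is_complete mu ;
  qr_semifinite : forall E : set T, measurable E -> mu E = +oo ->
    exists F, [/\ measurable F, F `<=` E & 0 < mu F < +oo] ;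
  qr_locally_determined : forall E : set T,
    (forall F, measurable F -> mu F < +oo -> measurable (E `&` F)) ->
    measurable E ;
  qr_tau_additive : forall G : set (set T),
    G !=set0 -> G `<=` open ->
    (forall U V, G U -> G V -> exists W, [/\ G W, U `<=` W & V `<=` W]) ->
    mu (\bigcup_(U in G) U) = ereal_sup [set mu U | U in G] ;
  qr_inner_regular : forall E : set T, measurable E ->
    mu E = ereal_sup [set mu K | K in [set K | closed K /\ K `<=` E]] ;
  qr_effectively_locally_finite : forall E : set T, measurable E -> 0 < mu E ->
    exists U, [/\ open U, mu U < +oo & 0 < mu (E `&` U)] }.

Definition outer_regular (mu : {measure set T -> \bar R}) :=
  forall B : set T, measurable B ->
    mu B = ereal_inf [set mu G | G in [set G | open G /\ B `<=` G]].

End quasi_radon.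

Section mcshane.
Context (d : measure_display) (T : topMeasurableType d) (R : realType)
  (X : completeNormedModType R) (mu : {measure set T -> \bar R}).

Definition gauge (Delta : T -> set T) :=
  forall s, open (Delta s) /\ Delta s s.

Record mcshane_partition (E : nat -> set T) (t : nat -> T) : Prop :=
  McShanePartition {
    mp_measurable : forall i, measurable (E i) ;
    mp_disjoint : trivIset [set: nat] E ;
    mp_finite : forall i, (mu (E i) < +oo)%E ;
    mp_cover : mu (~` \bigcup_i E i) = 0%E }.

Definition fine_partition (Delta : T -> set T) (E : nat -> set T)
  (t : nat -> T) := forall i, E i `<=` Delta (t i).

Definition is_mcshane_integral (F : T -> cwk X) (I : cwk X) :=
  forall e : R, 0 < e -> exists2 Delta, gauge Delta &
    forall E t, mcshane_partition E t -> fine_partition Delta E t ->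
      (limn_esup (fun n => hausdorff_dist I
         (minkowski_sum n (fun i => minkowski_scale (fine (mu (E i))) (F (t i)))))
       <= e%:E)%E.

Definition mcshane_integrable (F : T -> cwk X) :=
  exists I, is_mcshane_integral F I.

End mcshane.

Definition unconditionally_cvg (R : realType) (Z : normedModType R)
    (u : nat -> Z) :=
  forall s : nat -> nat, bijective s -> cvgn (series (u \o s)).

Section birkhoff.
Context (d : measure_display) (T : measurableType d) (R : realType)
  (mu : probability T R).

(* A countable partition is a sequence in which empty sets may be repeated, so
   that finite partitions are included. *)
Record countable_partition (A : nat -> set T) : Prop := CountablePartition {
  cp_measurable : forall n, measurable (A n) ;
  cp_disjoint : trivIset [set: nat] A ;
  cp_cover : \bigcup_n A n = [set: T] }.

(* Padding indices, where [A n] is empty, do not constrain [t n]: the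
   corresponding term below is multiplied by [mu set0 = 0]. *)
Definition partition_choice (A : nat -> set T) (t : nat -> T) :=
  forall n, A n !=set0 -> A n (t n).

Section banach_valued.
Variable Z : completeNormedModType R.

Definition birkhoff_term (f : T -> Z) (A : nat -> set T) (t : nat -> T)
  (n : nat) : Z := fine (mu (A n)) *: f (t n).

Definition summable_wrt (f : T -> Z) (A : nat -> set T) :=
  countable_partition A /\
  forall t, partition_choice A t -> unconditionally_cvg (birkhoff_term f A t).

Definition birkhoff_sums (f : T -> Z) (A : nat -> set T) : set Z :=
  [set limn (series (birkhoff_term f A t)) | t in partition_choice A].

Definition birkhoff_integrable (f : T -> Z) :=
  forall e : R, 0 < e -> exists2 A, summable_wrt f A &
    forall x y, birkhoff_sums f A x -> birkhoff_sums f A y -> `|x - y| <= e.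

(* The singleton says that [z] is the unique element of the intersection. *)
Definition is_birkhoff_integral (f : T -> Z) (z : Z) :=
  birkhoff_integrable f /\
  \bigcap_(A in summable_wrt f) closed_convex_hull (birkhoff_sums f A) = [set z].

End banach_valued.

Variable X : completeNormedModType R.

Definition cwk_birkhoff_integrable (F : T -> cwk X) :=
  birkhoff_integrable (@radstrom R X \o F).

Definition is_cwk_birkhoff_integral (F : T -> cwk X) (I : cwk X) :=
  is_birkhoff_integral (@radstrom R X \o F) (radstrom I).

End birkhoff.

(* Main.v *)
Require Import Defs.
From HB Require Import structures.
From mathcomp Require Import all_boot all_order all_algebra.
From mathcomp Require Import all_classical all_reals all_analysis.
From mathcomp Require Import ring lra.

Set Implicit Arguments.
Unset Strict Implicit.
Unset Printing Implicit Defensive.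

Import Order.TTheory GRing.Theory Num.Theory.
Import numFieldNormedType.Exports.

Local Open Scope classical_set_scope.
Local Open Scope ring_scope.

(** Write [G] for [radstrom] composed with the multifunction. Its McShane
    integral is the limit of finite Riemann sums over gauge-fine families
    covering almost all of the space.

    If [G] is Birkhoff integrable, the pieces of a good partition are enclosed
    in slightly larger open sets by outer regularity; these sets form the gauge.
    Separability plays no role here.

    Conversely, weak* separability gives countably many functionals that norm
    the span of the support functions, so only the sequence [f k] of the
    corresponding coordinates of [G] matters, and their Riemann sums converge
    uniformly in [k]. There is a countable measurable partition such that each
    [f k] is nearly constant on the pieces outside a union of pieces of small
    measure. Otherwise some [a < b] and some non-null set [A] would have the
    property that any finitely many non-null parts of [A] are all met in
    positive measure by both [f k < a] and [f k > b] for a common [k]; by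
    tau-additivity finitely many parts suffice to choose fine Riemann sums on
    [A] with tags in either level set, and these differ by [(b - a) mu A].

    The limit lies in the closed convex hull of every set of Birkhoff sums
    because a fine family refining the partition averages its tags over the
    pieces. *)

(** * Sublinear functionals and separation *)

Section hahn_banach.
Variables (R : realType) (V : lmodType R).

Definition sublinear (q : V -> R) :=
  (forall v w, q (v + w) <= q v + q w) /\
  (forall a v, 0 <= a -> q (a *: v) = a * q v).

Lemma sublinear0 q : sublinear q -> q 0 = 0.
Proof. by case=> _ qZ; rewrite -(scale0r 0) qZ// mul0r. Qed.

Lemma sublinear_opp_ge q v : sublinear q -> - q (- v) <= q v.
Proof.
move=> qs; have := qs.1 v (- v).
by rewrite subrr sublinear0//; lra.
Qed.

(* The sublinear functional is
   [v |-> inf {q (v - s *: y) + s * c | s >= 0, y in C}]. *)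
Lemma sublinear_below_on_convex (q : V -> R) (C : set V) (c : R) :
  sublinear q -> C !=set0 ->
  (forall y z a, C y -> C z -> 0 <= a <= 1 -> C (a *: y + (1 - a) *: z)) ->
  (forall y, C y -> - c <= q (- y)) ->
  exists p, [/\ sublinear p, forall v, p v <= q v & forall y, C y -> p y <= c].
Proof.
move=> qs [y0 Cy0] Cconv Cc.
pose A v : set R := [set r | exists (s : R) y, [/\ 0 <= s, C y & r = q (v - s *: y) + s * c]].
have lbA v : lbound (A v) (- q (- v)).
  move=> _ [s [y [s0 Cy ->]]].
  have := qs.1 (v - s *: y) (- v); rewrite addrAC subrr add0r -scalerN qs.2//.
  have := ler_wpM2l s0 (Cc _ Cy); lra.
have hA v : has_inf (A v).
  split; last by exists (- q (- v)); exact: lbA.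
  by exists (q (v - 0 *: y0) + 0 * c), 0, y0.
pose p v := inf (A v).
have pA v r : A v r -> p v <= r by move=> Ar; exact: (@ge_inf _ (A v) (hA v).2 r Ar).
have pZ1 a v : 0 < a -> p (a *: v) <= a * p v.
  move=> a0; rewrite -ler_pdivrMl//; apply: lb_le_inf; first exact: (hA v).1.
  move=> _ [s [y [s0 Cy ->]]]; rewrite ler_pdivrMl//; apply: pA.
  exists (a * s), y; split=> //; first by rewrite mulr_ge0// ltW.
  by rewrite -scalerA -scalerBr qs.2 ?ltW// mulrDr mulrA.
exists p; split; last 2 first.
- move=> v; apply: pA; exists 0, y0; split => //.
  by rewrite scale0r subr0 mul0r addr0.
- move=> y Cy; apply: pA; exists 1, y; split => //.
  by rewrite scale1r subrr sublinear0// add0r mul1r.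
split=> [v w|a v].
- rewrite -lerBlDr; apply: lb_le_inf; first exact: (hA v).1.
  move=> _ [s [y [s0 Cy ->]]]; rewrite lerBlDr -lerBlDl.
  apply: lb_le_inf; first exact: (hA w).1.
  move=> _ [t [z [t0 Cz ->]]]; rewrite lerBlDl.
  have [st0|st0] := eqVneq (s + t) 0.
    have [s00 t00] : s = 0 /\ t = 0 by lra.
    subst s t; apply: (@le_trans _ _ (q (v + w))); last first.
      by rewrite !scale0r !subr0 !mul0r !addr0 qs.1.
    by apply: pA; exists 0, y; split; rewrite // scale0r subr0 mul0r addr0.
  have stp : 0 < s + t by rewrite lt0r st0 addr_ge0.
  pose x := (s / (s + t)) *: y + (1 - s / (s + t)) *: z.
  have Cx : C x.
    by apply: Cconv => //; rewrite divr_ge0 ?ler_pdivrMr ?mul1r ?lerDl ?(ltW stp).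
  have xE : (s + t) *: x = s *: y + t *: z.
    rewrite scalerDr !scalerA; congr (_ *: _ + _ *: _); first by field.
    by field.
  apply: (@le_trans _ _ (q (v + w - (s + t) *: x) + (s + t) * c)).
    by apply: pA; exists (s + t), x; split=> //; exact: ltW.
  rewrite xE opprD addrACA mulrDl [leRHS]addrACA lerD2r; exact: qs.1.
- rewrite le_eqVlt => /orP[/eqP<-|a0].
    rewrite scale0r mul0r; apply/eqP; rewrite eq_le; apply/andP; split.
      rewrite -[leRHS](sublinear0 qs).
      by apply: pA; exists 0, y0; split; rewrite // scale0r subr0 mul0r addr0.
    apply: lb_le_inf; first exact: (hA 0).1.
    by move=> r /lbA; rewrite oppr0 sublinear0// oppr0.
  apply/eqP; rewrite eq_le pZ1//= -ler_pdivlMl//.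
  have := pZ1 a^-1 (a *: v); rewrite invr_gt0 => /(_ a0).
  by rewrite scalerA mulVf ?gt_eqF// scale1r.
Qed.

Lemma sublinear_minimal_linear (p : V -> R) : sublinear p ->
  (forall p', sublinear p' -> (forall v, p' v <= p v) -> p' = p) ->
  forall a v w, p (a *: v + w) = a * p v + p w.
Proof.
move=> ps pmin.
have pN y : p (- y) = - p y.
  have [|||p' [p's p'p p'y]] :=
    @sublinear_below_on_convex p [set - y] (- p y) ps.
  - by exists (- y).
  - move=> _ _ a -> -> _; rewrite -scalerDl addrCA subrr addr0 scale1r; exact: erefl.
  - by move=> _ ->; rewrite !opprK.
  have := p'y _ erefl; rewrite (pmin p')// => pNy.
  apply/eqP; rewrite eq_le pNy /=.
  by have := sublinear_opp_ge y ps; lra.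
have pD v w : p (v + w) = p v + p w.
  apply/eqP; rewrite eq_le ps.1 /=.
  have := ps.1 (- v) (- w); rewrite -opprD !pN; lra.
move=> a v w; rewrite pD; congr (_ + _).
have [a0|a0] := leP 0 a; first exact: ps.2.
by rewrite -[a *: v]opprK -scaleNr pN ps.2 ?oppr_ge0 ?(ltW a0)// mulNr opprK.
Qed.

Lemma sublinear_above_linear (q : V -> R) : sublinear q ->
  exists l : V -> R, (forall a v w, l (a *: v + w) = a * l v + l w) /\
    forall v, l v <= q v.
Proof.
move=> qs.
pose T := {p : V -> R | sublinear p /\ forall v, p v <= q v}.
pose le (p p' : T) := `[< forall v, sval p' v <= sval p v >].
have [||p p' /asboolP pp' /asboolP p'p|C Ctot|[p [ps pq]] pmax] := @Zorn T le.
- by move=> p; apply/asboolP.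
- move=> p p' p'' /asboolP h /asboolP h'; apply/asboolP => v.
  exact: le_trans (h' v) (h v).
- case: p p' pp' p'p => [p Pp] [p' Pp'] /= pp' p'p; apply: eq_exist; apply/funext => v; apply/eqP.
  by rewrite eq_le p'p pp'.
- have [->|/set0P[p0 Cp0]] := eqVneq C set0.
    by exists (exist _ q (conj qs (fun=> lexx _))).
  pose A v : set R := [set sval p v | p in C].
  have hA v : has_inf (A v).
    split; first by exists (sval p0 v), p0.
    exists (- q (- v)) => _ [[p [ps pq]] /= _ <-].
    by rewrite (le_trans _ (sublinear_opp_ge v ps))// lerN2.
  pose p v := inf (A v).
  have pC p' v : C p' -> p v <= sval p' v.
    by move=> Cp'; apply: (@ge_inf _ (A v)) (hA v).2 _ _; exists p'.
  have pge v r : (forall p', C p' -> r <= sval p' v) -> r <= p v.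
    by move=> h; apply: lb_le_inf (hA v).1 _ => _ [p' Cp' <-]; exact: h.
  have ps : sublinear p.
    split=> [v w|a v a0].
      rewrite -lerBlDr; apply: (pge) => p1 Cp1; rewrite lerBlDr -lerBlDl.
      apply: (pge) => p2 Cp2; rewrite lerBlDl.
      have [/asboolP h|/asboolP h] := Ctot _ _ Cp1 Cp2.
        rewrite (le_trans (pC _ _ Cp2))// (le_trans ((svalP p2).1.1 v w))//.
        by rewrite lerD2r.
      rewrite (le_trans (pC _ _ Cp1))// (le_trans ((svalP p1).1.1 v w))//.
      by rewrite lerD2l.
    apply/eqP; rewrite eq_le; apply/andP; split; last first.
      by apply: (pge) => p' Cp'; rewrite (svalP p').1.2// ler_wpM2l// pC.
    have [->|an0] := eqVneq a 0.
      rewrite scale0r mul0r -(sublinear0 (svalP p0).1); exact: pC.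
    have {an0} a1 : 0 < a by rewrite lt0r an0.
    rewrite -ler_pdivrMl//; apply: (pge) => p' Cp'.
    by rewrite ler_pdivrMl// -(svalP p').1.2// pC.
  have pq v : p v <= q v by apply: le_trans (pC _ v Cp0) _; exact: (svalP p0).2.
  exists (exist _ p (conj ps pq)) => p' Cp'; apply/asboolP => v; exact: pC.
- exists p; split=> //; apply: sublinear_minimal_linear => // p' p's p'p.
  have p'q v : p' v <= q v by exact: le_trans (p'p v) (pq v).
  have /(congr1 sval)// : exist _ p' (conj p's p'q) = exist _ p (conj ps pq) :> T.
  by apply: pmax; apply/asboolP.
Qed.

Lemma separation_linear (q : V -> R) (C : set V) (c : R) :
  sublinear q -> C !=set0 ->
  (forall y z a, C y -> C z -> 0 <= a <= 1 -> C (a *: y + (1 - a) *: z)) ->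
  (forall y, C y -> - c <= q (- y)) ->
  exists l : V -> R, [/\ forall a v w, l (a *: v + w) = a * l v + l w,
    forall v, l v <= q v & forall y, C y -> l y <= c].
Proof.
move=> qs C0 Cc Cq.
have [p [ps pq pc]] := sublinear_below_on_convex qs C0 Cc Cq.
have [l [ll lp]] := sublinear_above_linear ps.
exists l; split=> // [v|y Cy]; first exact: le_trans (lp v) (pq v).
exact: le_trans (lp y) (pc y Cy).
Qed.

End hahn_banach.

Section functionals.
Variables (R : realType) (X : completeNormedModType R).
Implicit Types (f : dual X) (x : X).

Lemma dualD f x y : f (x + y) = f x + f y.
Proof. by have := dual_linear f 1 x y; rewrite !scale1r. Qed.

Lemma dualB f x y : f (x - y) = f x - f y.
Proof. by rewrite dualD -scaleN1r dualZ mulN1r. Qed.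

Lemma dual_ball_le f x : `|f| <= 1 -> `|f x| <= `|x|.
Proof.
move=> f1; rewrite (le_trans (le_dual_norm f x))//.
by rewrite -[leRHS]mul1r ler_wpM2r.
Qed.

Lemma dual_sum n (f : 'I_n -> dual X) x :
  (\sum_i f i : dual X) x = \sum_i f i x.
Proof.
elim: n f => [f|n IH f]; first by rewrite !big_ord0.
by rewrite !big_ord_recr /= -IH.
Qed.

Lemma dual_of_le_norm (l : X -> R) :
  (forall a x y, l (a *: x + y) = a * l x + l y) ->
  (forall x, l x <= `|x|) -> exists f, (f : X -> R) = l /\ `|f| <= 1.
Proof.
move=> ll lx.
pose lf : {linear X -> R} := HB.pack l (GRing.isLinear.Build _ _ _ _ _ ll).
have lN x : l (- x) = - l x by exact: (linearN lf).
have lb x : `|l x| <= `|x|.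
  by rewrite ler_norml lx andbT lerNl -lN -normrN lx.
have ld : l \in @dual_pred R X.
  rewrite inE; split=> //; apply: (@bounded_linear_continuous _ _ _ lf).
  apply/linear_boundedP; exists 1; rewrite num_real; split=> // D D1 x.
  by rewrite (le_trans (lb x))// -[leLHS]mul1r ler_wpM2r// ltW.
exists (Dual ld); split=> //; apply: dual_norm_le => // x.
by rewrite mul1r.
Qed.

Lemma norm_sublinear : sublinear (fun x => `|x|).
Proof. by split=> [x y|a x a0]; rewrite ?ler_normD// normrZ ger0_norm. Qed.

Lemma norming_functional x : exists2 f : dual X, `|f| <= 1 & f x = `|x|.
Proof.
have [|||l [ll lq lc]] := @separation_linear _ _ _ [set - x] (- `|x|)
  norm_sublinear.
- by exists (- x).
- by move=> _ _ a -> -> _; rewrite -scalerDl addrCA subrr addr0 scale1r; exact: erefl.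
- by move=> _ ->; rewrite !opprK.
have [f [fE f1]] := dual_of_le_norm ll lq; exists f => //.
apply/eqP; rewrite eq_le (le_trans (ler_norm _) (dual_ball_le _ f1))/=.
have := lc _ erefl; rewrite -fE -[- x]scaleN1r dualZ; lra.
Qed.

Lemma norm_le_functionals x C :
  (forall f, `|f| <= 1 -> f x <= C) -> `|x| <= C.
Proof. by move=> h; have [f f1 <-] := norming_functional x; exact: h. Qed.

Lemma convex_setP (A : set X) : convex_set A <->
  forall x y (a : R), A x -> A y -> 0 <= a <= 1 -> A (a *: x + (1 - a) *: y).
Proof.
split=> [h x y a Ax Ay /andP[a0 a1]|h x y l].
  by have := h x y (Itv01 a0 a1); rewrite !inE; apply.
rewrite !inE => Ax Ay; apply: h => //.
by rewrite ge0 le1.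
Qed.

Lemma initial_cvg (S : choiceType) (T : topologicalType) (f : S -> T)
    (F : set_system S) (s : S) : Filter F ->
  f @ F --> f s -> F --> (s : initial_topology f).
Proof.
move=> FF h A [B [[C Co <-] Cfs] sBA]; apply: filterS sBA _.
by apply: h; exact: open_nbhs_nbhs.
Qed.

Lemma weak_cvg (F : set_system X) x : Filter F ->
  (forall f, f @ F --> f x) -> F --> (x : weak_space X).
Proof.
move=> FF h; apply: initial_cvg; apply/cvg_sup => f; apply: initial_cvg.
exact: h.
Qed.

Lemma weak_compactP (A : set X) : compact (A : set (weak_space X)) <->
  forall F : set_system X, UltraFilter F -> F A ->
    exists2 x, A x & forall f, f @ F --> f x.
Proof.
rewrite compact_ultra; split=> h F FU FA.
  have [x [Ax Fx]] := h F FU FA; exists x => // f.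
  apply: (@cvg_comp X X R (fun y : X => y) f F (nbhs (x : weak_space X))) => //.
  exact: (@weak_continuous R _ f x).
have [x Ax Fx] := h F FU FA; exists x; split=> //; exact: weak_cvg.
Qed.

End functionals.

(** * Weakly compact convex sets and the Radstrom embedding *)

Section cwk_operations.
Variables (R : realType) (X : completeNormedModType R).
Implicit Types (A B : cwk X) (f : dual X).

Lemma cvg_along_ultra (T Y : Type) (U : set_system T) (g : T -> Y) :
  UltraFilter U -> UltraFilter (g @ U).
Proof.
move=> UU; apply: Build_UltraFilter => H FH UH.
have hU (B : set Y) : H B -> U (g @^-1` B).
  move=> HB; have [//|UnB] := in_ultra_setVsetC (g @^-1` B) UU.
  have HnB : H (~` B) by apply: UH.
  by have [y []] := filter_ex (filterI HB HnB).
by apply/seteqP; split=> // B /hU.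
Qed.

Lemma cwk_ultra_cvg (T : Type) (U : set_system T) (A : cwk X) (g : T -> X) :
  UltraFilter U -> (\forall t \near U, cwk_set A (g t)) ->
  exists2 x, cwk_set A x & forall f, f (g t) @[t --> U] --> f x.
Proof.
move=> UU UA; have /weak_compactP/(_ (g @ U)) := @cwk_weakly_compact _ _ A.
by apply=> //; exact: cvg_along_ultra.
Qed.

Lemma cwk_addP A B : exists C : cwk X, cwk_set C = minkowski_add A B.
Proof.
have c0 : minkowski_add A B !=set0.
  have [[a Aa] [b Bb]] := (cwk_nonempty A, cwk_nonempty B).
  by exists (a + b), a => //; exists b.
have cc : convex_set (minkowski_add A B).
  apply/convex_setP => _ _ t [a Aa [b Bb <-]] [a' Aa' [b' Bb' <-]] t01.
  exists (t *: a + (1 - t) *: a').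
    by move/convex_setP : (@cwk_convex _ _ A); apply.
  exists (t *: b + (1 - t) *: b').
    by move/convex_setP : (@cwk_convex _ _ B); apply.
  by rewrite !scalerDr addrACA.
suff ck : compact (minkowski_add A B : set (weak_space X)) by exists (Cwk c0 cc ck).
apply/weak_compactP => U UU UAB.
have [g gP] : {g : X -> X * X & forall x, minkowski_add A B x ->
    [/\ cwk_set A (g x).1, cwk_set B (g x).2 & (g x).1 + (g x).2 = x]}.
  apply: (@choice X (X * X)%type (fun x y => minkowski_add A B x ->
    [/\ cwk_set A y.1, cwk_set B y.2 & y.1 + y.2 = x])) => x.
  have [[a Aa [b Bb abx]]|nx] := pselect (minkowski_add A B x).
    by exists (a, b).
  by exists (0, 0).
have [|a Aa ca] := @cwk_ultra_cvg _ U A (fun x => (g x).1) UU.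
  by apply: filterS UAB => x /gP[].
have [|b Bb cb] := @cwk_ultra_cvg _ U B (fun x => (g x).2) UU.
  by apply: filterS UAB => x /gP[].
exists (a + b); first by exists a => //; exists b.
move=> f; rewrite dualD; apply: cvg_trans (cvgD (ca f) (cb f)).
apply: near_eq_cvg; apply: filterS UAB => x /gP[_ _ xE].
have -> : f x = f ((g x).1 + (g x).2) by rewrite xE.
by rewrite dualD.
Qed.

Lemma real_compact_ultra (T : Type) (U : set_system T) (g : T -> R) (a b : R) :
  UltraFilter U -> (forall t, a <= g t <= b) ->
  exists2 l, a <= l <= b & g t @[t --> U] --> l.
Proof.
move=> UU gab; have := @segment_compact R a b; rewrite compact_ultra.
move=> /(_ (g @ U) (cvg_along_ultra g UU)) [].
  by apply: (@filterS _ U _ setT) filterT => t _ /=; rewrite in_itv/=.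
by move=> l [/= + gl]; rewrite in_itv/=; exists l.
Qed.

Lemma cwk_scaleP (c : R) A : exists C : cwk X, cwk_set C = minkowski_scale c A.
Proof.
have c0 : minkowski_scale c A !=set0.
  by have [a Aa] := cwk_nonempty A; exists (c *: a), a.
have cc : convex_set (minkowski_scale c A).
  apply/convex_setP => _ _ t [a Aa <-] [a' Aa' <-] t01.
  exists (t *: a + (1 - t) *: a').
    by move/convex_setP : (@cwk_convex _ _ A); apply.
  by rewrite scalerDr !scalerA mulrC [c * (1 - t)]mulrC.
suff ck : compact (minkowski_scale c A : set (weak_space X)) by exists (Cwk c0 cc ck).
apply/weak_compactP => U UU UA.
have [g gP] : {g : X -> X & forall x, minkowski_scale c A x ->
    cwk_set A (g x) /\ c *: g x = x}.
  apply: (@choice X X (fun x y => minkowski_scale c A x ->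
    cwk_set A y /\ c *: y = x)) => x.
  have [[a Aa ax]|nx] := pselect (minkowski_scale c A x); first by exists a.
  by exists 0.
have [|a Aa ca] := @cwk_ultra_cvg _ U A g UU.
  by apply: filterS UA => x /gP[].
exists (c *: a); first by exists a.
move=> f; rewrite dualZ; apply: cvg_trans (cvgZr (k := c) (ca f)).
apply: near_eq_cvg; apply: filterS UA => x /gP[_ xE].
have -> : f x = f (c *: g x) by rewrite xE.
by rewrite dualZ.
Qed.

Lemma cwk_cone_segmentP A : exists C : cwk X,
  cwk_set C = [set x | exists (t : R) a, [/\ 0 <= t <= 1, cwk_set A a & x = t *: a]].
Proof.
set S := [set _ | _].
have c0 : S !=set0.
  have [a Aa] := cwk_nonempty A.
  by exists (0 *: a), 0, a; rewrite lexx ler01.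
have cc : convex_set S.
  apply/convex_setP => _ _ t [u [a [/andP[u1 u2] Aa ->]]]
    [v [b [/andP[v1 v2] Ab ->]]] /andP[t0 t1].
  have tu : 0 <= t * u by rewrite mulr_ge0.
  have tv : 0 <= (1 - t) * v by rewrite mulr_ge0// subr_ge0.
  rewrite !scalerA; have [w0|w0] := eqVneq (t * u + (1 - t) * v) 0.
    exists 0, a; rewrite lexx ler01; split=> //.
    have [-> ->] : t * u = 0 /\ (1 - t) * v = 0 by lra.
    by rewrite !scale0r addr0.
  have w : 0 < t * u + (1 - t) * v by rewrite lt0r w0 addr_ge0.
  exists (t * u + (1 - t) * v).
  exists ((t * u / (t * u + (1 - t) * v)) *: a +
          (1 - t * u / (t * u + (1 - t) * v)) *: b); split.
  + by apply/andP; split; nra.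
  + move/convex_setP : (@cwk_convex _ _ A); apply => //.
    by rewrite divr_ge0 ?(ltW w)//= ler_pdivrMr// mul1r lerDl.
  + rewrite scalerDr !scalerA; congr (_ *: _ + _ *: _); by field.
suff ck : compact (S : set (weak_space X)) by exists (Cwk c0 cc ck).
apply/weak_compactP => U UU US.
have [g gP] : {g : X -> R * X & forall x, 0 <= (g x).1 <= 1 /\ (S x ->
    cwk_set A (g x).2 /\ (g x).1 *: (g x).2 = x)}.
  apply: (@choice X (R * X)%type (fun x y => 0 <= y.1 <= 1 /\ (S x ->
    cwk_set A y.2 /\ y.1 *: y.2 = x))) => x.
  have [[t [a [t01 Aa xE]]]|nx] := pselect (S x); first by exists (t, a).
  by exists (0, 0); rewrite /= lexx ler01.
have [|a Aa ca] := @cwk_ultra_cvg _ U A (fun x => (g x).2) UU.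
  by apply: filterS US => x /((gP x).2)[].
have [t t01 ct] := real_compact_ultra UU (fun x => (gP x).1).
exists (t *: a); first by exists t, a.
move=> f; rewrite dualZ; apply: cvg_trans (cvgM ct (ca f)).
apply: near_eq_cvg; apply: filterS US => x /((gP x).2)[_ xE].
have -> : f x = f ((g x).1 *: (g x).2) by rewrite xE.
by rewrite dualZ.
Qed.

Lemma support_has_sup A f : has_sup [set f x | x in cwk_set A].
Proof.
split; first by have [a Aa] := cwk_nonempty A; exists (f a), a.
have : compact (f @` (cwk_set A : set (weak_space X))).
  apply: continuous_compact (@cwk_weakly_compact _ _ A).
  exact/continuous_subspaceT/weak_continuous.
by move=> /compact_bounded[M [_ /(_ (M + 1))]]; rewrite ltrDl => /(_ ltr01) fM;
  exists (M + 1) => _ [x Ax <-]; rewrite (le_trans (ler_norm _))// fM//; exists x.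
Qed.

Lemma le_support A f x : cwk_set A x -> f x <= support_fun A f.
Proof.
by move=> Ax; apply: ub_le_sup; [exact: (support_has_sup A f).2|exists x].
Qed.

Lemma support_le A f C : (forall x, cwk_set A x -> f x <= C) ->
  support_fun A f <= C.
Proof.
move=> h; apply: ge_sup; first exact: (support_has_sup A f).1.
by move=> _ [x Ax <-]; exact: h.
Qed.

Lemma support_add A B C f : cwk_set C = minkowski_add A B ->
  support_fun C f = support_fun A f + support_fun B f.
Proof.
move=> CE; apply/eqP; rewrite eq_le; apply/andP; split.
  apply: support_le => x; rewrite CE => -[a Aa [b Bb <-]].
  by rewrite dualD lerD// le_support.
rewrite -lerBrDr; apply: support_le => a Aa; rewrite lerBrDr -lerBrDl.
apply: support_le => b Bb; rewrite lerBrDl -dualD le_support// CE.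
by exists a => //; exists b.
Qed.

Lemma support_scale (c : R) A C f : 0 <= c -> cwk_set C = minkowski_scale c A ->
  support_fun C f = c * support_fun A f.
Proof.
move=> c0 CE; apply/eqP; rewrite eq_le; apply/andP; split.
  apply: support_le => x; rewrite CE => -[a Aa <-].
  by rewrite dualZ ler_wpM2l// le_support.
have [cE|cn0] := eqVneq c 0.
  have [a Aa] := cwk_nonempty A.
  rewrite cE mul0r -(mul0r (f a)) -dualZ le_support// CE.
  by exists a; rewrite // cE.
have {cn0 c0} c0 : 0 < c by rewrite lt0r cn0.
rewrite -ler_pdivlMl//; apply: support_le => a Aa.
by rewrite ler_pdivlMl// -dualZ le_support// CE; exists a.
Qed.

Lemma cwk_zeroP : exists C : cwk X, cwk_set C = [set 0].
Proof.
have cc : convex_set ([set 0] : set X).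
  by apply/convex_setP => _ _ t -> -> _; rewrite !scaler0 addr0.
suff ck : compact ([set 0] : set (weak_space X)).
  by exists (Cwk (ex_intro _ 0 erefl) cc ck).
exact: compact_set1.
Qed.

Lemma minkowski_sumP n (c : nat -> R) (A : nat -> cwk X) :
  (forall i, 0 <= c i) -> exists2 C : cwk X,
    cwk_set C = minkowski_sum n (fun i => minkowski_scale (c i) (A i)) &
    radstrom C = \sum_(i < n) c i *: radstrom (A i).
Proof.
elim: n c A => [|n IH] c A c0.
  have [C CE] := cwk_zeroP; exists C; first by rewrite /minkowski_sum big_ord0.
  rewrite big_ord0; apply/val_inj/funext => -[f fP] /=.
  rewrite /support_fun CE image_set1 sup1 -(scale0r 0) dualZ mul0r; exact: erefl.
have [//|C CE Cr] := IH (fun i => c i.+1) (fun i => A i.+1).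
have [D DE] := cwk_scaleP (c 0) (A 0).
have [E EE] := cwk_addP D C.
exists E; first by rewrite EE /minkowski_sum big_ord_recl /= DE CE.
rewrite big_ord_recl; rewrite /= in Cr *.
transitivity (c 0%N *: radstrom (A 0%N) + radstrom C); last by rewrite Cr.
apply/val_inj/funext => -[f fP] /=.
by rewrite (support_add _ EE) (support_scale _ (c0 _) DE).
Qed.

End cwk_operations.

Section radstrom_embedding.
Variables (R : realType) (X : completeNormedModType R).
Implicit Types (A B : cwk X) (f : dual X).

Lemma le_radstromB A B f : `|f| <= 1 ->
  support_fun A f <= support_fun B f + `|radstrom A - radstrom B|.
Proof.
move=> f1; have fB : f \in dual_ball X by rewrite inE.
rewrite -lerBlDl; apply: le_trans (ler_norm _) _.
exact: (le_linfty_norm (radstrom A - radstrom B) (exist _ f fB)).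
Qed.

Lemma radstromB_le A B C : 0 <= C ->
  (forall f, `|f| <= 1 -> support_fun A f <= support_fun B f + C) ->
  (forall f, `|f| <= 1 -> support_fun B f <= support_fun A f + C) ->
  `|radstrom A - radstrom B| <= C.
Proof.
move=> C0 AB BA; apply: linfty_norm_le => // -[f fB] /=.
have f1 : `|f| <= 1 by move: fB; rewrite inE.
rewrite ler_norml; apply/andP; split.
  by have := BA _ f1; rewrite -[_ (exist _ f fB)]/(support_fun A f - support_fun B f); lra.
by have := AB _ f1; rewrite -[_ (exist _ f fB)]/(support_fun A f - support_fun B f); lra.
Qed.

Lemma near_cwk A x (c c' : R) :
  (forall f, `|f| <= 1 -> f x <= support_fun A f + c) -> c < c' ->
  exists2 a, cwk_set A a & `|x - a| < c'.
Proof.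
move=> xA cc'; apply: contrapT => h.
have {}h a : cwk_set A a -> c' <= `|x - a|.
  by move=> Aa; rewrite leNgt; apply/negP => xa; apply: h; exists a.
have [|||l [ll lq lc]] := @separation_linear _ _ _ [set a - x | a in cwk_set A] (- c')
  (norm_sublinear X).
- by have [a Aa] := cwk_nonempty A; exists (a - x), a.
- move=> _ _ t [a Aa <-] [b Ab <-] t01; exists (t *: a + (1 - t) *: b).
    by move/convex_setP : (@cwk_convex _ _ A); apply.
  by rewrite !scalerBr addrACA -opprD -[t *: x + _]scalerDl addrCA subrr addr0 scale1r.
- by move=> _ [a Aa <-]; rewrite !opprK opprB h.
have [f [fE f1]] := dual_of_le_norm ll lq.
have := xA _ f1; apply/negP; rewrite -ltNge -ltrBrDr.
apply: (@le_lt_trans _ _ (f x - c')); last lra.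
apply: support_le => a Aa; have := lc _ (imageP _ Aa); rewrite -fE dualB; lra.
Qed.

Lemma hausdorff_radstrom A B :
  hausdorff_dist (cwk_set A) (cwk_set B) = `|radstrom A - radstrom B|%:E.
Proof.
have half (A' B' : cwk X) : (ereal_sup [set ereal_inf [set `|a - b|%:E | b in cwk_set B'] |
    a in cwk_set A'] <= `|radstrom A' - radstrom B'|%:E)%E.
  apply: ge_ereal_sup => _ [a Aa <-]; apply/lee_addgt0Pr => e e0.
  have [b Bb ab] : exists2 b, cwk_set B' b &
      `|a - b| < `|radstrom A' - radstrom B'| + e.
    apply: (@near_cwk _ _ `|radstrom A' - radstrom B'|); last by rewrite ltrDl.
    by move=> f f1; rewrite (le_trans (le_support f Aa))// le_radstromB.
  apply: ereal_inf_le; exists `|a - b|%:E; first by exists b.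
  by rewrite -EFinD lee_fin ltW.
have lb (A' B' : cwk X) (D : \bar R) :
    (ereal_sup [set ereal_inf [set `|a - b|%:E | b in cwk_set B'] |
      a in cwk_set A'] <= D)%E -> forall r, D = r%:E -> 0 <= r -> forall f, `|f| <= 1 ->
      support_fun A' f <= support_fun B' f + r.
  move=> + r Dr r0 f f1; rewrite {}Dr => hD.
  apply: support_le => a Aa; apply/ler_addgt0Pr => e e0.
  have : (ereal_inf [set `|a - b|%:E | b in cwk_set B'] < (r + e)%:E)%E.
    apply: (@le_lt_trans _ _ r%:E); last by rewrite lte_fin ltrDl.
    by apply: le_trans hD; apply: ereal_sup_ubound; exists a.
  move=> /ereal_inf_lt[_ [b Bb <-]]; rewrite lte_fin => ab.
  rewrite -[f a](subrK (f b)) -dualB addrC -addrA lerD ?le_support//.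
  by rewrite (le_trans (le_trans (ler_norm _) (dual_ball_le _ f1)))// ltW.
rewrite /hausdorff_dist.
have E2 : ereal_sup [set ereal_inf [set `|a - b|%:E | a in cwk_set A] | b in cwk_set B] =
    ereal_sup [set ereal_inf [set `|a - b|%:E | b in cwk_set A] | a in cwk_set B].
  congr ereal_sup; apply: eq_imagel => b Bb; congr ereal_inf.
  by apply: eq_imagel => a Aa; rewrite distrC.
rewrite E2; apply/eqP; rewrite eq_le; apply/andP; split.
  by rewrite ge_max half /= distrC half.
set D := maxe _ _.
have D0 : (0 <= D)%E.
  have [a Aa] := cwk_nonempty A.
  rewrite /D le_max; apply/orP; left.
  apply: (@le_trans _ _ (ereal_inf [set `|a - b|%:E | b in cwk_set B])); last first.
    by apply: ereal_sup_ubound; exists a.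
  by apply: le_ereal_inf_tmp => _ [b _ <-]; rewrite lee_fin.
have Dfin : (D <= `|radstrom A - radstrom B|%:E)%E.
  by rewrite /D ge_max half /= distrC half.
have DE : D = (fine D)%:E by rewrite fineK// ge0_fin_numE// (le_lt_trans Dfin)// ltry.
have D0' : 0 <= fine D by exact: fine_ge0.
rewrite DE lee_fin; apply: radstromB_le => // f f1.
  by apply: (lb _ _ D) => //; rewrite /D le_max lexx.
by apply: (lb _ _ D) => //; rewrite /D le_max lexx orbT.
Qed.

End radstrom_embedding.

Section limits.
Variable R : realType.

Lemma cvg_le_near (T : Type) (U : set_system T) (u : T -> R) (l C : R) {UU : ProperFilter U} :
  u t @[t --> U] --> l -> (\forall t \near U, u t <= C) -> l <= C.
Proof.
move=> ul uC; apply: (@closed_cvg _ _ U UU u [set x | x <= C]) => //.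
Qed.

Lemma cauchy_rate_cvg (V : completeNormedModType R) (y : nat -> V) (e : nat -> R) :
  e n @[n --> \oo] --> (0 : R) -> (forall m k, `|y m - y k| <= e m + e k) ->
  exists l, forall m, `|y m - l| <= e m.
Proof.
move=> e0 ye.
have yc : cvgn y.
  apply: cauchy_cvg; apply: cauchy_exP => r r0.
  have r2 : 0 < r / 2 by rewrite divr_gt0.
  have [N _ eN] : \forall n \near \oo, `|e n| < r / 2.
    by move/cvgr0Pnorm_lt : e0; apply.
  exists (y N); exists N => // n /= Nn; rewrite -ball_normE /=.
  rewrite (le_lt_trans (ye N n))// [ltRHS]splitr ltrD//.
    exact: le_lt_trans (ler_norm _) (eN N (leqnn _)).
  exact: le_lt_trans (ler_norm _) (eN n Nn).
exists (lim (y @ \oo)) => m.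
have cn : `|y m - y k| - e k @[k --> \oo] --> `|y m - lim (y @ \oo)| - 0.
  by apply: cvgB e0; apply: cvg_norm; apply: cvgB => //; exact: cvg_cst.
rewrite -[leLHS]subr0; apply: (cvg_le_near cn).
by apply: nearW => k; rewrite lerBlDr.
Qed.

End limits.

Section radstrom_closed.
Variables (R : realType) (X : completeNormedModType R).
Implicit Types (f : dual X).

Let e (n : nat) : R := n.+1%:R^-1.

Let e_gt0 n : 0 < e n. Proof. by rewrite invr_gt0. Qed.

Let e_cvg : e n @[n --> \oo] --> (0 : R). Proof. exact: cvg_harmonic. Qed.

(* Grothendieck's criterion: being within [e m] of a weakly compact set for
   every [m] suffices for weak compactness. *)
Lemma ultra_cvg_near_cwk (T : Type) (U : set_system T) (g : T -> X)
    (A : nat -> cwk X) : UltraFilter U ->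
  (forall m, \forall t \near U, exists2 a, cwk_set (A m) a & `|g t - a| <= e m) ->
  exists y, forall f, f (g t) @[t --> U] --> f y.
Proof.
move=> UU UA.
have [a aP] : {a : nat * T -> X & forall mt,
    (exists2 a, cwk_set (A mt.1) a & `|g mt.2 - a| <= e mt.1) ->
    cwk_set (A mt.1) (a mt) /\ `|g mt.2 - a mt| <= e mt.1}.
  apply: (@choice (nat * T)%type X (fun mt y =>
    (exists2 a, cwk_set (A mt.1) a & `|g mt.2 - a| <= e mt.1) ->
    cwk_set (A mt.1) y /\ `|g mt.2 - y| <= e mt.1)) => mt.
  have [[x Ax gx]|nx] := pselect (exists2 a, cwk_set (A mt.1) a & `|g mt.2 - a| <= e mt.1).
    by exists x.
  by exists 0.
have {aP}aP m : \forall t \near U, cwk_set (A m) (a (m, t)) /\ `|g t - a (m, t)| <= e m.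
  by apply: filterS (UA m) => t h; exact: (aP (m, t)).
have [y yP] : {y : nat -> X & forall m f, f (a (m, t)) @[t --> U] --> f (y m)}.
  apply: (@choice nat X (fun m y => forall f, f (a (m, t)) @[t --> U] --> f y)) => m.
  have [|y Ay cy] := @cwk_ultra_cvg _ _ T U (A m) (fun t => a (m, t)) UU.
    by apply: filterS (aP m) => t [].
  by exists y.
have [|l lP] := @cauchy_rate_cvg _ X y e e_cvg.
  move=> m k; apply: norm_le_functionals => f f1; rewrite dualB.
  apply: (cvg_le_near (cvgB (yP m f) (yP k f))).
  apply: filterS2 (aP m) (aP k) => t [_ h1] [_ h2].
  rewrite [leLHS](_ : _ = f (a (m, t) - a (k, t))); last by rewrite dualB.
  rewrite (le_trans (ler_norm _))// (le_trans (dual_ball_le _ f1))//.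
  rewrite -[a (m, t)](subrK (g t)) -addrA (le_trans (ler_normD _ _))//.
  by rewrite lerD// distrC.
exists l => f.
apply/cvgrPdist_le => r r0.
have F0 : 0 < `|f| + 1 by rewrite ltr_wpDl.
have r3 : 0 < r / 3 / (`|f| + 1) by rewrite !divr_gt0.
have [N _ eN] : \forall n \near \oo, `|e n| < r / 3 / (`|f| + 1).
  by move/cvgr0Pnorm_lt : e_cvg; apply.
have {}eN : (`|f| + 1) * e N <= r / 3.
  rewrite mulrC -ler_pdivlMr// ltW// (le_lt_trans (ler_norm _))//.
  exact: (eN N (leqnn _)).
have fle x : `|f x| <= (`|f| + 1) * `|x|.
  by rewrite (le_trans (le_dual_norm f x))// ler_wpM2r// lerDl.
have r3' : 0 < r / 3 by rewrite divr_gt0.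
have /cvgrPdist_le/(_ _ r3') cN := yP N f.
apply: filterS2 (aP N) cN => t [_ h1] h2.
have -> : f l - f (g t) = (f (y N) - f (a (N, t))) + (f (a (N, t) - g t) - f (y N - l)).
  by rewrite !dualB; ring.
rewrite (le_trans (ler_normD _ _))// (le_trans (lerD h2 (ler_normB _ _)))//.
have a1 : `|f (a (N, t) - g t)| <= r / 3.
  by rewrite (le_trans (fle _))// (le_trans _ eN)// ler_wpM2l ?(ltW F0)// distrC.
have a2 : `|f (y N - l)| <= r / 3.
  by rewrite (le_trans (fle _))// (le_trans _ eN)// ler_wpM2l ?(ltW F0)//.
lra.
Qed.

Lemma radstrom_closed (z : linfty R (dual_ball X)) :
  (forall r, 0 < r -> exists A : cwk X, `|radstrom A - z| <= r) ->
  exists I : cwk X, radstrom I = z.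
Proof.
move=> zA.
have [A AP] : {A : nat -> cwk X & forall n, `|radstrom (A n) - z| <= e n / 2}.
  apply: (@choice nat (cwk X) (fun n A => `|radstrom A - z| <= e n / 2)) => n.
  by apply: zA; rewrite divr_gt0.
have Az n (f : dual_ball X) : `|support_fun (A n) (val f) - z f| <= e n / 2.
  by rewrite (le_trans _ (AP n))//; exact: (le_linfty_norm (radstrom (A n) - z)).
pose S : set X := [set x | forall f : dual_ball X, val f x <= z f].
have dbE f (f1 : `|f| <= 1) : f \in dual_ball X by rewrite inE.
have SA x m : S x -> exists2 a, cwk_set (A m) a & `|x - a| <= e m.
  move=> Sx; have [f f1||a Aa xa] := @near_cwk _ _ (A m) x (e m / 2) (e m).
  - have := Sx (exist _ f (dbE f f1)); have := Az m (exist _ f (dbE f f1)).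
    rewrite ler_norml /= => /andP[h _]; lra.
  - by have := e_gt0 m; lra.
  - by exists a => //; exact: ltW.
have Scl (T : Type) (U : set_system T) (g : T -> X) (y : X) : UltraFilter U ->
    (forall f, f (g t) @[t --> U] --> f y) ->
    (forall (f : dual_ball X) r, 0 < r -> \forall t \near U, val f (g t) <= z f + r) ->
    S y.
  move=> UU gy gz f; apply/ler_addgt0Pr => r r0.
  exact: (cvg_le_near (gy (val f)) (gz f r r0)).
have Sc : convex_set S.
  apply/convex_setP => x y t Sx Sy /andP[t0 t1] f.
  rewrite dualD !dualZ; have := Sx f; have := Sy f => h1 h2.
  have : 0 <= 1 - t by rewrite subr_ge0.
  move=> /ler_wpM2l/(_ _ _ h1) => h3; have := ler_wpM2l t0 h2; lra.
have Sk : compact (S : set (weak_space X)).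
  apply/weak_compactP => U UU US.
  have [m|y yP] := @ultra_cvg_near_cwk X U id A UU.
    by apply: filterS US => x /SA.
  exists y => //; apply: (Scl _ _ _ _ UU yP) => f r r0.
  by apply: filterS US => x Sx; rewrite (le_trans (Sx f))// lerDl ltW.
(* Near-maximizers of [f] over [A n], along an ultrafilter on [n], converge to a
   point of [S] where [f] takes the value [z f]. *)
have [U [UU Uoo]] := @ultraFilterLemma nat \oo _.
have Umax (f : dual_ball X) : exists2 y, S y & val f y = z f.
  have [x xP] : {x : nat -> X & forall n, cwk_set (A n) (x n) /\
      support_fun (A n) (val f) - e n < val f (x n)}.
    apply: (@choice nat X (fun n x => cwk_set (A n) x /\
      support_fun (A n) (val f) - e n < val f x)) => n.
    have [_ [x Ax <-] h] := sup_adherent (e_gt0 n) (support_has_sup (A n) (val f)).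
    by exists x.
  have eU r : 0 < r -> \forall n \near U, e n < r.
    move=> r0; apply: Uoo; have /cvgr0Pnorm_lt/(_ _ r0) := e_cvg.
    by apply: filterS => n; exact/le_lt_trans/ler_norm.
  have xz (g : dual_ball X) n : val g (x n) <= z g + e n.
    have := Az n g; rewrite ler_norml => /andP[_ h].
    have := le_support (val g) (xP n).1; have := e_gt0 n; lra.
  have [m|y yP] := @ultra_cvg_near_cwk nat U x A UU.
    apply: filterS (eU (e m / 4) _) => [n en|]; last by rewrite divr_gt0.
    have [g g1||a Aa xa] := @near_cwk _ _ (A m) (x n) (e n + e m / 2) (e m).
    - have := xz (exist _ g (dbE g g1)) n; have := Az m (exist _ g (dbE g g1)).
      rewrite ler_norml /= => /andP[h _]; lra.
    - by have := e_gt0 m; lra.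
    - by exists a => //; exact: ltW.
  exists y.
    apply: (Scl _ _ _ _ UU yP) => g r r0.
    apply: filterS (eU _ r0) => n en; have := xz g n; lra.
  apply: (@cvg_unique _ (@Rhausdorff R) (val f (x t) @[t --> U])); first exact: yP.
  apply/cvgrPdist_le => r r0; have r2 : 0 < r / 2 by rewrite divr_gt0.
  apply: filterS (eU _ r2) => n en.
  have := xz f n; have [_] := xP n; have := Az n f; have := e_gt0 n.
  rewrite !ler_norml => ? /andP[? ?] ? ?; apply/andP; split; lra.
have S0 : S !=set0.
  have d0 : (0 : dual X) \in dual_ball X by rewrite inE /dual_ball /= normr0.
  by have [y Sy _] := Umax (exist _ 0 d0); exists y.
exists (Cwk S0 Sc Sk); apply/val_inj/funext => f.
rewrite -[LHS]/(support_fun (Cwk S0 Sc Sk) (val f)).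
apply/eqP; rewrite eq_le; apply/andP; split.
  by apply: support_le => x Sx; exact: Sx.
by have [y Sy yz] := Umax f; rewrite -[leLHS]yz; exact: le_support.
Qed.

End radstrom_closed.

(** * A countable norming family of functionals *)

Section minimax.
Variable R : realType.

Lemma rV_max_sublinear n :
  sublinear (fun v : 'rV[R]_n.+1 => \big[Order.max/v 0 0]_i v 0 i).
Proof.
have le v i : (v : 'rV[R]_n.+1) 0 i <= \big[Order.max/v 0 0]_i v 0 i.
  exact: le_bigmax.
split=> [v w|a v a0].
  by apply: bigmax_le => [|i _]; rewrite mxE lerD// le.
apply/eqP; rewrite eq_le; apply/andP; split.
  by apply: bigmax_le => [|i _]; rewrite mxE ler_wpM2l// le.
have [->|an0] := eqVneq a 0.
  by rewrite mul0r scale0r; apply: le_trans (le 0 0); rewrite mxE.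
have {an0} a1 : 0 < a by rewrite lt0r an0.
rewrite -ler_pdivlMl//; apply: bigmax_le => [|i _]; rewrite ler_pdivlMl//.
  by have := le (a *: v) 0; rewrite mxE.
by have := le (a *: v) i; rewrite mxE.
Qed.

Lemma finite_minimax n (C : set 'rV[R]_n.+1) (c : R) : C !=set0 ->
  (forall y z (a : R), C y -> C z -> 0 <= a <= 1 -> C (a *: y + (1 - a) *: z)) ->
  (forall y, C y -> exists i, y 0 i <= c) ->
  exists l : 'I_n.+1 -> R, [/\ forall i, 0 <= l i, \sum_i l i = 1 &
    forall y, C y -> \sum_i l i * y 0 i <= c].
Proof.
move=> C0 Cc Cy; pose q (v : 'rV[R]_n.+1) := \big[Order.max/v 0 0]_i v 0 i.
have qle (v : 'rV[R]_n.+1) i : v 0 i <= q v by exact: le_bigmax.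
have [|l [ll lq lc]] := @separation_linear _ _ q C c (rV_max_sublinear n) C0 Cc.
  move=> y /Cy[i yi]; apply: le_trans (qle _ i).
  by rewrite mxE lerN2.
pose lf : {linear 'rV[R]_n.+1 -> R} := HB.pack l (GRing.isLinear.Build _ _ _ _ _ ll).
have lE v : l v = \sum_i l (delta_mx 0 i) * v 0 i.
  transitivity (lf (\sum_j v 0 j *: delta_mx 0 j)).
    by congr (l _); exact: row_sum_delta.
  by rewrite linear_sum; apply: eq_bigr => i _; rewrite linearZ /= mulrC.
have lN v : l (- v) = - l v by exact: (linearN lf).
exists (fun i => l (delta_mx 0 i)); split.
- move=> i; rewrite -oppr_le0 -lN (le_trans (lq _))//.
  by apply: bigmax_le => [|j _]; rewrite !mxE oppr_le0 ler0n.
- have l1 : l (const_mx 1) = \sum_i l (delta_mx 0 i).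
    by rewrite lE; apply: eq_bigr => i _; rewrite mxE mulr1.
  apply/eqP; rewrite -l1 eq_le; apply/andP; split.
    by apply: (le_trans (lq _)); apply: bigmax_le => [|j _]; rewrite mxE.
  rewrite -lerN2 -lN; apply: (le_trans (lq _)).
  by apply: bigmax_le => [|j _]; rewrite !mxE.
- by move=> y Cy'; rewrite -lE; exact: lc.
Qed.

End minimax.

Section norming.
Variables (R : realType) (X : completeNormedModType R).
Implicit Types (f : dual X) (K : cwk X).

Lemma cwk_symmetric_hull n (A : nat -> cwk X) : exists2 K : cwk X, cwk_set K 0 &
  forall i x, (i < n)%N -> cwk_set (A i) x -> cwk_set K x /\ cwk_set K (- x).
Proof.
elim: n => [|n [K K0 KA]].
  by have [K KE] := cwk_zeroP X; exists K => //; rewrite KE.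
have [P PE] := cwk_cone_segmentP (A n).
have [Q QE] := cwk_scaleP (-1) P.
have [S SE] := cwk_addP P Q.
have [L LE] := cwk_addP K S.
have P0 : cwk_set P 0.
  have [a Aa] := cwk_nonempty (A n).
  by rewrite PE; exists 0, a; rewrite lexx ler01 scale0r.
have Q0 : cwk_set Q 0 by rewrite QE; exists 0 => //; rewrite scaler0.
have S0 : cwk_set S 0 by rewrite SE; exists 0 => //; exists 0 => //; rewrite addr0.
have PA x : cwk_set (A n) x -> cwk_set P x.
  by move=> Ax; rewrite PE; exists 1, x; rewrite lexx ler01 scale1r.
exists L; first by rewrite LE; exists 0 => //; exists 0 => //; rewrite addr0.
move=> i x; rewrite ltnS leq_eqVlt => /orP[/eqP-> Ax|/KA h /h [Kx Kx']]; rewrite LE.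
  split; exists 0 => //.
    exists x; rewrite ?add0r// SE; exists x; first exact: PA.
    by exists 0 => //; rewrite addr0.
  exists (- x); rewrite ?add0r// SE; exists 0 => //.
  exists (- x); rewrite ?add0r// QE; exists x; first exact: PA.
  by rewrite scaleN1r.
by split; [exists x|exists (- x)] => //; exists 0 => //; rewrite addr0.
Qed.

Lemma cwk_norm_bounded K : exists2 C, 0 < C & forall x, cwk_set K x -> `|x| <= C.
Proof.
have [C KC] := cwk_bounded K; exists (`|C| + 1); first by rewrite ltr_wpDl.
move=> x Kx; apply: norm_le_functionals => f f1.
rewrite (le_trans (ler_norm _))// (le_trans (KC _ _ Kx f1))//.
by rewrite (le_trans (ler_norm _))// lerDl.
Qed.

Lemma weak_star_dense_seq :
  separable_set (dual_ball X : set (weak_star_dual X)) ->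
  exists D : nat -> dual X, (forall k, `|D k| <= 1) /\
    forall f x (e : R), `|f| <= 1 -> 0 < e -> exists k, D k x < f x + e.
Proof.
move=> [S [Sc SB BS]].
have evc x : continuous (fun f : weak_star_dual X => (f : dual X) x : R).
  move=> f.
  apply: (@continuous_comp (weak_star_dual X)
    (prod_topology (fun=> R : topologicalType)) R
    (fun (f : dual X) (x : X) => f x) (proj x)).
    exact: initial_continuous.
  exact: proj_continuous.
have Sf f x (e : R) : `|f| <= 1 -> 0 < e -> exists2 d : dual X, S d & d x < f x + e.
  move=> f1 e0.
  have /BS /(_ [set d : weak_star_dual X | (d : dual X) x < f x + e]) [] :
    (dual_ball X : set (weak_star_dual X)) f by [].
    apply: (evc x f [set r | r < f x + e]); apply: open_nbhs_nbhs; split; first exact: open_lt.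
    by rewrite /= ltrDl.
  by move=> d [Sd dx]; exists d.
have n0 : `|0 : dual X| <= 1 by rewrite normr0.
have [d0 Sd0 _] := Sf 0 0 1 n0 ltr01.
have /countable_injP[g ginj] := Sc.
have [D DP] : {D : nat -> dual X & forall k, S (D k) /\
    forall d, S d -> g d = k -> d = D k}.
  apply: (@choice nat (dual X) (fun k y => S y /\ forall d, S d -> g d = k -> d = y)) => k.
  have [[d [Sd gd]]|nd] := pselect (exists d, S d /\ g d = k).
    exists d; split=> // d' Sd' gd'; apply: ginj; rewrite ?inE//.
    by rewrite gd gd'.
  by exists d0; split=> // d Sd gd; case: nd; exists d.
exists D; split=> [k|f x e f1 e0]; first exact: SB (DP k).1.
have [d Sd dx] := Sf f x e f1 e0; exists (g d).
by rewrite -((DP (g d)).2 d Sd erefl).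
Qed.

Lemma cwk_uniform_approx (D : nat -> dual X) K f (e : R) : 0 < e ->
  (forall x, exists k, D k x < f x + e) ->
  exists n (l : 'I_n.+1 -> R), [/\ forall i, 0 <= l i, \sum_i l i = 1 &
    forall x, cwk_set K x -> \sum_i l i * D i x <= f x + e].
Proof.
move=> e0 Df.
have [n nP] : exists n, forall x, cwk_set K x ->
    exists2 k, (k < n)%N & D k x < f x + e.
  apply: contrapT => h.
  have [x xP] : {x : nat -> X & forall n, cwk_set K (x n) /\
      forall k, (k < n)%N -> f (x n) + e <= D k (x n)}.
    apply: (@choice nat X (fun n x => cwk_set K x /\
      forall k, (k < n)%N -> f x + e <= D k x)) => n.
    apply: contrapT => h'; apply: h; exists n => x Kx.
    apply: contrapT => h''; apply: h'; exists x; split=> // k kn.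
    by rewrite leNgt; apply/negP => ?; apply: h''; exists k.
  have [U [UU Uoo]] := @ultraFilterLemma nat \oo _.
  have [|y Ky yP] := @cwk_ultra_cvg _ _ nat U K x UU.
    by apply: nearW => t; exact: (xP t).1.
  have [k] := Df y; apply/negP; rewrite -leNgt -lerBrDl.
  have c : f (x t) - D k (x t) @[t --> U] --> f y - D k y by apply: cvgB.
  rewrite -lerN2 opprB; apply: (cvg_le_near c).
  apply: Uoo; exists k.+1 => // t /= kt.
  have := (xP t).2 k kt; lra.
case: n nP => [|n] nP.
  by have [x /nP[]] := cwk_nonempty K.
exists n.
pose Y x : 'rV[R]_n.+1 := \row_i (D i x - f x).
have [|||l [l0 l1 lY]] := @finite_minimax R n [set Y x | x in cwk_set K] e.
- by have [x Kx] := cwk_nonempty K; exists (Y x), x.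
- move=> _ _ a [x Kx <-] [y Ky <-] a01; exists (a *: x + (1 - a) *: y).
    by move/convex_setP : (@cwk_convex _ _ K); apply.
  by apply/rowP => i; rewrite !mxE !dualD !dualZ; ring.
- move=> _ [x Kx <-]; have [k kn /ltW h] := nP x Kx.
  by exists (Ordinal kn); rewrite mxE lerBlDl.
exists l; split=> // x Kx.
have := lY _ (imageP _ Kx); under eq_bigr do rewrite mxE mulrBr.
by rewrite big_split /= sumrN -mulr_suml l1 mul1r lerBlDl.
Qed.

Definition rational_average (D : nat -> dual X) (p : seq (nat * nat) * nat) : dual X :=
  p.2.+1%:R^-1 *: \sum_(i <- p.1) i.2%:R *: D i.1.

Lemma cwk_rational_approx (D : nat -> dual X) K f (e : R) : 0 < e ->
  (forall k, `|D k| <= 1) -> (forall x e', 0 < e' -> exists k, D k x < f x + e') ->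
  exists2 p, `|rational_average D p| <= 1 &
    forall x, cwk_set K x -> rational_average D p x <= f x + e.
Proof.
move=> e0 D1 Df; have e2 : 0 < e / 2 by rewrite divr_gt0.
have [n [l [l0 l1 lP]]] := cwk_uniform_approx K e2 (fun x => Df x _ e2).
have [C C0 KC] := cwk_norm_bounded K.
pose N := Num.truncn (n.+1%:R * C / (e / 2)).
have NP : n.+1%:R * C <= N.+1%:R * (e / 2).
  by rewrite -ler_pdivrMr// ltW// truncnS_gt.
pose m i := Num.truncn (l i * N.+1%:R).
have m1 i : (m i)%:R <= l i * N.+1%:R.
  by have /truncn_itv/andP[] : 0 <= l i * N.+1%:R by rewrite mulr_ge0.
have m2 i : l i * N.+1%:R <= (m i)%:R + 1.
  by rewrite natr1 ltW// truncnS_gt.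
pose p := ([seq (nat_of_ord i, m i) | i <- enum 'I_n.+1], N).
have avE : rational_average D p = N.+1%:R^-1 *: \sum_(i < n.+1) (m i)%:R *: D i.
  by rewrite /rational_average /= big_map big_enum.
exists p; rewrite avE.
  rewrite normrZ normfV ger0_norm// mulrC ler_pdivrMr ?ltr0Sn// mul1r.
  apply: (le_trans (ler_norm_sum _ _ _)).
  apply: (@le_trans _ _ (\sum_i l i * N.+1%:R)); last by rewrite -mulr_suml l1 mul1r.
  apply: ler_sum => i _; rewrite normrZ ger0_norm// (le_trans _ (m1 i))//.
  by rewrite -[leRHS]mulr1 ler_wpM2l.
move=> x Kx; rewrite -[_ x]/(N.+1%:R^-1 * (\sum_(i < n.+1) (m i)%:R *: D i : dual X) x).
rewrite dual_sum ler_pdivrMl ?ltr0Sn//.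
apply: (@le_trans _ _ (\sum_(i < n.+1) (l i * N.+1%:R * D i x + C))).
  apply: ler_sum => i _; rewrite -[_ x]/((m i)%:R * D i x).
  have : `|((m i)%:R - l i * N.+1%:R) * D i x| <= 1 * C.
    rewrite normrM ler_pM//.
      by rewrite ler_norml; apply/andP; split; have := m1 i; have := m2 i; lra.
    by rewrite (le_trans (dual_ball_le _ (D1 i)))// KC.
  rewrite mul1r mulrBl ler_norml; lra.
rewrite big_split /= sumr_const card_ord -[C *+ _]mulr_natl.
have -> : \sum_(i < n.+1) l i * N.+1%:R * D i x = N.+1%:R * \sum_(i < n.+1) l i * D i x.
  by rewrite mulr_sumr; apply: eq_bigr => i _; ring.
have := ler_wpM2l (ler0n R N.+1) (lP x Kx); lra.
Qed.

Lemma countable_norming : separable_set (dual_ball X : set (weak_star_dual X)) ->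
  exists d : nat -> dual_ball X, forall n (c : nat -> R) (A : nat -> cwk X) (C : R),
    (forall k, `|(\sum_(i < n) c i *: radstrom (A i) : linfty R _) (d k)| <= C) ->
    `|\sum_(i < n) c i *: radstrom (A i)| <= C.
Proof.
move=> /weak_star_dense_seq[D [D1 DP]].
have z1 : (0 : dual X) \in dual_ball X by rewrite inE /dual_ball /= normr0.
have [d dP] : {d : nat -> dual_ball X & forall k p, unpickle k = Some p ->
    `|rational_average D p| <= 1 -> val (d k) = rational_average D p}.
  apply: (@choice nat (dual_ball X) (fun k y => forall p, unpickle k = Some p ->
    `|rational_average D p| <= 1 -> val y = rational_average D p)) => k.
  have [[p [kp p1]]|np] := pselect (exists p, unpickle k = Some p /\
      `|rational_average D p| <= 1).
    have pB : rational_average D p \in dual_ball X by rewrite inE.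
    by exists (exist (fun f : dual X => f \in dual_ball X) _ pB) => p'; rewrite kp => -[<-].
  by exists (exist (fun f : dual X => f \in dual_ball X) _ z1) => p kp p1; case: np; exists p.
exists d => n c A C dC.
have C0 : 0 <= C by exact: le_trans (normr_ge0 _) (dC 0%N).
apply: linfty_norm_le => // f; apply/ler_addgt0Pr => e e0.
pose M := \sum_(i < n) `|c i| + 1.
have M0 : 0 < M by rewrite ltr_wpDl// sumr_ge0.
have eM : 0 < e / M by rewrite divr_gt0.
have f1 : `|val f| <= 1 by case: f => f /=; rewrite inE.
have [K K0 KA] := cwk_symmetric_hull n A.
have [p p1 pK] := @cwk_rational_approx D K (val f) _ eM D1
  (fun x e' => DP (val f) x e' f1).
have dpE : val (d (pickle p)) = rational_average D p.
  by apply: dP p1; rewrite pickleK.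
have sE g : (\sum_(i < n) c i *: radstrom (A i) : linfty R _) g =
    \sum_(i < n) c i * support_fun (A i) (val g).
  elim: (n) => [|k IH]; first by rewrite !big_ord0.
  by rewrite !big_ord_recr /= -IH.
have sub i : (i < n)%N -> `|support_fun (A i) (val f) -
    support_fun (A i) (rational_average D p)| <= e / M.
  move=> ik; rewrite ler_norml; apply/andP; split.
    rewrite lerBrDl lerBlDr; apply: support_le => x Ax.
    rewrite (le_trans (pK _ (KA i x ik Ax).1))// lerD2r; exact: le_support.
  rewrite lerBlDl; apply: support_le => x Ax.
  have := pK _ (KA i x ik Ax).2.
  rewrite -[- x]scaleN1r !dualZ; have := le_support (rational_average D p) Ax; lra.
rewrite sE; have := dC (pickle p); rewrite sE dpE => h.
rewrite -[X in `|X|](subrK (\sum_(i < n) c i * support_fun (A i) (rational_average D p))).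
rewrite (le_trans (ler_normD _ _))// addrC lerD//.
rewrite -sumrB (le_trans (ler_norm_sum _ _ _))//.
apply: (@le_trans _ _ (\sum_(i < n) `|c i| * (e / M))).
  by apply: ler_sum => i _; rewrite -mulrBr normrM ler_wpM2l// sub.
by rewrite -mulr_suml mulrCA ler_piMr ?(ltW e0)// ler_pdivrMr// mul1r lerDl.
Qed.

End norming.

(** * Finite tagged partitions and gauges *)

Section prob.
Context (d : measure_display) (T : measurableType d) (R : realType) (mu : probability T R).
Local Notation m E := (fine (mu E)).

Lemma probE E : measurable E -> mu E = (m E)%:E.
Proof. by move=> mE; rewrite fineK// fin_num_measure. Qed.

Lemma prob_ge0 E : 0 <= m E.
Proof. exact: fine_ge0. Qed.

Lemma prob_mono A B : measurable A -> measurable B -> A `<=` B -> m A <= m B.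
Proof.
by move=> mA mB AB; rewrite -lee_fin -!probE// le_measure// inE.
Qed.

Lemma prob_le1 A : measurable A -> m A <= 1.
Proof. by move=> mA; rewrite -lee_fin -probE// probability_le1. Qed.

Lemma prob_setT : m [set: T] = 1.
Proof. by rewrite probability_setT. Qed.

Lemma prob_set0 : m set0 = 0.
Proof. by rewrite measure0. Qed.

Lemma prob_setU A B : measurable A -> measurable B -> A `&` B = set0 ->
  m (A `|` B) = m A + m B.
Proof.
move=> mA mB AB; apply/EFin_inj; rewrite EFinD -!probE//; last exact: measurableU.
by rewrite measureU.
Qed.

Lemma prob_setID A B : measurable A -> measurable B ->
  m A = m (A `&` B) + m (A `\` B).
Proof.
move=> mA mB; rewrite -prob_setU ?setUIDK//; first exact: measurableI.
  exact: measurableD.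
by rewrite setDE setIACA setICr setI0.
Qed.

Lemma prob_setU_le A B : measurable A -> measurable B -> m (A `|` B) <= m A + m B.
Proof.
move=> mA mB; have -> : A `|` B = A `|` (B `\` A).
  apply/seteqP; split=> x; last by case=> [|[]]; [left|right].
  by case=> [|Bx]; [left|have [Ax|nAx] := pselect (A x); [left|right]].
rewrite prob_setU//; last 2 first.
- exact: measurableD.
- by rewrite setDE setICA setICr setI0.
by rewrite lerD2l prob_mono//; exact: measurableD.
Qed.

Lemma prob_setC A : measurable A -> m (~` A) = 1 - m A.
Proof.
move=> mA; have := prob_setID measurableT mA.
by rewrite setTI setTD prob_setT => ->; rewrite addrAC subrr add0r.
Qed.

Lemma prob_bigcup_le (F : nat -> set T) (e : nat -> R) (s : R) :
  (forall n, measurable (F n)) -> (forall n, m (F n) <= e n) ->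
  (forall n, \sum_(i < n) e i <= s) -> m (\bigcup_n F n) <= s.
Proof.
move=> mF Fe es; have mU : measurable (\bigcup_n F n) by exact: bigcup_measurable.
rewrite -lee_fin -probE//.
apply: (le_trans (@measure_sigma_subadditive _ _ _ mu (\bigcup_n F n) F mF mU (fun=> id))).
apply: lime_le; first by apply: is_cvg_nneseries.
apply: nearW => n; rewrite big_mkord.
apply: (@le_trans _ _ (\sum_(i < n) (e i)%:E)%E).
  by apply: lee_sum => i _; have := Fe i; rewrite -lee_fin -probE.
by rewrite sumEFin lee_fin.
Qed.

Lemma prob_bigcup_null (F : nat -> set T) : (forall n, measurable (F n)) ->
  (forall n, m (F n) = 0) -> m (\bigcup_n F n) = 0.
Proof.
move=> mF F0; apply/eqP; rewrite eq_le prob_ge0 andbT.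
apply: (@prob_bigcup_le _ (fun=> 0)) => //; first by move=> n; rewrite F0.
by move=> n; rewrite big1.
Qed.

Lemma prob_cvg_bigcup (F : nat -> set T) : (forall n, measurable (F n)) ->
  nondecreasing_seq F -> m (F n) @[n --> \oo] --> m (\bigcup_n F n).
Proof.
move=> mF ndF; have mU : measurable (\bigcup_n F n) by exact: bigcup_measurable.
have h : mu (F n) @[n --> \oo] --> (m (\bigcup_n F n))%:E.
  by rewrite -probE//; exact: nondecreasing_cvg_mu.
exact: fine_cvg h.
Qed.

Lemma prob_bigcup_finite (F : nat -> set T) (e : R) : (forall n, measurable (F n)) ->
  0 < e -> exists N, forall n, (N <= n)%N ->
    m (\bigcup_i F i `\` \big[setU/set0]_(i < n) F i) <= e.
Proof.
move=> mF e0.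
pose G n := \big[setU/set0]_(i < n) F i.
have mG n : measurable (G n) by exact: bigsetU_measurable.
have ndG : nondecreasing_seq G by move=> n k nk; apply/subsetPset; exact: subset_bigsetU.
have GF : \bigcup_n G n = \bigcup_n F n.
  apply/seteqP; split=> x [n _]; first by rewrite /G -bigcup_mkord => -[i _]; exists i.
  by move=> Fx; exists n.+1 => //; rewrite /G -bigcup_mkord; exists n => //=.
have := prob_cvg_bigcup mG ndG; rewrite GF => /cvgrPdist_le/(_ _ e0)[N _ h].
exists N => n Nn; have := h n Nn; rewrite /= ler_norml => /andP[_].
have mU : measurable (\bigcup_n F n) by exact: bigcup_measurable.
have -> := prob_setID mU (mG n).
rewrite (_ : _ `&` _ = G n); last first.
  by apply/setIidr; rewrite -GF; exact: bigcup_sup.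
by rewrite addrAC subrr add0r.
Qed.

Lemma measurable_hull (S : set T) : exists P, [/\ measurable P, S `<=` P &
  forall Q, measurable Q -> S `&` Q = set0 -> m (P `&` Q) = 0].
Proof.
pose A : set R := [set r | exists P, [/\ measurable P, S `<=` P & r = m P]].
have hA : has_inf A.
  split; first by exists (m setT), setT.
  by exists 0 => _ [P [_ _ ->]]; exact: prob_ge0.
have [P PP] : {P : nat -> set T & forall n, [/\ measurable (P n), S `<=` P n &
    m (P n) < inf A + n.+1%:R^-1]}.
  apply: (@choice nat (set T) (fun n P => [/\ measurable P, S `<=` P &
    m P < inf A + n.+1%:R^-1])) => n.
  have n0 : 0 < n.+1%:R^-1 :> R by rewrite invr_gt0.
  by have [_ [P [mP SP ->]] h] := inf_adherent n0 hA; exists P.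
have mP : measurable (\bigcap_n P n) by apply: bigcap_measurable => // n _; case: (PP n).
exists (\bigcap_n P n); split=> // [x Sx n _|Q mQ SQ]; first by case: (PP n) => _ /(_ x Sx).
have mPle : m (\bigcap_n P n) <= inf A.
  apply/ler_addgt0Pr => e e0.
  have [n _ en] : \forall n \near \oo, `|n.+1%:R^-1 : R| < e.
    by have /cvgr0Pnorm_lt := @cvg_harmonic R; apply.
  have [mPn _ /ltW h] := PP n.
  apply: (@le_trans _ _ (m (P n))).
    by apply: prob_mono => //; exact: bigcap_inf.
  rewrite (le_trans h)// lerD2l (le_trans (ler_norm _))// ltW//.
  exact: en (leqnn n).
have : inf A <= m (\bigcap_n P n `\` Q).
  apply: (@ge_inf _ A) hA.2 _ _; exists (\bigcap_n P n `\` Q); split=> //.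
    exact: measurableD.
  move=> x Sx; split; first by move=> n _; case: (PP n) => _ /(_ x Sx).
  by move=> Qx; have : (S `&` Q) x by []; rewrite SQ.
have := prob_setID mP mQ; have := prob_ge0 (\bigcap_n P n `&` Q); lra.
Qed.

End prob.

Section partial_partition.
Context (d : measure_display) (T : measurableType d) (R : realType) (mu : probability T R).
Local Notation m E := (fine (mu E)).
Implicit Types (G : set T -> T -> Prop) (p : seq (set T * T)).

Definition supp p := \big[setU/set0]_(q <- p) q.1.

(* [G E t] is the constraint relating a set to its tag. *)
Fixpoint partial_partition G p : Prop :=
  if p is q :: p' then
    [/\ measurable q.1, G q.1 q.2, q.1 `&` supp p' = set0 & partial_partition G p']
  else True.

Lemma supp_nil : supp [::] = set0.
Proof. exact: big_nil. Qed.

Lemma supp_cons q p : supp (q :: p) = q.1 `|` supp p.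
Proof. exact: big_cons. Qed.

Lemma supp_cat p p' : supp (p ++ p') = supp p `|` supp p'.
Proof. exact: big_cat. Qed.

Lemma supp_mem p x : supp p x <-> exists2 q, q \in p & q.1 x.
Proof.
elim: p => [|q p IH]; first by rewrite supp_nil; split=> // -[].
rewrite supp_cons; split=> [[qx|/IH[q' qp q'x]]|[q' + q'x]].
- by exists q; rewrite ?mem_head.
- by exists q'; rewrite // inE qp orbT.
- by rewrite inE => /orP[/eqP<-|qp]; [left|right; apply/IH; exists q'].
Qed.

Lemma partial_partition_measurable G p : partial_partition G p -> measurable (supp p).
Proof.
elim: p => [|q p IH] /=; first by rewrite supp_nil.
by move=> [mq _ _ /IH mp]; rewrite supp_cons; exact: measurableU.
Qed.

Lemma partial_partition_mem G p q : partial_partition G p -> q \in p ->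
  measurable q.1 /\ G q.1 q.2.
Proof.
elim: p => [|q' p IH] //= [mq Gq _ /IH h]; rewrite inE => /orP[/eqP->|/h] //.
Qed.

Lemma partial_partition_sub G G' p : (forall E t, G E t -> G' E t) ->
  partial_partition G p -> partial_partition G' p.
Proof. by move=> GG'; elim: p => [|q p IH] //= [mq /GG' Gq qp /IH]. Qed.

Lemma partial_partition_cat G p p' : partial_partition G p -> partial_partition G p' ->
  supp p `&` supp p' = set0 -> partial_partition G (p ++ p').
Proof.
elim: p => [|q p IH] //= [mq Gq qp Gp] Gp'.
rewrite supp_cons setIUl setU_eq0 => -[qp' pp']; split=> //; last exact: IH.
by rewrite supp_cat setIUr qp qp' setU0.
Qed.

Definition restrict_parts p (B : set T) := [seq (q.1 `&` B, q.2) | q <- p].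

Lemma supp_restrict p B : supp (restrict_parts p B) = supp p `&` B.
Proof.
elim: p => [|q p IH]; first by rewrite /= !supp_nil set0I.
by rewrite /= !supp_cons IH setIUl.
Qed.

Lemma partial_partition_restrict G G' p B : measurable B ->
  (forall E t, G E t -> G' (E `&` B) t) -> partial_partition G p ->
  partial_partition G' (restrict_parts p B).
Proof.
move=> mB GG'; elim: p => [|q p IH] //= [mq Gq qp /IH Gp]; split=> //.
- exact: measurableI.
- exact: GG'.
- by rewrite supp_restrict setIACA qp set0I.
Qed.

Lemma prob_supp G p : partial_partition G p -> m (supp p) = \sum_(q <- p) m q.1.
Proof.
elim: p => [|q p IH] /=; first by rewrite supp_nil big_nil prob_set0.
move=> [mq Gq qp Gp]; rewrite supp_cons big_cons -IH// prob_setU//.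
exact: partial_partition_measurable Gp.
Qed.

Lemma partial_partition_disjoint G p q0 i j : partial_partition G p ->
  (i < j < size p)%N -> (nth q0 p i).1 `&` (nth q0 p j).1 = set0.
Proof.
elim: p i j => [|q p IH] [|i] [|j] //=; rewrite ?ltn0 ?andbF//.
  move=> [_ _ qp _]; rewrite ltnS => jp; rewrite -subset0 -qp => x [qx px].
  by split=> //; apply/supp_mem; exists (nth q0 p j); rewrite ?mem_nth.
by move=> [_ _ _ Gp]; rewrite !ltnS => ij; exact: IH.
Qed.

Lemma partial_partition_rcons G p q : partial_partition G p -> measurable q.1 ->
  G q.1 q.2 -> supp p `&` q.1 = set0 -> partial_partition G (rcons p q).
Proof.
move=> Gp mq Gq pq; rewrite -cats1; apply: partial_partition_cat => //.
  by split=> //; rewrite supp_nil setI0.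
by rewrite supp_cons supp_nil setU0.
Qed.

Section riemann_sum.
Variables (V : lmodType R) (f : T -> V).

Definition riemann_sum p : V := \sum_(q <- p) m q.1 *: f q.2.

Lemma riemann_sum_cat p p' : riemann_sum (p ++ p') = riemann_sum p + riemann_sum p'.
Proof. exact: big_cat. Qed.

Lemma riemann_sum_cons q p : riemann_sum (q :: p) = m q.1 *: f q.2 + riemann_sum p.
Proof. exact: big_cons. Qed.

Lemma riemann_sum_restrictD G p B : measurable B -> partial_partition G p ->
  riemann_sum p = riemann_sum (restrict_parts p B) + riemann_sum (restrict_parts p (~` B)).
Proof.
move=> mB; elim: p => [|q p IH] /=.
  by rewrite /riemann_sum !big_nil addr0.
move=> [mq _ _ /IH E]; rewrite !riemann_sum_cons E addrACA -scalerDl.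
by rewrite (prob_setID _ mq mB) setDE.
Qed.

End riemann_sum.

Lemma riemann_sum_norm_le (V : normedModType R) (f : T -> V) G p C : 0 <= C ->
  partial_partition G p -> (forall q, q \in p -> `|f q.2| <= C) ->
  `|riemann_sum f p| <= C * m (supp p).
Proof.
move=> C0 Gp fC; rewrite (prob_supp Gp) /riemann_sum (le_trans (ler_norm_sum _ _ _))//.
rewrite big_seq [leRHS]mulr_sumr [leRHS]big_seq; apply: ler_sum => q qp.
by rewrite normrZ ger0_norm ?prob_ge0// mulrC ler_wpM2r ?prob_ge0 ?fC.
Qed.

Lemma riemann_sum_ge (f : T -> R^o) G p b : partial_partition G p ->
  (forall q, q \in p -> b <= f q.2) -> b * m (supp p) <= riemann_sum f p.
Proof.
move=> Gp fb; rewrite (prob_supp Gp) /riemann_sum mulr_sumr.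
rewrite big_seq [leRHS]big_seq; apply: ler_sum => q qp.
by rewrite mulrC ler_wpM2l ?prob_ge0 ?fb.
Qed.

Lemma riemann_sum_le (f : T -> R^o) G p b : partial_partition G p ->
  (forall q, q \in p -> f q.2 <= b) -> riemann_sum f p <= b * m (supp p).
Proof.
move=> Gp fb; rewrite (prob_supp Gp) /riemann_sum mulr_sumr.
rewrite big_seq [leRHS]big_seq; apply: ler_sum => q qp.
by rewrite [leRHS]mulrC ler_wpM2l ?prob_ge0 ?fb.
Qed.

End partial_partition.

Section infinite_flatten.
Variables (A : Type) (x0 : A) (b : nat -> seq A).
Hypothesis b_gt0 : forall n, (0 < size (b n))%N.

Definition prefix_flatten n := flatten [seq b i | i <- iota 0 n].
Definition infinite_flatten n := nth x0 (prefix_flatten n.+1) n.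

Lemma prefix_flattenS n : prefix_flatten n.+1 = prefix_flatten n ++ b n.
Proof. by rewrite /prefix_flatten -addn1 iotaD map_cat flatten_cat /= cats0. Qed.

Lemma prefix_flattenD n k : exists s, prefix_flatten (n + k) = prefix_flatten n ++ s.
Proof.
elim: k => [|k [s E]]; first by exists [::]; rewrite addn0 cats0.
by exists (s ++ b (n + k)); rewrite addnS prefix_flattenS E catA.
Qed.

Lemma size_prefix_flatten n : (n <= size (prefix_flatten n))%N.
Proof.
elim: n => // n IH; rewrite prefix_flattenS size_cat -addn1 leq_add//.
Qed.

Lemma nth_infinite_flatten n i : (i < size (prefix_flatten n))%N ->
  infinite_flatten i = nth x0 (prefix_flatten n) i.
Proof.
move=> ip; rewrite /infinite_flatten.
have [ni|ni] := leqP n i.+1.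
  have [s] := prefix_flattenD n (i.+1 - n); rewrite subnKC// => ->.
  by rewrite nth_cat ip.
have [s] := prefix_flattenD i.+1 (n - i.+1); rewrite subnKC ?(ltnW ni)// => ->.
by rewrite nth_cat size_prefix_flatten.
Qed.

Lemma mkseq_infinite_flatten n :
  mkseq infinite_flatten (size (prefix_flatten n)) = prefix_flatten n.
Proof.
apply: (@eq_from_nth _ x0) => [|i]; rewrite size_mkseq// => ip.
by rewrite nth_mkseq; [exact: nth_infinite_flatten|].
Qed.

End infinite_flatten.

Section gauge_cover.
Context (d : measure_display) (T : topMeasurableType d) (R : realType) (mu : probability T R).
Local Notation m E := (fine (mu E)).
Hypothesis qr : quasi_radon mu.

Definition gauge_union (Delta : T -> set T) (H : set T) := \bigcup_(t in H) Delta t.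

Lemma gauge_union_open (Delta : T -> set T) H : gauge Delta -> open (gauge_union Delta H).
Proof. by move=> gD; apply: bigcup_open => t _; exact: (gD t).1. Qed.

Lemma gauge_union_measurable (Delta : T -> set T) H : gauge Delta ->
  measurable (gauge_union Delta H).
Proof. by move=> gD; apply: (qr_open_measurable qr); exact: gauge_union_open. Qed.

Lemma gauge_measurable (Delta : T -> set T) t : gauge Delta -> measurable (Delta t).
Proof. by move=> gD; apply: (qr_open_measurable qr); exact: (gD t).1. Qed.

Lemma sub_gauge_union (Delta : T -> set T) H : gauge Delta -> H `<=` gauge_union Delta H.
Proof. by move=> gD t Ht; exists t => //; exact: (gD t).2. Qed.

Lemma gauge_finite_cover (Delta : T -> set T) (H : set T) (e : R) : gauge Delta -> 0 < e ->
  exists2 s : seq T, (forall t, t \in s -> H t) &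
    m (gauge_union Delta H `\` \big[setU/set0]_(t <- s) Delta t) <= e.
Proof.
move=> gD e0.
pose U (s : seq T) := \big[setU/set0]_(t <- s) Delta t.
have oU s : open (U s).
  by apply: big_ind => [||t _]; [exact: open0|exact: openU|exact: (gD t).1].
pose G : set (set T) := [set U s | s in [set s : seq T | forall t : T, t \in s -> H t]].
have UG : gauge_union Delta H = \bigcup_(V in G) V.
  apply/seteqP; split=> x.
    move=> [t Ht tx]; exists (U [:: t]); last by rewrite /U big_seq1.
    by exists [:: t] => // t'; rewrite inE => /eqP->.
  move=> [_ [s sH <-]]; rewrite /U => Ux.
  suff [t ts tx] : exists2 t, t \in s & Delta t x by exists t => //; exact: sH.
  elim: s Ux {sH} => [|t s IH]; first by rewrite big_nil.
  rewrite big_cons => -[tx|/IH[t' ts tx]]; first by exists t; rewrite ?mem_head.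
  by exists t'; rewrite // inE ts orbT.
have := @qr_tau_additive _ _ _ _ qr G _ _ _; rewrite -UG => supE.
have mG := gauge_union_measurable H gD.
have : ((m (gauge_union Delta H) - e)%:E < ereal_sup [set mu V | V in G])%E.
  rewrite -supE.
  - by rewrite [ltRHS]probE// lte_fin ltrBlDr ltrDl.
  - by exists (U [::]), [::].
  - by move=> _ [s _ <-].
  - move=> _ _ [s sH <-] [s' sH' <-]; exists (U (s ++ s')); split.
    + by exists (s ++ s') => // t; rewrite mem_cat => /orP[/sH|/sH'].
    + by rewrite /U big_cat; exact: subsetUl.
    + by rewrite /U big_cat; exact: subsetUr.
move=> /ereal_sup_gt[_ [_ [s sH <-] <-]].
have mU : measurable (U s) by exact: (qr_open_measurable qr).
rewrite [ltRHS]probE// lte_fin => h; exists s => //.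
have := prob_setID mu mG mU.
rewrite (_ : _ `&` U s = U s); first by rewrite -/(U s); lra.
apply/setIidr; rewrite UG => x Ux; exists (U s) => //; by exists s.
Qed.

Lemma gauge_disjointify (Delta : T -> set T) (A : set T) (s : seq T) :
  gauge Delta -> measurable A -> exists2 p,
    partial_partition (fun E t => [/\ E `<=` Delta t, E `<=` A & t \in s]) p &
    supp p = A `&` \big[setU/set0]_(t <- s) Delta t.
Proof.
move=> gD; elim: s A => [|t s IH] A mA.
  by exists [::] => //; rewrite supp_nil big_nil setI0.
have mD := gauge_measurable t gD.
have [p Pp pE] := IH (A `\` Delta t) (measurableD mA mD).
exists ((A `&` Delta t, t) :: p).
  split=> /=; [exact: measurableI| | |].
  - by split; rewrite ?mem_head.
  - by rewrite pE -subset0 => x [[_ tx] [[_ ntx] _]].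
  - apply: partial_partition_sub Pp => E t' [ED EA t's]; split=> //.
      by move=> x /EA[].
    by rewrite inE t's orbT.
rewrite supp_cons pE big_cons /=; apply/seteqP; split=> x.
  by case=> [[Ax tx]|[[Ax _] sx]]; split => //; [left|right].
move=> [Ax [tx|sx]]; first by left.
by have [tx|ntx] := pselect (Delta t x); [left|right].
Qed.

Lemma gauge_partial_cover (Delta : T -> set T) (A H : set T) (e : R) :
  gauge Delta -> measurable A -> 0 < e -> exists2 p,
    partial_partition (fun E t => [/\ E `<=` Delta t, E `<=` A & H t]) p &
    m ((A `&` gauge_union Delta H) `\` supp p) <= e.
Proof.
move=> gD mA e0; have [s sH se] := gauge_finite_cover H gD e0.
have [p Pp pE] := gauge_disjointify s gD mA; exists p.
  by apply: partial_partition_sub Pp => E t [? ? /sH].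
have mG := gauge_union_measurable H gD.
have mU : measurable (\big[setU/set0]_(t <- s) Delta t).
  by apply: bigsetU_measurable => t _; exact: gauge_measurable.
apply: le_trans se; apply: prob_mono.
- by rewrite pE; apply: measurableD; exact: measurableI.
- exact: measurableD.
- by rewrite pE => x [[Ax Gx] nx]; split=> // Ux; exact: nx.
Qed.

Lemma gauge_almost_cover (Delta : T -> set T) (e : R) : gauge Delta -> 0 < e ->
  exists2 p, partial_partition (fun E t => E `<=` Delta t) p & m (~` supp p) <= e.
Proof.
move=> gD e0; have [p pP pe] := gauge_partial_cover setT gD measurableT e0.
have mp := partial_partition_measurable pP.
exists p; first by apply: partial_partition_sub pP => E t [].
apply: le_trans pe; apply: prob_mono.
- exact: measurableC.
- by apply: measurableD => //; apply: measurableI => //; exact: gauge_union_measurable.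
- by move=> x np; split=> //; split=> //; exists x => //; exact: (gD x).2.
Qed.

Lemma gauge_partition (Delta : T -> set T) (A : set T) : gauge Delta -> measurable A ->
  exists E t, [/\ forall i, measurable (E i), trivIset [set: nat] E,
    forall i, E i `<=` A `&` Delta (t i) & m (A `\` \bigcup_i E i) = 0].
Proof.
move=> gD mA.
have e0 n : 0 < n.+1%:R^-1 :> R by rewrite invr_gt0.
have [s sP] : {s : nat -> seq T & forall n,
    m (gauge_union Delta setT `\` \big[setU/set0]_(t <- s n) Delta t) <= n.+1%:R^-1}.
  apply: (@choice nat (seq T) (fun n s => m (gauge_union Delta setT `\`
     \big[setU/set0]_(t <- s) Delta t) <= n.+1%:R^-1)) => n.
  by have [s _ h] := gauge_finite_cover setT gD (e0 n); exists s.
pose t k := if unpickle k is Some (n, i) then nth point (s n) i else point.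
pose E k := A `&` seqDU (fun k => Delta (t k)) k.
have mD k : measurable (Delta (t k)) by exact: gauge_measurable.
have mS k : measurable (seqDU (fun k => Delta (t k)) k).
  by apply: measurableD => //; apply: bigsetU_measurable.
exists E, t; split.
- by move=> i; exact: measurableI.
- by apply: trivIset_setIl; exact: trivIset_seqDU.
- by move=> i x [Ax [Dx _]].
have UE : \bigcup_i E i = A `&` \bigcup_i Delta (t i).
  by rewrite -setI_bigcupr -seqDU_bigcup_eq.
have mUD : measurable (\bigcup_i Delta (t i)) by exact: bigcup_measurable.
apply/eqP; rewrite eq_le prob_ge0 andbT; apply/ler_addgt0Pr => e ep; rewrite add0r.
have [n _ en] : \forall n \near \oo, `|n.+1%:R^-1 : R| < e.
  by have /cvgr0Pnorm_lt := @cvg_harmonic R; apply.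
have {}en : n.+1%:R^-1 <= e by rewrite ltW// (le_lt_trans (ler_norm _))// en/=.
apply: le_trans en; apply: le_trans (sP n); apply: prob_mono.
- by rewrite UE; apply: measurableD => //; exact: measurableI.
- apply: measurableD; first exact: gauge_union_measurable.
  by apply: bigsetU_measurable => t' _; exact: gauge_measurable.
rewrite UE => x [Ax nx]; split; first by exists x => //; exact: (gD x).2.
move=> sx; apply: nx; split=> //.
have [t' ts tx] : exists2 t', t' \in s n & Delta t' x.
  elim: (s n) sx => [|t' s' IH]; first by rewrite big_nil.
  rewrite big_cons => -[tx|/IH[t'' ts tx]]; first by exists t'; rewrite ?mem_head.
  by exists t''; rewrite // inE ts orbT.
exists (pickle (n, index t' (s n))) => //.
by rewrite /t pickleK nth_index.
Qed.

End gauge_cover.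

Section gauge_limits.
Context (d : measure_display) (T : topMeasurableType d) (R : realType) (mu : probability T R).
Local Notation m E := (fine (mu E)).
Local Notation fine_in Delta := (partial_partition (fun E t => E `<=` Delta t)).

Lemma partial_partition_catr G (p p' : seq (set T * T)) :
  partial_partition G (p ++ p') -> partial_partition G p' /\ supp p `&` supp p' = set0.
Proof.
elim: p => [|q p IH] /=; first by rewrite supp_nil set0I.
rewrite supp_cat setIUr setU_eq0 => -[_ _ [_ qp'] /IH[Gp' pp']]; split=> //.
by rewrite supp_cons setIUl qp' pp' setU0.
Qed.

Lemma supp_prefix_flatten (b : nat -> seq (set T * T)) n x :
  supp (prefix_flatten b n) x <-> exists2 k, (k < n)%N & supp (b k) x.
Proof.
elim: n => [|n IH]; first by rewrite supp_nil; split=> // -[].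
rewrite prefix_flattenS supp_cat; split=> [[/IH[k kn kx]|nx]|[k]].
- by exists k => //; exact: ltnW.
- by exists n.
- rewrite ltnS leq_eqVlt => /orP[/eqP->|kn] kx; first by right.
  by left; apply/IH; exists k.
Qed.

Lemma partial_partition_prefix_flatten G (b : nat -> seq (set T * T)) n :
  (forall l, partial_partition G (b l)) ->
  (forall k l, (k < l)%N -> supp (b k) `&` supp (b l) = set0) ->
  partial_partition G (prefix_flatten b n).
Proof.
move=> Gb bb; elim: n => // n IH; rewrite prefix_flattenS.
apply: partial_partition_cat => //; rewrite -subset0 => x.
by move=> [/supp_prefix_flatten[k kn kx] nx]; rewrite -(bb k n kn).
Qed.

Lemma riemann_sum_mkseq (V : lmodType R) (f : T -> V) (u : nat -> set T * T) n :
  riemann_sum mu f (mkseq u n) = \sum_(i < n) m (u i).1 *: f (u i).2.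
Proof. by rewrite /riemann_sum big_map -{1}[n]subn0 -/(index_iota 0 n) big_mkord. Qed.

Lemma mkseq_infinite_flatten_take A (x0 : A) (b : nat -> seq A) n k :
  (forall n, (0 < size (b n))%N) -> (k <= size (prefix_flatten b n))%N ->
  mkseq (infinite_flatten x0 b) k = take k (prefix_flatten b n).
Proof.
move=> b0 kn; rewrite -(mkseq_infinite_flatten x0 b0 n).
by rewrite /mkseq -map_take take_iota; move/minn_idPl : kn => ->.
Qed.

Hypothesis qr : quasi_radon mu.

Lemma block_partition (Delta : T -> set T) (b : nat -> seq (set T * T)) :
  gauge Delta -> (forall l, fine_in Delta (b l)) ->
  (forall k l, (k < l)%N -> supp (b k) `&` supp (b l) = set0) ->
  exists (q : nat -> set T * T) (u : nat -> set T * T),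
    [/\ mcshane_partition mu (fst \o u) (snd \o u),
      fine_partition Delta (fst \o u) (snd \o u),
      forall n, fine_in Delta (prefix_flatten (fun l => rcons (b l) (q l)) n) &
      forall n k, (k <= size (prefix_flatten (fun l => rcons (b l) (q l)) n))%N ->
        mkseq u k = take k (prefix_flatten (fun l => rcons (b l) (q l)) n)].
Proof.
move=> gD bD bb; pose A := ~` \bigcup_l supp (b l).
have mA : measurable A.
  by apply/measurableC/bigcup_measurable => l _; exact: partial_partition_measurable (bD l).
have [E [t [mE tE EA AE]]] := gauge_partition qr gD mA.
pose b' l := rcons (b l) (E l, t l).
have b'0 l : (0 < size (b' l))%N by rewrite size_rcons.
have Ab l : supp (b l) `&` A = set0.
  by rewrite -subset0 => x [lx]; apply; exists l.
have sb' l : supp (b' l) = supp (b l) `|` E l.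
  by rewrite /b' -cats1 supp_cat supp_cons supp_nil setU0.
have b'D l : fine_in Delta (b' l).
  apply: partial_partition_rcons => //=; first by move=> x /EA[].
  by rewrite -subset0 -(Ab l) => x [bx /EA[]].
have b'b' k l : (k < l)%N -> supp (b' k) `&` supp (b' l) = set0.
  move=> kl; rewrite !sb' -subset0 => x [[bkx|Ekx] [blx|Elx]].
  - by rewrite -(bb k l kl).
  - by rewrite -(Ab k); split=> //; case: (EA _ _ Elx).
  - by rewrite -(Ab l); split=> //; case: (EA _ _ Ekx).
  - move/trivIsetP : tE => /(_ k l I I).
    by rewrite neq_ltn kl => /(_ isT) <-.
have Fb n := partial_partition_prefix_flatten n b'D b'b'.
pose q0 : set T * T := (E 0%N, t 0%N).
pose u := infinite_flatten q0 b'.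
have uF n i : (i < size (prefix_flatten b' n))%N -> u i = nth q0 (prefix_flatten b' n) i.
  exact: nth_infinite_flatten.
have uD i : measurable (u i).1 /\ (u i).1 `<=` Delta (u i).2.
  have iF : (i < size (prefix_flatten b' i.+1))%N by exact: size_prefix_flatten.
  by rewrite (uF _ _ iF); apply: partial_partition_mem (Fb i.+1) _; exact: mem_nth.
have disj i j : (i < j)%N -> (u i).1 `&` (u j).1 = set0.
  move=> ij; have jF : (j < size (prefix_flatten b' j.+1))%N by exact: size_prefix_flatten.
  rewrite (uF _ _ jF) (uF j.+1 i); last exact: ltn_trans jF.
  by apply: partial_partition_disjoint (Fb j.+1) _; rewrite ij.
exists (fun l => (E l, t l)), u; split=> //.
- split=> [i|||] /=; first exact: (uD i).1.
  + apply/trivIsetP => i j _ _; rewrite neq_ltn => /orP[ij|ij]; first exact: disj.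
    by rewrite setIC; exact: disj.
  + by move=> i; rewrite probE ?ltry//; exact: (uD i).1.
  + have mU : measurable (\bigcup_i (u i).1).
      by apply: bigcup_measurable => i _; exact: (uD i).1.
    rewrite probE; last exact: measurableC.
    suff -> : m (~` \bigcup_i (u i).1) = 0 by [].
    apply/eqP; rewrite eq_le prob_ge0 andbT -AE; apply: prob_mono.
    * exact: measurableC.
    * by apply: measurableD => //; exact: bigcup_measurable.
    * have ub l : supp (b' l) `<=` \bigcup_i (u i).1.
        move=> x lx; have : supp (prefix_flatten b' l.+1) x.
          by apply/supp_prefix_flatten; exists l.
        move=> /supp_mem[q qF qx]; exists (index q (prefix_flatten b' l.+1)) => //.
        by rewrite (uF l.+1) ?index_mem// nth_index.
      move=> x nx; split=> [[l _ lx]|[l _ lx]]; apply: nx; apply: (ub l);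
        rewrite sb'; by [left|right].
- by move=> i; exact: (uD i).2.
- by move=> n k; exact: mkseq_infinite_flatten_take.
Qed.

Section riemann.
Variables (V : completeNormedModType R) (f : T -> V) (z : V).

Definition gauge_limit := forall e : R, 0 < e -> exists Delta (r : R),
  [/\ gauge Delta, 0 < r & forall p, fine_in Delta p -> m (~` supp p) <= r ->
    `|z - riemann_sum mu f p| <= e].

Definition partition_limit := forall e : R, 0 < e -> exists2 Delta, gauge Delta &
  forall E t, mcshane_partition mu E t -> fine_partition Delta E t ->
    \forall n \near \oo, `|z - \sum_(i < n) m (E i) *: f (t i)| <= e.

Lemma small_riemann_sum (Delta : T -> set T) (e : R) : gauge Delta -> 0 < e ->
  (forall E t, mcshane_partition mu E t -> fine_partition Delta E t ->
    \forall n \near \oo, `|z - \sum_(i < n) m (E i) *: f (t i)| <= e) ->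
  exists2 r : R, 0 < r & forall p, fine_in Delta p -> m (supp p) <= r ->
    `|riemann_sum mu f p| <= 4 * e.
Proof.
move=> gD e0 De; apply: contrapT => h.
have [pick pickP] : {pick : R -> seq (set T * T) & forall r, 0 < r ->
    [/\ fine_in Delta (pick r), m (supp (pick r)) <= r &
      4 * e < `|riemann_sum mu f (pick r)|]}.
  apply: (@choice R (seq (set T * T)) (fun r p => 0 < r ->
    [/\ fine_in Delta p, m (supp p) <= r & 4 * e < `|riemann_sum mu f p|])) => r.
  have [r0|r0] := ltP 0 r; last by exists [::].
  apply: contrapT => h'; apply: h; exists r => // p pD pr.
  by rewrite leNgt; apply/negP => pe; apply: h'; exists p.
pose c (p : seq (set T * T)) : R := \sum_(q <- p) `|f q.2|.
have c0 p : 0 <= c p by exact: sumr_ge0.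
have cq p q : q \in p -> `|f q.2| <= c p.
  move=> qp; rewrite /c (big_rem q)//= lerDl; exact: sumr_ge0.
pose step r := Num.min (r / 2) (e / (2 * (c (pick r) + 1))).
pose r l := iter l step 1.
have r0 l : 0 < r l.
  elim: l => //= l IH; rewrite lt_min !divr_gt0//= mulr_gt0// ltr_wpDl//.
pose b l := pick (r l).
have bP l := pickP _ (r0 l).
have rS l k : r (l + k)%N <= r l / 2 ^+ k.
  elim: k => [|k IH]; first by rewrite addn0 expr0 divr1.
  rewrite addnS /= ge_min; apply/orP; left.
  by rewrite exprS invfM mulrCA mulrC ler_wpM2l.
pose later l := \bigcup_k supp (b (l.+1 + k)%N).
have mb l : measurable (supp (b l)).
  by case: (bP l) => h' _ _; exact: partial_partition_measurable h'.
have mlater l : measurable (later l) by apply: bigcup_measurable => k _.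
have later_le l : (c (b l)) * m (later l) <= e.
  have : m (later l) <= 2 * r l.+1.
    apply: (@prob_bigcup_le _ _ _ _ _ (fun k => r l.+1 / 2 ^+ k)) => [k|k|n] //.
      by case: (bP (l.+1 + k)%N) => _ + _; move/le_trans; apply; exact: rS.
    suff -> : \sum_(i < n) r l.+1 / 2 ^+ i = 2 * r l.+1 - 2 * r l.+1 / 2 ^+ n.
      by rewrite gerBl divr_ge0 ?mulr_ge0 ?exprn_ge0// ltW.
    elim: n => [|n IH]; first by rewrite big_ord0 expr0 divr1 subrr.
    by move: (r l.+1) IH => a IH; rewrite big_ord_recr /= IH exprS; field; rewrite expf_neq0.
  have : r l.+1 <= e / (2 * (c (b l) + 1)) by rewrite /r /= ge_min lexx orbT.
  have c1 : 0 < c (b l) + 1 by rewrite ltr_wpDl.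
  rewrite ler_pdivlMr ?mulr_gt0// => h1 h2.
  have := prob_ge0 mu (later l); have := c0 (b l); nra.
pose b' l := restrict_parts (b l) (~` later l).
have b'D l : fine_in Delta (b' l).
  case: (bP l) => h' _ _; apply: partial_partition_restrict h'.
    exact: measurableC.
  by move=> E t ED x [/ED].
have b'b' k l : (k < l)%N -> supp (b' k) `&` supp (b' l) = set0.
  move=> kl; rewrite !supp_restrict -subset0 => x [[_ nx] [lx _]]; apply: nx.
  by exists (l - k.+1)%N => //; rewrite subnKC.
have b'e l : 3 * e < `|riemann_sum mu f (b' l)|.
  case: (bP l) => h1 _; rewrite (riemann_sum_restrictD mu f (mlater l) h1) => h2.
  have {h2} := lt_le_trans h2 (ler_normD _ _); rewrite -/(b l) -/(b' l) => h2.
  suff : `|riemann_sum mu f (restrict_parts (b l) (later l))| <= e by lra.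
  apply: le_trans (later_le l).
  have h5 : fine_in Delta (restrict_parts (b l) (later l)).
    by apply: partial_partition_restrict h1 => // E t ED x [/ED].
  apply: (le_trans (riemann_sum_norm_le mu (c0 (b l)) h5 _)).
    by move=> _ /mapP[q qb ->] /=; exact: cq.
  rewrite ler_wpM2l//; apply: prob_mono => //; first exact: partial_partition_measurable h5.
  by rewrite supp_restrict; exact: subIsetr.
have [q [u [uP uD Fb uF]]] := block_partition gD b'D b'b'.
have [N _ Ne] := De _ _ uP uD.
pose F n := prefix_flatten (fun l => rcons (b' l) (q l)) n.
have bq0 l : (0 < size (rcons (b' l) (q l)))%N by rewrite size_rcons.
have NF : (N <= size (F N))%N by exact: size_prefix_flatten.
have := Ne _ NF; rewrite /= -riemann_sum_mkseq (uF N)// take_size.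
have NF' : (N <= size (F N ++ b' N))%N by rewrite size_cat (leq_trans NF)// leq_addr.
have := Ne _ NF'; rewrite /= -riemann_sum_mkseq (uF N.+1); last first.
  by rewrite prefix_flattenS !size_cat size_rcons leq_add2l.
rewrite prefix_flattenS -cats1 catA take_size_cat// riemann_sum_cat -/(F N) => h1 h2.
have : `|riemann_sum mu f (b' N)| <= 2 * e.
  rewrite (_ : riemann_sum _ _ _ = (z - riemann_sum mu f (F N)) -
    (z - (riemann_sum mu f (F N) + riemann_sum mu f (b' N)))).
    by rewrite (le_trans (ler_normB _ _))//; lra.
  by rewrite opprB addrC addrA subrK addrAC subrr add0r.
have := b'e N; lra.
Qed.

Lemma partition_gauge_limit : partition_limit <-> gauge_limit.
Proof.
split=> [h e e0|h e e0].
  have e5 : 0 < e / 5 by rewrite divr_gt0.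
  have [Delta gD De] := h _ e5.
  have [r r0 rP] := small_riemann_sum gD e5 De.
  exists Delta, r; split=> // p pD pr.
  pose b l := if l is 0%N then p else [::].
  have bD l : fine_in Delta (b l) by case: l.
  have bb k l : (k < l)%N -> supp (b k) `&` supp (b l) = set0.
    by case: l => // l _; rewrite supp_nil setI0.
  have [q [u [uP uD Fb uF]]] := block_partition gD bD bb.
  have [N _ Ne] := De _ _ uP uD.
  pose F n := prefix_flatten (fun l => rcons (b l) (q l)) n.
  have bq0 l : (0 < size (rcons (b l) (q l)))%N by rewrite size_rcons.
  have NF : (N <= size (F N.+1))%N.
    by rewrite (leq_trans _ (size_prefix_flatten _ N.+1)).
  have := Ne _ NF; rewrite /= -riemann_sum_mkseq (uF N.+1)// take_size.
  have [s sE] := prefix_flattenD (fun l => rcons (b l) (q l)) 1 N.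
  have FE : F N.+1 = p ++ q 0%N :: s.
    by rewrite /F -add1n sE /prefix_flatten /= cats0 cat_rcons.
  have := Fb N.+1; rewrite -/(F N.+1) FE => /partial_partition_catr[sD ps].
  rewrite riemann_sum_cat => h1.
  have h2 : `|riemann_sum mu f (q 0%N :: s)| <= 4 * (e / 5).
    apply: rP => //; apply: le_trans pr; apply: prob_mono.
    - exact: partial_partition_measurable sD.
    - exact/measurableC/partial_partition_measurable/pD.
    - by move=> x sx px; have : (supp p `&` supp (q 0%N :: s)) x by []; rewrite ps.
  rewrite (_ : z - _ = (z - (riemann_sum mu f p + riemann_sum mu f (q 0%N :: s))) +
      riemann_sum mu f (q 0%N :: s)); last by rewrite opprD addrA subrK.
  by rewrite (le_trans (ler_normD _ _))//; lra.
have [Delta [r [gD r0 rP]]] := h e e0; exists Delta => // E t [mE tE _ E0] ED.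
have [N NP] := prob_bigcup_finite mu mE r0.
exists N => // n Nn /=; pose p := mkseq (fun i => (E i, t i)) n.
have pE k : supp (mkseq (fun i => (E i, t i)) k) = \big[setU/set0]_(i < k) E i.
  by rewrite /supp big_map -{1}[k]subn0 -/(index_iota 0 k) big_mkord.
have pD k : fine_in Delta (mkseq (fun i => (E i, t i)) k).
  elim: k => // k IH; rewrite mkseqS; apply: partial_partition_rcons => //=.
  rewrite pE -bigcup_mkord -subset0 => x [[i /= ik Eix] Ekx].
  move/trivIsetP : tE => /(_ i k I I); rewrite neq_ltn ik.
  by move=> /(_ isT)/seteqP[/(_ x)] Ekix _; exact: Ekix.
have := rP p (pD n); rewrite riemann_sum_mkseq; apply.
have mU : measurable (\bigcup_i E i) by exact: bigcup_measurable.
have mp := partial_partition_measurable (pD n).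
apply: (@le_trans _ _ (m (~` (\bigcup_i E i) `|` ((\bigcup_i E i) `\` supp p)))).
  apply: prob_mono; first exact: measurableC.
    by apply: measurableU; [exact: measurableC|exact: measurableD].
  by move=> x px; have [Ux|nUx] := pselect ((\bigcup_i E i) x); [right|left].
rewrite (le_trans (prob_setU_le _ _ _))//; [exact: measurableC|exact: measurableD|].
by rewrite E0 add0r pE; exact: NP.
Qed.

End riemann.

End gauge_limits.

Section mcshane_gauge_limit.
Context (d : measure_display) (T : topMeasurableType d) (R : realType) (mu : probability T R)
  (X : completeNormedModType R).
Hypothesis qr : quasi_radon mu.

Lemma limn_esup_le (u : nat -> R) (e : R) :
  (\forall n \near \oo, u n <= e) -> (limn_esup (fun n => (u n)%:E) <= e%:E)%E.
Proof.
move=> ue; rewrite /limn_esup /limf_esup.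
apply: (@le_trans _ _ (ereal_sup [set (u n)%:E | n in [set n | u n <= e]])).
  by apply: ereal_inf_lbound; exists [set n | u n <= e].
by apply: ge_ereal_sup => _ [n /= une <-]; rewrite lee_fin.
Qed.

Lemma limn_esup_lt (u : nat -> R) (e : R) :
  (limn_esup (fun n => (u n)%:E) < e%:E)%E -> \forall n \near \oo, u n <= e.
Proof.
move=> /ereal_inf_lt[_ [V Voo <-] h]; apply: filterS Voo => n Vn.
rewrite -lee_fin; apply: le_trans (ltW h).
by apply: ereal_sup_ubound; exists n.
Qed.

Lemma mcshane_integralP (F : T -> cwk X) (I : cwk X) :
  is_mcshane_integral mu F I <-> gauge_limit mu (@radstrom R X \o F) (radstrom I).
Proof.
rewrite -partition_gauge_limit//.
have hE (E : nat -> set T) (t : nat -> T) : (fun n => hausdorff_dist (cwk_set I)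
      (minkowski_sum n (fun i => minkowski_scale (fine (mu (E i))) (F (t i))))) =
    (fun n => `|radstrom I - \sum_(i < n) fine (mu (E i)) *: radstrom (F (t i))|%:E).
  apply/funext => n; have [i|C <- <-] := @minkowski_sumP _ _ n
    (fun i => fine (mu (E i))) (fun i => F (t i)); first exact: prob_ge0.
  exact: hausdorff_radstrom.
split=> h e e0.
  have e2 : 0 < e / 2 by rewrite divr_gt0.
  have [Delta gD De] := h _ e2; exists Delta => // E t Ep Ef.
  apply: limn_esup_lt; have := De E t Ep Ef; rewrite hE => /le_lt_trans; apply.
  by rewrite lte_fin; lra.
have [Delta gD De] := h _ e0; exists Delta => // E t Ep Ef.
by rewrite hE; apply: limn_esup_le; exact: De.
Qed.

End mcshane_gauge_limit.

(** * Oscillation of countably many coordinates *)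

Section oscillation.
Context (d : measure_display) (T : topMeasurableType d) (R : realType) (mu : probability T R).
Local Notation m E := (fine (mu E)).
Local Notation fine_in Delta := (partial_partition (fun E t => E `<=` Delta t)).
Hypothesis qr : quasi_radon mu.

Lemma prob_big_setU_le (I : eqType) (s : seq I) (F : I -> set T) (c : R) :
  (forall i, i \in s -> measurable (F i)) -> (forall i, i \in s -> m (F i) <= c) ->
  measurable (\big[setU/set0]_(i <- s) F i) /\
  m (\big[setU/set0]_(i <- s) F i) <= (size s)%:R * c.
Proof.
elim: s => [|i s IH] mF Fc; first by rewrite big_nil prob_set0 mul0r.
have [mU Uc] : measurable (\big[setU/set0]_(i <- s) F i) /\
    m (\big[setU/set0]_(i <- s) F i) <= (size s)%:R * c.
  by apply: IH => j js; [apply: mF|apply: Fc]; rewrite inE js orbT.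
have mi := mF i (mem_head _ _); rewrite big_cons; split; first exact: measurableU.
rewrite (le_trans (prob_setU_le _ _ _))//= -natr1 mulrDl mul1r addrC lerD//.
exact: Fc (mem_head _ _).
Qed.

Lemma hull_in (S A : set T) : measurable A -> S `<=` A ->
  exists P, [/\ measurable P, S `<=` P, P `<=` A &
    forall Q, measurable Q -> 0 < m (P `&` Q) -> S `&` Q !=set0].
Proof.
move=> mA SA; have [P [mP SP PQ]] := measurable_hull mu S.
exists (P `&` A); split=> [|x Sx|x []|Q mQ Q0] //; first exact: measurableI.
  by split; [exact: SP|exact: SA].
apply: contrapT => /nonemptyPn SQ; move: Q0; rewrite ltNge => /negP; apply.
rewrite -(PQ Q mQ SQ); apply: prob_mono.
- by apply: measurableI => //; exact: measurableI.
- exact: measurableI.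
- by move=> x [[]].
Qed.

Section tests.
Variables (Delta : T -> set T) (H : nat -> set T) (A : set T).
Hypotheses (gD : gauge Delta) (mH : forall j, measurable (H j)) (mA : measurable A).

Let F t j := if `[< H j t >] then ~` gauge_union Delta (H j) else set0.

Let mF t j : measurable (F t j).
Proof.
rewrite /F; case: ifP => _; last exact: measurable0.
exact/measurableC/(gauge_union_measurable qr).
Qed.

Let tail n t := \bigcup_j F t j `\` \big[setU/set0]_(j < n) F t j.

Let mtail n t : measurable (tail n t).
Proof.
apply: measurableD; first exact: bigcup_measurable.
exact: bigsetU_measurable.
Qed.

Let signature n t := mkseq (fun j => `[< H j t >]) n.

(* Membership of [t] in the first [n] sets determines, up to measure [1/(l+1)],
   the intersection of the gauge unions of all the [H j] containing [t]. *)
Let class (c : nat * nat * seq bool) : set T :=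
  [set t | [/\ A t, m (tail c.1.1 t) <= c.1.2.+1%:R^-1 & signature c.1.1 t = c.2]].

Let big_signature n t t' : signature n t = signature n t' ->
  \big[setU/set0]_(j < n) F t j = \big[setU/set0]_(j < n) F t' j.
Proof.
move=> tt'; apply: eq_bigr => j _.
have := congr1 (fun s => nth false s j) tt'.
by rewrite /F !nth_mkseq// => ->.
Qed.

Let gauge_sub n t : Delta t `<=` ~` \big[setU/set0]_(j < n) F t j.
Proof.
move=> x tx; rewrite -bigcup_mkord => -[j _]; rewrite /F.
case: ifPn => // /asboolP Ht; apply; by exists t.
Qed.

Lemma gauge_tests (e : R) : 0 < e -> exists L : seq (set T),
  (forall B, B \in L -> [/\ measurable B, B `<=` A & 0 < m B]) /\
  forall j, (forall B, B \in L -> 0 < m (B `&` H j)) ->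
    m (A `\` gauge_union Delta (H j)) <= e.
Proof.
move=> e0.
have [P PP] : {P : nat * nat * seq bool -> set T & forall c,
    [/\ measurable (P c), class c `<=` P c, P c `<=` A &
    forall Q, measurable Q -> 0 < m (P c `&` Q) -> class c `&` Q !=set0]}.
  apply: (@choice (nat * nat * seq bool)%type (set T) (fun c P =>
    [/\ measurable P, class c `<=` P, P `<=` A &
    forall Q, measurable Q -> 0 < m (P `&` Q) -> class c `&` Q !=set0])) => c.
  by apply: hull_in => // t [].
have mP c : measurable (P c) by case: (PP c).
pose N := \bigcup_i (if @unpickle (nat * nat * seq bool)%type i is Some c then
  if `[< m (P c) = 0 >] then P c else set0 else set0).
have mN' i : measurable (if @unpickle (nat * nat * seq bool)%type i is Some c then
    if `[< m (P c) = 0 >] then P c else set0 else set0).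
  by case: (unpickle i) => [c|]; [case: ifP => _|] => //; exact: measurable0.
have mN : measurable N by exact: bigcup_measurable.
have N0 : m N = 0.
  apply: prob_bigcup_null => // i; case: (unpickle i) => [c|]; last exact: prob_set0.
  by case: ifPn => [/asboolP//|_]; exact: prob_set0.
have NP c t : class c t -> ~ N t -> 0 < m (P c).
  move=> ct nN; rewrite lt0r prob_ge0 andbT; apply/eqP => c0; apply: nN.
  exists (pickle c) => //; rewrite pickleK; case: ifPn => [_|/asboolP//].
  by case: (PP c) => _ /(_ t ct).
have e2 : 0 < e / 2 by rewrite divr_gt0.
have [s sA se] := gauge_finite_cover qr (A `\` N) gD e2.
pose l := Num.truncn ((size s)%:R / (e / 2)).
have le : (size s)%:R * l.+1%:R^-1 <= e / 2.
  by rewrite ler_pdivrMr// mulrC -ler_pdivrMr// ltW// truncnS_gt.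
have l0 : 0 < l.+1%:R^-1 :> R by rewrite invr_gt0.
have [n nP] : {n : T -> nat & forall t, m (tail (n t) t) <= l.+1%:R^-1}.
  apply: (@choice T nat (fun t n => m (tail n t) <= l.+1%:R^-1)) => t.
  by have [k /(_ k (leqnn k))] := prob_bigcup_finite mu (mF t) l0; exists k.
pose c t := (n t, l, signature (n t) t).
have ct t : t \in s -> class (c t) t by move=> /sA[At _]; split=> //; exact: nP.
exists [seq P (c t) | t <- s]; split.
  move=> _ /mapP[t ts ->]; case: (PP (c t)) => h1 _ h2 _; split=> //.
  by apply: (NP _ t); [exact: ct|case: (sA _ ts)].
move=> j hj.
have mW := gauge_union_measurable qr (H j) gD.
have tW t : t \in s -> m (Delta t `\` gauge_union Delta (H j)) <= l.+1%:R^-1.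
  move=> ts; have [t' [[At' h1 h2] Ht']] : class (c t) `&` H j !=set0.
    case: (PP (c t)) => _ _ _; apply => //.
    by apply: hj; apply/mapP; exists t.
  apply: le_trans h1; apply: prob_mono => //.
    by apply: measurableD => //; exact: (gauge_measurable qr).
  move=> x [tx nx]; split; first by exists j => //; rewrite /F asboolT.
  by rewrite (big_signature h2); exact: gauge_sub.
have mD t : measurable (Delta t) by exact: (gauge_measurable qr).
pose U := \big[setU/set0]_(t <- s) Delta t.
have mU : measurable U by exact: bigsetU_measurable.
pose C := \big[setU/set0]_(t <- s) (Delta t `\` gauge_union Delta (H j)).
have [||mC Cle] := @prob_big_setU_le _ s
  (fun t => Delta t `\` gauge_union Delta (H j)) l.+1%:R^-1.
- by move=> t _; exact: measurableD.
- exact: tW.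
have mG := gauge_union_measurable qr (A `\` N) gD.
apply: (@le_trans _ _ (m ((N `|` (gauge_union Delta (A `\` N) `\` U)) `|` C))).
  apply: prob_mono.
  - exact: measurableD.
  - by apply: measurableU => //; apply: measurableU => //; exact: measurableD.
  - move=> x [Ax nx]; have [Nx|nN] := pselect (N x); first by left; left.
    have [Ux|nU] := pselect (U x).
      right; move: Ux; rewrite /U /C; elim: (s) => [|t s' IH]; first by rewrite big_nil.
      by rewrite !big_cons => -[tx|/IH]; [left|right].
    left; right; split=> //; apply: (sub_gauge_union gD); by split.
have mGU : measurable (gauge_union Delta (A `\` N) `\` U) by exact: measurableD.
rewrite (le_trans (prob_setU_le _ _ _))//; first exact: measurableU.
have := prob_setU_le mu mN mGU; rewrite N0 => h.
rewrite (le_trans (lerD h (le_trans Cle le)))// add0r [leRHS]splitr lerD2r; exact: se.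
Qed.

End tests.

Lemma measurable_nat_preimage (p : T -> nat) (V : set nat) :
  (forall n, measurable (p @^-1` [set n])) -> measurable (p @^-1` V).
Proof.
move=> mp; rewrite (_ : p @^-1` V = \bigcup_n (if `[< V n >] then p @^-1` [set n] else set0)).
  by apply: bigcup_measurable => n _; case: ifP => // _; exact: measurable0.
apply/seteqP; split=> t /=.
  by move=> Vt; exists (p t) => //; rewrite asboolT.
by move=> [n _]; case: ifPn => // /asboolP Vn /= ->.
Qed.

(* The joint failure of [U]-smallness is witnessed on a set all of whose finite
   families of non-null parts are hit simultaneously. *)
Lemma positive_family (Hp Hm : nat -> set T) (e : R) :
  (forall k, measurable (Hp k)) -> (forall k, measurable (Hm k)) -> 0 < e ->
  (forall p : T -> nat, (forall n, measurable (p @^-1` [set n])) -> exists k,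
    e < m (p @^-1` [set n | 0 < m (p @^-1` [set n] `&` Hp k) /\
                            0 < m (p @^-1` [set n] `&` Hm k)])) ->
  exists A, [/\ measurable A, 0 < m A & forall L : seq (set T),
    (forall B, B \in L -> [/\ measurable B, B `<=` A & 0 < m B]) ->
    exists k, forall B, B \in L -> 0 < m (B `&` Hp k) /\ 0 < m (B `&` Hm k)].
Proof.
move=> mHp mHm e0 bad.
pose ms (p : T -> nat) := forall n, measurable (p @^-1` [set n]).
have mpre p (V : set nat) : ms p -> measurable (p @^-1` V) by exact: measurable_nat_preimage.
have [K KP] : {K : (T -> nat) -> nat & forall p, ms p ->
    e < m (p @^-1` [set n | 0 < m (p @^-1` [set n] `&` Hp (K p)) /\
                            0 < m (p @^-1` [set n] `&` Hm (K p))])}.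
  apply: (@choice (T -> nat) nat (fun p k => ms p ->
    e < m (p @^-1` [set n | 0 < m (p @^-1` [set n] `&` Hp k) /\
                            0 < m (p @^-1` [set n] `&` Hm k)]))) => p.
  by have [/bad[k h]|nm] := pselect (ms p); [exists k|exists 0%N].
pose Bd p := p @^-1` [set n | 0 < m (p @^-1` [set n] `&` Hp (K p)) /\
                              0 < m (p @^-1` [set n] `&` Hm (K p))].
have mBd p : ms p -> measurable (Bd p) by exact: mpre.
pose cone (q : T -> nat) : set (T -> nat) := [set p | ms p /\ exists g : nat -> nat, q = g \o p].
pose F := filter_from ms cone.
have FF : ProperFilter F.
  apply: filter_from_proper; last by move=> q mq; exists q; split=> //; exists id.
  apply: filter_from_filter.
    exists (fun=> 0%N) => n; have [->|n0] := eqVneq n 0%N.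
      by rewrite preimage_cst mem_set//.
    by rewrite preimage_cst memNset//= => /esym/eqP; rewrite (negbTE n0).
  move=> q1 q2 m1 m2; exists (fun t => pickle (q1 t, q2 t)).
    move=> n; rewrite (_ : _ @^-1` _ =
      if @unpickle (nat * nat)%type n is Some (i, j) then
        (if pickle (i, j) == n then q1 @^-1` [set i] `&` q2 @^-1` [set j] else set0)
      else set0).
      case: (unpickle n) => [[i j]|]; last exact: measurable0.
      by case: ifP => _; [exact: measurableI|exact: measurable0].
    apply/seteqP; split=> t /=.
      by move=> <-; rewrite pickleK eqxx.
    by case: (unpickle n) => [[i j]|] //; case: ifPn => [/eqP<- [/= <- <-]|].
  move=> p [mp [g gE]]; split; split=> //.
    exists (fun n => if @unpickle (nat * nat)%type (g n) is Some (i, j) then i else 0%N).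
    by apply/funext => t /=; rewrite -[g (p t)]/((g \o p) t) -gE pickleK.
  exists (fun n => if @unpickle (nat * nat)%type (g n) is Some (i, j) then j else 0%N).
  by apply/funext => t /=; rewrite -[g (p t)]/((g \o p) t) -gE pickleK.
have [U [UU FU]] := ultraFilterLemma FF.
have Ums : \forall p \near U, ms p.
  have [q mq _] : F setT by exact: filterT.
  by apply: FU; exists q => // p [].
pose null E := forall r : R, 0 < r -> \forall p \near U, m (E `&` Bd p) <= r.
have null_bigcup (E : nat -> set T) : (forall i, measurable (E i)) ->
    (forall i, null (E i)) -> null (\bigcup_i E i).
  move=> mE nE r r0; have r2 : 0 < r / 2 by rewrite divr_gt0.
  have [n /(_ n (leqnn n)) nP] := prob_bigcup_finite mu mE r2.
  have mU : measurable (\bigcup_i E i) by exact: bigcup_measurable.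
  have fin k : \forall p \near U,
      m ((\big[setU/set0]_(i < k) E i) `&` Bd p) <= k%:R * (r / 2 / n.+1%:R).
    elim: k => [|k IH]; first by apply: nearW => p; rewrite big_ord0 set0I prob_set0 mul0r.
    have rn : 0 < r / 2 / n.+1%:R by rewrite divr_gt0.
    apply: filterS3 IH (nE k _ rn) Ums => p h1 h2 mp.
    rewrite big_ord_recr /= setIUl -natr1 mulrDl mul1r.
    have mG : measurable (\big[setU/set0]_(i < k) E i) by exact: bigsetU_measurable.
    by rewrite (le_trans (prob_setU_le _ _ _))//; [exact: measurableI (mBd _ mp)|
      exact: measurableI (mBd _ mp)|exact: lerD].
  apply: filterS2 (fin n) Ums => p h mp.
  have mG : measurable (\big[setU/set0]_(i < n) E i) by exact: bigsetU_measurable.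
  apply: (@le_trans _ _ (m (((\big[setU/set0]_(i < n) E i) `&` Bd p) `|`
      ((\bigcup_i E i) `\` \big[setU/set0]_(i < n) E i)))).
    apply: prob_mono.
    - exact: measurableI (mBd _ mp).
    - by apply: measurableU; [exact: measurableI (mBd _ mp)|exact: measurableD].
    - move=> x [Ux Bx].
      by have [Gx|nG] := pselect ((\big[setU/set0]_(i < n) E i) x); [left|right].
  have := prob_setU_le mu (measurableI _ _ mG (mBd _ mp)) (measurableD mU mG).
  move=> /le_trans; apply.
  have : n%:R * (r / 2 / n.+1%:R) <= r / 2.
    rewrite mulrCA ler_piMr ?(ltW r2)// ler_pdivrMr// mul1r ler_nat; exact: leqnSn.
  by move=> h1; rewrite [leRHS]splitr; exact: lerD (le_trans h h1) nP.
pose S : set R := [set r | exists E, [/\ measurable E, null E & r = m E]].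
have hS : has_sup S.
  split; last by exists 1 => _ [E [mE _ ->]]; exact: prob_le1.
  exists (m set0), set0; split=> // r r0; apply: nearW => p.
  by rewrite set0I prob_set0 ltW.
have [E EP] : {E : nat -> set T & forall n, [/\ measurable (E n), null (E n) &
    sup S - n.+1%:R^-1 < m (E n)]}.
  apply: (@choice nat (set T) (fun n E => [/\ measurable E, null E &
    sup S - n.+1%:R^-1 < m E])) => n.
  have n0 : 0 < n.+1%:R^-1 :> R by rewrite invr_gt0.
  by have [_ [E [mE nE ->]] h] := sup_adherent n0 hS; exists E.
have mE n : measurable (E n) by case: (EP n).
pose N := \bigcup_n E n.
have mN : measurable N by exact: bigcup_measurable.
have nN : null N by apply: null_bigcup => // i; case: (EP i).
have Nsup : sup S <= m N.
  apply/ler_addgt0Pr => r r0.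
  have [n _ en] : \forall n \near \oo, `|n.+1%:R^-1 : R| < r.
    by have /cvgr0Pnorm_lt := @cvg_harmonic R; apply.
  have h1 := le_lt_trans (ler_norm _) (en n (leqnn n)).
  have h2 : m (E n) <= m N by apply: prob_mono => //; exact: bigcup_sup.
  case: (EP n) => _ _; move: (n.+1%:R^-1) h1 => a; lra.
have mA : measurable (~` N) by exact: measurableC.
have pos B : measurable B -> B `<=` ~` N -> 0 < m B ->
    \forall p \near U, 0 < m (B `&` Bd p).
  move=> mB BN B0.
  have nB : ~ null B.
    move=> nB; have mNB : measurable (N `|` B) by exact: measurableU.
    have : m (N `|` B) <= sup S.
      apply: ub_le_sup; first exact: hS.2.
      exists (N `|` B); split=> // r r0; have r2 : 0 < r / 2 by rewrite divr_gt0.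
      apply: filterS3 (nN _ r2) (nB _ r2) Ums => p h1 h2 mp.
      rewrite setIUl (le_trans (prob_setU_le _ _ _))//; last lra.
        exact: measurableI (mBd _ mp).
      exact: measurableI (mBd _ mp).
    rewrite prob_setU//; first lra.
    by rewrite -subset0 => x [Nx /BN].
  have [r [r0 nr]] : exists r : R, 0 < r /\ ~ \forall p \near U, m (B `&` Bd p) <= r.
    apply: contrapT => h; apply: nB => r r0; apply: contrapT => h'; apply: h.
    by exists r.
  have [//|] := in_ultra_setVsetC [set p | m (B `&` Bd p) <= r] UU.
  by apply: filterS => p /= /negP; rewrite -ltNge; exact: lt_trans.
exists (~` N); split=> //.
  have e2 : 0 < e / 2 by rewrite divr_gt0.
  have [p [h mp]] := filter_ex (filterI (nN _ e2) Ums).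
  have h1 := KP p mp; rewrite -/(Bd p) in h1.
  have := prob_setID mu (mBd p mp) mN; rewrite setIC => h2.
  have h3 : m (Bd p `\` N) <= m (~` N).
    by apply: prob_mono => //; apply: measurableD => //; exact: mBd.
  lra.
move=> L LP.
have [code [decode codeK]] : exists (code : seq bool -> nat) decode, pcancel code decode.
  by exists pickle, unpickle; exact: pickleK.
pose q t : nat := code [seq `[< B t >] | B <- L].
have mq : ms q.
  move=> n; rewrite (_ : _ @^-1` _ = if decode n is Some s then
      (if code s == n then [set t | [seq `[< B t >] | B <- L] = s] else set0) else set0).
    case: (decode n) => [s|]; last exact: measurable0.
    case: ifP => _; last exact: measurable0.
    elim: L s LP {q} => [|B L IH] [|b s] LP /=.
    - by rewrite (_ : mkset _ = setT); [exact: measurableT|exact/seteqP].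
    - by rewrite (_ : mkset _ = set0); [exact: measurable0|apply/seteqP; split=> t].
    - by rewrite (_ : mkset _ = set0); [exact: measurable0|apply/seteqP; split=> t].
    - rewrite (_ : mkset _ = [set t | `[< B t >] = b] `&` [set t | [seq `[< B t >] | B <- L] = s]).
        apply: measurableI; last by apply: IH => B' B'L; apply: LP; rewrite inE B'L orbT.
        have [mB _ _] := LP B (mem_head _ _).
        case: b; first by rewrite (_ : mkset _ = B)//; apply/seteqP; split=> t /asboolP.
        rewrite (_ : mkset _ = ~` B); first exact: measurableC.
        by apply/seteqP; split=> t; [move=> /asboolPn|move=> h; apply/asboolPn].
      apply/seteqP; split=> t /=; first by case=> -> ->.
      by case=> -> ->.
  apply/seteqP; split=> t; first by move=> ht; rewrite -(ht : q t = n) /q codeK eqxx.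
  by case: (decode n) => [s|] //; case: ifPn => // /eqP <- st; congr code.
have Uq : \forall p \near U, cone q p by apply: FU; exists q.
have UL : \forall p \near U, forall B, B \in L -> 0 < m (B `&` Bd p).
  elim: (L) LP => [|B L' IH] LP; first by apply: nearW.
  have [mB BN B0] := LP B (mem_head _ _).
  have h : \forall p \near U, forall B, B \in L' -> 0 < m (B `&` Bd p).
    by apply: IH => B' B'L; apply: LP; rewrite inE B'L orbT.
  apply: filterS2 (pos B mB BN B0) h => p h1 h2 B'.
  by rewrite inE => /orP[/eqP->|/h2].
have [p [[mp [g qE]] pL]] := filter_ex (filterI Uq UL).
exists (K p) => B BL; have [mB BN B0] := LP B BL.
have [t [Bt [tp tm]]] : B `&` Bd p !=set0.
  apply/set0P/eqP => h; have := pL B BL; by rewrite h prob_set0 ltxx.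
have pB : p @^-1` [set p t] `<=` B.
  move=> s /= st; have : q s = q t by rewrite qE /= st.
  move=> /(pcan_inj codeK) h; have := congr1 (fun u => nth false u (index B L)) h.
  rewrite !(nth_map set0) ?index_mem// nth_index// => h'.
  by apply/asboolP; rewrite h'; apply/asboolP.
by split; [apply: lt_le_trans tp _|apply: lt_le_trans tm _]; apply: prob_mono;
  try exact: measurableI; move=> x [] /pB.
Qed.

End oscillation.

Section coordinates.
Context (d : measure_display) (T : topMeasurableType d) (R : realType) (mu : probability T R).
Local Notation m E := (fine (mu E)).
Local Notation fine_in Delta := (partial_partition (fun E t => E `<=` Delta t)).
Hypothesis qr : quasi_radon mu.
Variables (f : nat -> T -> R) (z : nat -> R).

Definition uniform_gauge_limit := forall e : R, 0 < e -> exists Delta (r : R),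
  [/\ gauge Delta, 0 < r & forall p, fine_in Delta p -> m (~` supp p) <= r ->
    forall k, `|z k - riemann_sum mu (f k : T -> R^o) p| <= e].

Hypothesis fz : uniform_gauge_limit.

(* If both level sets have gauge unions covering [A], then [A] can be filled with
   tags from either of them, and the two sums differ by [(b - a) * m A]. *)
Lemma level_sets_separate (A : set T) (a b : R) : measurable A -> a < b -> 0 < m A ->
  exists Delta (e : R), [/\ gauge Delta, 0 < e & forall k (Hm Hp : set T),
    (forall t, Hm t -> f k t <= a) -> (forall t, Hp t -> b <= f k t) ->
    m (A `\` gauge_union Delta Hm) <= e -> m (A `\` gauge_union Delta Hp) <= e -> False].
Proof.
move=> mA ab A0; pose c := (b - a) * m A.
have c0 : 0 < c by rewrite mulr_gt0// subr_gt0.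
have c8 : 0 < c / 8 by rewrite divr_gt0.
have [Delta [r [gD r0 rP]]] := fz c8.
pose M := `|a| + `|b| + 1.
have M0 : 0 < M by rewrite ltr_wpDl// addr_ge0.
pose e := Num.min (r / 3) (c / 8 / M).
have e0 : 0 < e by rewrite lt_min !divr_gt0.
have er : 3 * e <= r.
  have : e <= r / 3 by rewrite /e ge_min lexx.
  lra.
have eM : e * M <= c / 8.
  by rewrite -ler_pdivlMr// /e ge_min lexx orbT.
exists Delta, e; split=> // k Hm Hp Hma Hpb Am Ap.
have [p0 p0P p0e] := gauge_partial_cover qr setT gD (measurableC mA) e0.
have mW H := gauge_union_measurable qr H gD.
have sub H : m (A `\` gauge_union Delta H) <= e -> exists p, [/\
    partial_partition (fun E t => [/\ E `<=` Delta t, E `<=` A & H t]) p,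
    m A - 2 * e <= m (supp p) <= m A &
    `|z k - (riemann_sum mu (f k : T -> R^o) p + riemann_sum mu (f k : T -> R^o) p0)| <= c / 8].
  move=> Ae; have [p pP pe] := gauge_partial_cover qr H gD mA e0.
  have mp := partial_partition_measurable pP.
  have mp0 := partial_partition_measurable p0P.
  have pA : supp p `<=` A.
    by move=> x /supp_mem[q qp qx]; have [_ [_ h _]] := partial_partition_mem pP qp; exact: h.
  have p0A : supp p0 `<=` ~` A.
    by move=> x /supp_mem[q qp qx]; have [_ [_ h _]] := partial_partition_mem p0P qp; exact: h.
  have pp : m A <= m (supp p) + 2 * e.
    apply: (@le_trans _ _ (m (supp p `|` ((A `\` gauge_union Delta H) `|`
        ((A `&` gauge_union Delta H) `\` supp p))))).
      apply: prob_mono => //.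
        apply: measurableU => //; apply: measurableU; first exact: measurableD.
        by apply: measurableD => //; exact: measurableI.
      move=> x Ax; have [?|?] := pselect (supp p x); first by left.
      by right; have [?|?] := pselect (gauge_union Delta H x); [right|left].
    rewrite (le_trans (prob_setU_le _ _ _))//.
      apply: measurableU; first exact: measurableD.
      by apply: measurableD => //; exact: measurableI.
    rewrite lerD2l (le_trans (prob_setU_le _ _ _))//; last lra.
      exact: measurableD.
    by apply: measurableD => //; exact: measurableI.
  exists p; split=> //.
    by rewrite prob_mono// andbT; lra.
  rewrite -riemann_sum_cat; apply: rP.
    apply: partial_partition_cat.
    - by apply: partial_partition_sub pP => E t [].
    - by apply: partial_partition_sub p0P => E t [].
    - by rewrite -subset0 => x [/pA Ax /p0A].
  apply: le_trans er; rewrite supp_cat.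
  have p0e' : m (~` A `\` supp p0) <= e.
    apply: le_trans p0e; apply: prob_mono.
    - exact: measurableD (measurableC mA) mp0.
    - apply: measurableD => //; apply: measurableI => //; exact: measurableC.
    - by move=> x [nA np]; split=> //; split=> //; exists x => //; exact: (gD x).2.
  have pe' : m (A `\` supp p) <= 2 * e.
    have := prob_setID mu mA mp; rewrite (_ : A `&` supp p = supp p); first lra.
    exact/setIidr.
  apply: (@le_trans _ _ (m ((A `\` supp p) `|` (~` A `\` supp p0)))).
    apply: prob_mono; first by apply: measurableC; exact: measurableU.
      by apply: measurableU; [exact: measurableD|exact: measurableD (measurableC mA) mp0].
    move=> x nx; have [Ax|nA] := pselect (A x); [left|right]; split=> // ?; apply: nx.
      by left.
    by right.
  rewrite (le_trans (prob_setU_le _ _ _))//; last lra.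
    exact: measurableD.
  exact: measurableD (measurableC mA) mp0.
have [pm [pmP /andP[pm1 pm2] pmz]] := sub Hm Am.
have [pp [ppP /andP[pp1 pp2] ppz]] := sub Hp Ap.
have um : riemann_sum mu (f k : T -> R^o) pm <= a * m (supp pm).
  apply: riemann_sum_le (pmP) _ => q qp.
  by have [_ [_ _]] := partial_partition_mem pmP qp; exact: Hma.
have up : b * m (supp pp) <= riemann_sum mu (f k : T -> R^o) pp.
  apply: riemann_sum_ge (ppP) _ => q qp.
  by have [_ [_ _]] := partial_partition_mem ppP qp; exact: Hpb.
have am : a * m (supp pm) <= a * m A + `|a| * (2 * e).
  have : - a <= `|a| by rewrite -normrN ler_norm.
  have := ler_norm a; nra.
have bp : b * m A - `|b| * (2 * e) <= b * m (supp pp).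
  have : - b <= `|b| by rewrite -normrN ler_norm.
  have := ler_norm b; nra.
move: pmz ppz; rewrite !ler_norml => /andP[_ h1] /andP[h2 _].
have cE : c = b * m A - a * m A by rewrite /c mulrBl.
have lin (sm sp s0 zk : R) : sm <= a * m (supp pm) -> b * m (supp pp) <= sp ->
    zk - (sm + s0) <= c / 8 -> - (c / 8) <= zk - (sp + s0) -> False.
  by move: eM; rewrite /M !mulrDr mulr1; lra.
exact: lin um up h1 h2.
Qed.

Lemma measurable_level k c : measurable [set t | f k t <= c].
Proof.
have [P [mP SP PS]] := measurable_hull mu [set t | f k t <= c].
have [Q QP] : {Q : nat -> set T & forall n, [/\ measurable (Q n),
    [set t | c + n.+1%:R^-1 <= f k t] `<=` Q n & forall Q', measurable Q' ->
    [set t | c + n.+1%:R^-1 <= f k t] `&` Q' = set0 -> m (Q n `&` Q') = 0]}.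
  apply: (@choice nat (set T) (fun n Q => [/\ measurable Q,
    [set t | c + n.+1%:R^-1 <= f k t] `<=` Q & forall Q', measurable Q' ->
    [set t | c + n.+1%:R^-1 <= f k t] `&` Q' = set0 -> m (Q `&` Q') = 0])) => n.
  exact: measurable_hull.
have mQ n : measurable (Q n) by case: (QP n).
have PQ n : m (P `&` Q n) = 0.
  apply/eqP; apply: contrapT => /negP PQ0.
  have {}PQ0 : 0 < m (P `&` Q n) by rewrite lt0r PQ0 prob_ge0.
  have mPQ : measurable (P `&` Q n) by exact: measurableI.
  have ab : c < c + n.+1%:R^-1 by rewrite ltrDl invr_gt0.
  have [Delta [e [gD e0 De]]] := level_sets_separate mPQ ab PQ0.
  have cov H (Z : set T) : measurable Z -> (forall Q', measurable Q' -> H `&` Q' = set0 ->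
      m (Z `&` Q') = 0) -> P `&` Q n `<=` Z ->
      m ((P `&` Q n) `\` gauge_union Delta H) <= e.
    move=> mZ ZH PZ; have mW := gauge_union_measurable qr H gD.
    apply: (@le_trans _ _ (m (Z `&` ~` gauge_union Delta H))); last first.
      rewrite ZH ?(ltW e0)//; first exact: measurableC.
      by rewrite -subset0 => x [Hx]; apply; exact: sub_gauge_union.
    apply: prob_mono; first exact: measurableD.
      by apply: measurableI => //; exact: measurableC.
    by move=> x [/PZ].
  apply: (De k [set t | f k t <= c] [set t | c + n.+1%:R^-1 <= f k t]) => //.
    by apply: (cov _ P) => // x [].
  by apply: (cov _ (Q n)) => //; case: (QP n).
pose N := \bigcup_n (P `&` Q n).
have mN n : measurable (P `&` Q n) by exact: measurableI.
have mNU : measurable N by exact: bigcup_measurable.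
have N0 : mu N = 0%E by rewrite probE// prob_bigcup_null.
rewrite (_ : [set t | f k t <= c] = P `\` (P `\` [set t | f k t <= c])); last first.
  by rewrite setDD; apply/esym/setIidr.
apply: measurableD => //; apply: (qr_complete qr); exists N; split=> // t [Pt /negP].
rewrite -ltNge => ct; have : 0 < f k t - c by rewrite subr_gt0.
move=> ft0; have [n _ en] : \forall n \near \oo, `|n.+1%:R^-1 : R| < f k t - c.
  by have /cvgr0Pnorm_lt := @cvg_harmonic R; apply.
exists n => //; split=> //; case: (QP n) => _ + _; apply => /=.
have := le_lt_trans (ler_norm _) (en n (leqnn n)); rewrite ltrBrDl.
exact: ltW.
Qed.

Lemma oscillation_partition (a b e : R) : a < b -> 0 < e ->
  exists (p : T -> nat) (N : set T), [/\ forall n, measurable (p @^-1` [set n]),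
    measurable N, m N = 0 & forall k, exists V : set nat, m (p @^-1` V) <= e /\
      forall t t', ~ N t -> ~ N t' -> p t = p t' -> ~ V (p t) ->
        f k t <= a -> f k t' <= b].
Proof.
move=> ab e0.
pose Hm k := [set t | f k t <= a]; pose Hp k := ~` [set t | f k t <= b].
have mHm k : measurable (Hm k) by exact: measurable_level.
have mHp k : measurable (Hp k) by apply: measurableC; exact: measurable_level.
have [p [mp pP]] : exists p : T -> nat, (forall n, measurable (p @^-1` [set n])) /\
    forall k, m (p @^-1` [set n | 0 < m (p @^-1` [set n] `&` Hp k) /\
                                 0 < m (p @^-1` [set n] `&` Hm k)]) <= e.
  apply: contrapT => h.
  have [p mp|A [mA A0 AL]] := @positive_family _ _ _ mu Hp Hm e mHp mHm e0.
    apply: contrapT => h'; apply: h; exists p; split=> // k; rewrite leNgt.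
    by apply/negP => h''; apply: h'; exists k.
  have [Delta [r [gD r0 rP]]] := level_sets_separate mA ab A0.
  pose H j := if odd j then Hp j./2 else Hm j./2.
  have mH j : measurable (H j) by rewrite /H; case: ifP.
  have [L [LP LH]] := gauge_tests qr gD mH mA r0.
  have [k kP] := AL L LP.
  apply: (rP k (Hm k) (Hp k)) => //.
  - by move=> t /negP; rewrite -ltNge => /ltW.
  - have := LH k.*2; rewrite /H odd_double doubleK; apply.
    by move=> B /kP[].
  - have := LH k.*2.+1; rewrite /H /= odd_double /= uphalf_double; apply.
    by move=> B /kP[].
pose W c := if @unpickle (nat * nat * bool)%type c is Some (n, k, s) then
  (let B := p @^-1` [set n] `&` (if s then Hp k else Hm k) in
   if `[< m B = 0 >] then B else set0) else set0.
have mW c : measurable (W c).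
  rewrite /W; case: (unpickle c) => [[[n k] s]|] //; case: ifP => // _.
  by apply: measurableI => //; case: s.
exists p, (\bigcup_c W c); split=> //; first exact: bigcup_measurable.
  apply: prob_bigcup_null => // c; rewrite /W; case: (unpickle c) => [[[n k] s]|] //=.
    by case: ifPn => [/asboolP|_] //; exact: prob_set0.
  exact: prob_set0.
have WP t k s : ~ (\bigcup_c W c) t -> (if s then Hp k else Hm k) t ->
    0 < m (p @^-1` [set p t] `&` (if s then Hp k else Hm k)).
  move=> nW Ht; rewrite lt0r prob_ge0 andbT; apply/eqP => h; apply: nW.
  exists (pickle (p t, k, s)) => //; rewrite /W pickleK /=.
  by case: ifPn => [_|/asboolP] //; split.
move=> k; exists [set n | 0 < m (p @^-1` [set n] `&` Hp k) /\
                          0 < m (p @^-1` [set n] `&` Hm k)]; split=> //.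
move=> t t' nt nt' tt' nV ta; rewrite leNgt; apply/negP => tb; apply: nV; split.
  rewrite tt'; apply: (WP t' k true nt').
  by apply/negP; rewrite -ltNge.
exact: (WP t k false nt).
Qed.

End coordinates.

Section level_partition.
Context (d : measure_display) (T : topMeasurableType d) (R : realType) (mu : probability T R).
Local Notation m E := (fine (mu E)).
Hypothesis qr : quasi_radon mu.
Variables (f : nat -> T -> R) (z : nat -> R).
Hypothesis fz : uniform_gauge_limit mu f z.

Lemma finite_oscillation_partition (a b : nat -> R) (e : R) J : (forall j, a j < b j) ->
  0 < e -> exists (p : T -> nat) (N : set T), [/\ forall n, measurable (p @^-1` [set n]),
    measurable N, m N = 0 & forall k, exists V : set nat, m (p @^-1` V) <= J%:R * e /\
      forall t t' j, (j < J)%N -> ~ N t -> ~ N t' -> p t = p t' -> ~ V (p t) ->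
        f k t <= a j -> f k t' <= b j].
Proof.
move=> ab e0; elim: J => [|J [p [N [mp mN N0 pP]]]].
  exists (fun=> 0%N), set0; split=> //; last 2 first.
  - exact: prob_set0.
  - by move=> k; exists set0; rewrite preimage_set0 prob_set0 mul0r.
  move=> n; have [->|n0] := eqVneq n 0%N; first by rewrite preimage_cst mem_set.
  by rewrite preimage_cst memNset//= => /esym/eqP; rewrite (negbTE n0).
have [p' [N' [mp' mN' N'0 p'P]]] := oscillation_partition qr fz (ab J) e0.
pose dec n := odflt (0, 0)%N (@unpickle (nat * nat)%type n).
pose q t := pickle (p t, p' t).
have qK t : dec (q t) = (p t, p' t) by rewrite /dec pickleK.
have mq n : measurable (q @^-1` [set n]).
  rewrite (_ : _ @^-1` _ =
      (if pickle (dec n) == n then p @^-1` [set (dec n).1] `&` p' @^-1` [set (dec n).2] else set0)).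
    by case: ifP => _ //; exact: measurableI.
  apply/seteqP; split=> t /=; first by move=> <-; rewrite qK eqxx.
  by case: ifPn => // /eqP nE [/= h1 h2]; rewrite /q h1 h2 -[RHS]nE; case: (dec n).
exists q, (N `|` N'); split=> //; first exact: measurableU.
  apply/eqP; rewrite eq_le prob_ge0 andbT (le_trans (prob_setU_le _ _ _))//.
  by rewrite N0 N'0 addr0.
move=> k; have [V [Ve VP]] := pP k; have [V' [V'e V'P]] := p'P k.
exists [set n | V (dec n).1 \/ V' (dec n).2]; split.
  rewrite (_ : _ @^-1` _ = p @^-1` V `|` p' @^-1` V'); last first.
    by apply/seteqP; split=> t; rewrite /preimage /= qK.
  rewrite (le_trans (prob_setU_le _ _ _))//; try exact: measurable_nat_preimage.
  by rewrite -natr1 mulrDl mul1r lerD.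
move=> t t' j; rewrite ltnS leq_eqVlt /= qK => jJ nt nt' qq nV ta.
have [pp pp'] : p t = p t' /\ p' t = p' t'.
  by have := congr1 dec qq; rewrite !qK => -[].
case/orP : jJ => [/eqP jJ|jJ].
  rewrite jJ in ta *; apply: V'P ta => //.
  - by move=> ?; apply: nt; right.
  - by move=> ?; apply: nt'; right.
  - by move=> ?; apply: nV; right.
apply: VP ta => //.
- by move=> ?; apply: nt; left.
- by move=> ?; apply: nt'; left.
- by move=> ?; apply: nV; left.
Qed.

Lemma bounded_oscillation_partition (h e M : R) : 0 < h -> 0 < e -> 0 <= M ->
  exists (p : T -> nat) (N : set T), [/\ forall n, measurable (p @^-1` [set n]),
    measurable N, m N = 0 & forall k, exists V : set nat, m (p @^-1` V) <= e /\
      forall t t', ~ N t -> ~ N t' -> p t = p t' -> ~ V (p t) ->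
        `|f k t| <= M -> `|f k t'| <= M -> `|f k t - f k t'| <= 2 * h].
Proof.
move=> h0 e0 M0.
pose J := (Num.truncn (2 * M / h)).+2.
have eJ : 0 < e / J%:R by rewrite divr_gt0.
pose a j : R := - M + j%:R * h.
have ab j : a j < a j + h by rewrite ltrDl.
have [p [N [mp mN N0 pP]]] := finite_oscillation_partition J ab eJ.
exists p, N; split=> // k; have [V [Ve VP]] := pP k; exists V; split.
  by rewrite (le_trans Ve)// mulrCA divff ?mulr1// pnatr_eq0.
have one t t' : ~ N t -> ~ N t' -> p t = p t' -> ~ V (p t) ->
    `|f k t| <= M -> f k t' <= f k t + 2 * h.
  move=> nt nt' tt' nV; rewrite ler_norml => /andP[t1 t2].
  pose j := (Num.truncn ((f k t + M) / h)).+1.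
  have q0 : 0 <= (f k t + M) / h by rewrite divr_ge0 ?(ltW h0)//; lra.
  have j1 : f k t <= a j.
    have : (f k t + M) / h < j%:R by exact: truncnS_gt.
    by rewrite ltr_pdivrMr// /a; lra.
  have j2 : a j <= f k t + h.
    have : (Num.truncn ((f k t + M) / h))%:R <= (f k t + M) / h.
      by have /truncn_itv/andP[] := q0.
    by rewrite ler_pdivlMr// /a /j -natr1; lra.
  have jJ : (j < J)%N.
    rewrite /j /J ltnS ltnS; apply: le_truncn.
    by rewrite ler_pM2r ?invr_gt0//; lra.
  by have := VP t t' j jJ nt nt' tt' nV j1; lra.
move=> t t' nt nt' tt' nV tM t'M; rewrite ler_norml; apply/andP; split.
  by have := one t t' nt nt' tt' nV tM; lra.
have nV' : ~ V (p t') by rewrite -tt'.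
by have := one t' t nt' nt (esym tt') nV' t'M; lra.
Qed.

(* [lev] bounds the norm on each piece; [V] collects the pieces on which [f k]
   oscillates, and has small measure at every level. *)
Lemma level_partition (e : R) : 0 < e -> (forall t, exists C, forall k, `|f k t| <= C) ->
  exists (p lev : T -> nat) (N : set T), [/\ forall n, measurable (p @^-1` [set n]),
    forall n, measurable (lev @^-1` [set n]), measurable N, m N = 0 &
    [/\ forall t t', p t = p t' -> lev t = lev t', forall k t, `|f k t| <= (lev t)%:R &
     forall k, exists V : set nat,
      (forall M, (2 * M%:R) * m (lev @^-1` [set M] `&` p @^-1` V) <= e / 2 ^+ M) /\
      forall t t', ~ N t -> ~ N t' -> p t = p t' -> ~ V (p t) ->
        `|f k t - f k t'| <= 2 * e]].
Proof.
move=> e0 fb.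
pose B M := [set t | forall k, - M%:R < f k t <= M%:R].
have mB M : measurable (B M).
  rewrite (_ : B M = \bigcap_k ([set t | f k t <= M%:R] `&` ~` [set t | f k t <= - M%:R])).
    apply: bigcap_measurable => // k _; apply: measurableI; first exact: (measurable_level qr fz).
    by apply: measurableC; exact: (measurable_level qr fz).
  apply/seteqP; split=> t h k.
    by move=> _; have /andP[h1 h2] := h k; split=> //; apply/negP; rewrite -ltNge.
  by have [// h1 /negP] := h k I; rewrite -ltNge => ->.
have exB t : exists M, `[< B M t >].
  have [C fC] := fb t; exists (Num.truncn C).+1; apply/asboolP => k.
  have := fC k; rewrite ler_norml => /andP[h1 h2].
  have := truncnS_gt C; move: (_.+1%:R) => c cC; apply/andP; split; lra.
pose lev t := ex_minn (exB t).
have levB t : B (lev t) t by rewrite /lev; case: ex_minnP => M /asboolP.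
have mlev n : measurable (lev @^-1` [set n]).
  rewrite (_ : _ @^-1` _ = B n `\` \big[setU/set0]_(i < n) B i).
    by apply: measurableD => //; exact: bigsetU_measurable.
  apply/seteqP; split=> t /=.
    move=> <-; split; first exact: levB.
    rewrite -bigcup_mkord => -[i /= il Bi]; move: il; rewrite /lev; case: ex_minnP => M _.
    by move=> /(_ i); rewrite asboolT// => /(_ isT); rewrite leqNgt => /negP.
  move=> [Bn nB]; apply/eqP; rewrite eqn_leq; apply/andP; split.
    by rewrite /lev; case: ex_minnP => M _; apply; exact/asboolP.
  rewrite leqNgt; apply/negP => ln; apply: nB; rewrite -bigcup_mkord.
  by exists (lev t).
pose eM (M : nat) : R := e / 2 ^+ M / (2 * M%:R + 1).
have eM0 M : 0 < eM M by rewrite !divr_gt0 ?exprn_gt0// ltr_wpDl.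
have eMle M : 2 * M%:R * eM M <= e / 2 ^+ M.
  rewrite /eM mulrCA ler_piMr ?divr_ge0 ?exprn_ge0 ?(ltW e0)//.
  by rewrite ler_pdivrMr ?mul1r ?lerDl// ltr_wpDl.
have [pN pNP] : {pN : nat -> (T -> nat) * set T & forall M, [/\
    forall n, measurable ((pN M).1 @^-1` [set n]), measurable (pN M).2, m (pN M).2 = 0 &
    forall k, exists V : set nat, m ((pN M).1 @^-1` V) <= eM M /\
      forall t t', ~ (pN M).2 t -> ~ (pN M).2 t' -> (pN M).1 t = (pN M).1 t' ->
        ~ V ((pN M).1 t) -> `|f k t| <= M%:R -> `|f k t'| <= M%:R ->
        `|f k t - f k t'| <= 2 * e]}.
  apply: (@choice nat ((T -> nat) * set T)%type (fun M y => [/\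
    forall n, measurable (y.1 @^-1` [set n]), measurable y.2, m y.2 = 0 &
    forall k, exists V : set nat, m (y.1 @^-1` V) <= eM M /\
      forall t t', ~ y.2 t -> ~ y.2 t' -> y.1 t = y.1 t' ->
        ~ V (y.1 t) -> `|f k t| <= M%:R -> `|f k t'| <= M%:R ->
        `|f k t - f k t'| <= 2 * e])) => M.
  have [p [N h]] := bounded_oscillation_partition e0 (eM0 M) (ler0n R M).
  by exists (p, N).
have mpN M n : measurable ((pN M).1 @^-1` [set n]) by case: (pNP M).
have mN M : measurable (pN M).2 by case: (pNP M).
pose dec n := odflt (0, 0)%N (@unpickle (nat * nat)%type n).
pose q t := pickle (lev t, (pN (lev t)).1 t).
have qK t : dec (q t) = (lev t, (pN (lev t)).1 t) by rewrite /dec pickleK.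
have flev k t : `|f k t| <= (lev t)%:R.
  by have := levB t k; rewrite ler_norml => /andP[/ltW-> ->].
exists q, lev, (\bigcup_M (pN M).2); split=> //.
- move=> n; rewrite (_ : _ @^-1` _ =
      (if pickle (dec n) == n then lev @^-1` [set (dec n).1] `&`
       (pN (dec n).1).1 @^-1` [set (dec n).2] else set0)).
    by case: ifP => _ //; exact: measurableI.
  apply/seteqP; split=> t /=; first by move=> <-; rewrite qK eqxx.
  case: ifPn => // /eqP nE [/= h1 h2]; rewrite /q h1 h2 -[RHS]nE.
  by case: (dec n).
- exact: bigcup_measurable.
- by apply: prob_bigcup_null => // M; case: (pNP M).
split=> //; first by move=> t t' tt'; have := congr1 dec tt'; rewrite !qK => -[].
move=> k.
have [V VP] : {V : nat -> set nat & forall M, m ((pN M).1 @^-1` V M) <= eM M /\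
      forall t t', ~ (pN M).2 t -> ~ (pN M).2 t' -> (pN M).1 t = (pN M).1 t' ->
        ~ V M ((pN M).1 t) -> `|f k t| <= M%:R -> `|f k t'| <= M%:R ->
        `|f k t - f k t'| <= 2 * e}.
  apply: (@choice nat (set nat) (fun M V => m ((pN M).1 @^-1` V) <= eM M /\
      forall t t', ~ (pN M).2 t -> ~ (pN M).2 t' -> (pN M).1 t = (pN M).1 t' ->
        ~ V ((pN M).1 t) -> `|f k t| <= M%:R -> `|f k t'| <= M%:R ->
        `|f k t - f k t'| <= 2 * e)) => M.
  by case: (pNP M) => _ _ _ /(_ k).
exists [set n | V (dec n).1 (dec n).2]; split.
  move=> M; apply: le_trans (eMle M); rewrite ler_wpM2l ?mulr_ge0//.
  apply: le_trans (VP M).1; apply: prob_mono.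
  - rewrite (_ : _ `&` _ = lev @^-1` [set M] `&` (pN M).1 @^-1` V M).
      by apply: measurableI => //; exact: measurable_nat_preimage.
    by apply/seteqP; split=> t /= [lM]; rewrite /preimage /= qK /= lM.
  - exact: measurable_nat_preimage.
  - by move=> t /= [lM]; rewrite /preimage /= qK /= lM.
move=> t t' nt nt' tt'; have := congr1 dec tt'; rewrite /= !qK /= => -[ll pp] nV.
apply: (VP (lev t)).2 => //.
- by move=> h; apply: nt; exists (lev t).
- by move=> h; apply: nt'; exists (lev t).
- by rewrite pp ll.
- by rewrite ll.
Qed.

End level_partition.

(** * From McShane to Birkhoff *)

Section series.
Variables (R : realType) (V : completeNormedModType R).

Lemma cvg_seriesP (u : nat -> V) : cvgn (series u) <->
  forall e : R, 0 < e -> exists N, forall k n, (N <= k <= n)%N ->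
    `|\sum_(k <= i < n) u i| <= e.
Proof.
split=> [cu e e0|h].
  have /cauchy_seriesP/(_ _ e0) : cauchy (series u @ \oo) by exact/cauchy_cvgP.
  move=> [[P Q] /= [[N1 _ P1] [N2 _ Q2]] PQ]; exists (maxn N1 N2) => k n /andP[Nk kn].
  apply: ltW; apply: (PQ (k, n)); split=> /=.
    by apply: P1; rewrite /= (leq_trans _ Nk)// leq_maxl.
  by apply: Q2; rewrite /= (leq_trans _ (leq_trans Nk kn))// leq_maxr.
apply/cauchy_cvgP/cauchy_seriesP => e e0.
have e2 : 0 < e / 2 by rewrite divr_gt0.
have [N NP] := h _ e2.
exists ([set n | (N <= n)%N], [set n | (N <= n)%N]); first by split; exists N.
move=> [k n] [/= Nk Nn]; have [kn|nk] := leqP k n.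
  rewrite (le_lt_trans (NP k n _)) ?Nk//; lra.
by rewrite big_geq ?(ltnW nk)// normr0.
Qed.

End series.

Section linfty_coordinates.
Variables (R : realType) (S : Type).

Lemma linfty_sum (I : Type) (s : seq I) (P : pred I) (g : I -> linfty R S) x :
  (\sum_(i <- s | P i) g i : linfty R S) x = \sum_(i <- s | P i) g i x.
Proof. by apply: (big_morph (fun g : linfty R S => g x)). Qed.

End linfty_coordinates.

Section birkhoff_of_gauge_limit.
Context (d : measure_display) (T : topMeasurableType d) (R : realType) (mu : probability T R).
Local Notation m E := (fine (mu E)).
Local Notation fine_in Delta := (partial_partition (fun E t => E `<=` Delta t)).
Hypothesis qr : quasi_radon mu.

Lemma sum_prob_le (A : nat -> set T) (s : seq nat) (P : pred nat) (B : set T) :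
  (forall n, measurable (A n)) -> trivIset [set: nat] A -> uniq s -> measurable B ->
  (forall n, n \in s -> P n -> A n `<=` B) -> \sum_(n <- s | P n) m (A n) <= m B.
Proof.
move=> mA tA; elim: s B => [|n s IH] B /=; first by rewrite big_nil prob_ge0.
move=> /andP[ns us] mB AB; rewrite big_cons; case: ifPn => [Pn|_]; last first.
  by apply: IH => // k ks; apply: AB; rewrite inE ks orbT.
rewrite (prob_setID mu mB (mA n)) lerD//.
  have -> : B `&` A n = A n by apply/setIidr; apply: AB; rewrite ?mem_head.
  by [].
apply: IH => //; first exact: measurableD.
move=> k ks Pk x kx; split; first by apply: (AB k) => //; rewrite inE ks orbT.
move=> nx; move/trivIsetP : tA => /(_ n k I I).
have nk : n != k by apply: contraNneq ns => ->.
by move=> /(_ nk)/seteqP[/(_ x) h _]; exact: h.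
Qed.

Lemma gauge_limit_small (V : completeNormedModType R) (G : T -> V) (z : V) (e : R) :
  gauge_limit mu G z -> 0 < e -> exists Delta (r : R), [/\ gauge Delta, 0 < r,
    forall p, fine_in Delta p -> m (~` supp p) <= r -> `|z - riemann_sum mu G p| <= e &
    forall p, fine_in Delta p -> m (supp p) <= r -> `|riemann_sum mu G p| <= e].
Proof.
move=> Gz e0; have e2 : 0 < e / 2 by rewrite divr_gt0.
have [Delta [r [gD r0 rP]]] := Gz _ e2.
have r2 : 0 < r / 2 by rewrite divr_gt0.
exists Delta, (r / 2); split=> // p pD pr.
  by rewrite (le_trans (rP p pD _))//; lra.
have mp := partial_partition_measurable pD.
have [q qP qe] := gauge_partial_cover qr setT gD (measurableC mp) r2.
have qD : fine_in Delta q by apply: partial_partition_sub qP => E t [].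
have mq := partial_partition_measurable qD.
have qp : supp q `<=` ~` supp p.
  by move=> x /supp_mem[c cq cx]; have [_ [_ h _]] := partial_partition_mem qP cq; exact: h.
have qe' : m (~` supp p `\` supp q) <= r / 2.
  apply: le_trans qe; apply: prob_mono.
  - exact: measurableD (measurableC mp) mq.
  - apply: measurableD => //; apply: measurableI; first exact: measurableC.
    exact: (gauge_union_measurable qr).
  - by move=> x [nA np]; split=> //; split=> //; exists x => //; exact: (gD x).2.
have h1 : `|z - riemann_sum mu G q| <= e / 2.
  apply: rP => //; apply: (@le_trans _ _ (m (supp p `|` (~` supp p `\` supp q)))).
    apply: prob_mono; first exact: measurableC.
      by apply: measurableU => //; exact: measurableD (measurableC mp) mq.
    by move=> x nq; have [px|npx] := pselect (supp p x); [left|right].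
  rewrite (le_trans (prob_setU_le _ _ _))//; first exact: measurableD (measurableC mp) mq.
  lra.
have h2 : `|z - (riemann_sum mu G p + riemann_sum mu G q)| <= e / 2.
  rewrite -riemann_sum_cat; apply: rP.
    apply: partial_partition_cat => //.
    by rewrite -subset0 => x [px /qp].
  apply: (@le_trans _ _ (m (~` supp p `\` supp q))); last lra.
  apply: prob_mono.
  - by rewrite supp_cat; apply: measurableC; exact: measurableU.
  - exact: measurableD (measurableC mp) mq.
  - by rewrite supp_cat setCU => x [].
rewrite (_ : riemann_sum mu G p = (z - riemann_sum mu G q) -
    (z - (riemann_sum mu G p + riemann_sum mu G q))).
  by rewrite (le_trans (ler_normB _ _))// [leRHS]splitr lerD.
by rewrite opprB addrC addrA subrK addrK.
Qed.

Lemma approximating_partition (f : nat -> T -> R) (A : nat -> set T) (Delta : T -> set T)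
    (t : nat -> T) (c : nat -> R) (s : seq nat) (e : R) :
  (forall n, measurable (A n)) -> trivIset [set: nat] A -> gauge Delta ->
  (forall n, 0 < m (A n) -> A n (t n)) ->
  (forall k n, 0 < m (A n) -> `|f k (t n)| <= c n) -> uniq s -> 0 < e ->
  exists p, [/\ fine_in Delta p, forall x, supp p x -> exists2 n, n \in s & A n x,
    \sum_(n <- s) m (A n) - e <= m (supp p) <= \sum_(n <- s) m (A n) &
    forall k (o : nat -> R), (forall n, 0 <= o n) ->
      (forall n t', 0 < m (A n) -> A n t' -> `|f k (t n) - f k t'| <= o n) ->
      `|\sum_(n <- s) m (A n) * f k (t n) - riemann_sum mu (f k : T -> R^o) p| <=
        \sum_(n <- s) m (A n) * o n + e].
Proof.
move=> mA tA gD At fc; elim: s e => [|n s IH] e /=.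
  move=> _ e0; exists [::]; split=> //.
  - by rewrite supp_nil.
  - by rewrite big_nil supp_nil prob_set0 sub0r oppr_le0 ltW /=.
  - by move=> k o _ _; rewrite /riemann_sum !big_nil subrr normr0 add0r ltW.
move=> /andP[ns us] e0; have e2 : 0 < e / 2 by rewrite divr_gt0.
have [p [pD pA /andP[pe pe'] pk]] := IH _ us e2.
have [n0|n0] := eqVneq (m (A n)) 0.
  exists p; split=> //.
  - by move=> x /pA[k ks kx]; exists k => //; rewrite inE ks orbT.
  - by rewrite big_cons n0 add0r; apply/andP; split; lra.
  - move=> k o o0 ok; rewrite !big_cons n0 !mul0r !add0r.
    by rewrite (le_trans (pk k o o0 ok))//; lra.
have {}n0 : 0 < m (A n) by rewrite lt0r n0 prob_ge0.
have c0 : 0 <= c n by exact: le_trans (fc 0%N n n0).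
pose r := e / 2 / (c n + 1).
have c1 : 0 < c n + 1 by rewrite ltr_wpDl.
have r0 : 0 < r by rewrite divr_gt0.
have rc : r * (c n + 1) = e / 2 by rewrite divfK// gt_eqF.
have [q qP qe] := gauge_partial_cover qr (A n) gD (mA n) r0.
have qD : fine_in Delta q by apply: partial_partition_sub qP => E t' [].
have mq := partial_partition_measurable qD.
have mp := partial_partition_measurable pD.
have qA : supp q `<=` A n.
  by move=> x /supp_mem[b bq bx]; have [_ [_ h _]] := partial_partition_mem qP bq; exact: h.
have qp : supp q `&` supp p = set0.
  rewrite -subset0 => x [/qA nx /pA[k ks kx]].
  have nk : n != k by apply: contraNneq ns => ->.
  by move/trivIsetP : tA => /(_ n k I I nk)/seteqP[/(_ x) h _]; exact: h.
have qm : m (A n) - r <= m (supp q) <= m (A n).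
  rewrite prob_mono// andbT.
  have := prob_setID mu (mA n) mq; rewrite (_ : A n `&` supp q = supp q); last exact/setIidr.
  suff : m (A n `\` supp q) <= r by lra.
  apply: le_trans qe; apply: prob_mono.
  - exact: measurableD.
  - apply: measurableD => //; apply: measurableI => //; exact: (gauge_union_measurable qr).
  - by move=> x [nA np]; split=> //; split=> //; exists x => //; exact: (gD x).2.
exists (q ++ p); split.
- exact: partial_partition_cat.
- rewrite supp_cat => x [/qA nx|/pA[k ks kx]]; first by exists n; rewrite ?mem_head.
  by exists k => //; rewrite inE ks orbT.
- rewrite supp_cat prob_setU// big_cons; case/andP: qm => qm1 qm2.
  have : r <= e / 2 by rewrite -rc ler_peMr ?(ltW r0)// lerDr.
  by move=> ?; apply/andP; split; lra.
move=> k o o0 ok; rewrite riemann_sum_cat !big_cons.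
have := pk k o o0 ok; case/andP : qm => qm1 qm2.
have qs : `|m (supp q) * f k (t n) - riemann_sum mu (f k : T -> R^o) q| <= m (A n) * o n.
  apply: (@le_trans _ _ (m (supp q) * o n)); last by rewrite ler_wpM2r.
  rewrite (prob_supp mu qP) /riemann_sum !mulr_suml -sumrB (le_trans (ler_norm_sum _ _ _))//.
  rewrite big_seq [leRHS]big_seq; apply: ler_sum => b bq.
  rewrite -mulrBr normrM ger0_norm ?prob_ge0// ler_wpM2l ?prob_ge0//.
  by apply: ok => //; have [_ [_ _ h]] := partial_partition_mem qP bq.
have qc : `|(m (A n) - m (supp q)) * f k (t n)| <= e / 2.
  rewrite normrM ger0_norm; last lra.
  rewrite -rc ler_pM//; try lra.
  by rewrite (le_trans (fc _ _ n0))// lerDl.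
move: qs qc; rewrite mulrBl.
have lin (x1 x2 x3 x4 x5 b1 b2 : R) : `|x1 - x2| <= b1 -> `|x3 - x1| <= e / 2 ->
    `|x4 - x5| <= b2 + e / 2 -> `|x3 + x4 - (x2 + x5)| <= b1 + b2 + e.
  by rewrite !ler_norml => /andP[? ?] /andP[? ?] /andP[? ?]; apply/andP; split; lra.
exact: lin.
Qed.

Variables (S : Type) (G : T -> linfty R S) (z : linfty R S) (x : nat -> S).

Definition norming_for := forall (a : R) (l : seq (R * T)) (C : R),
  (forall k, `|a * z (x k) + \sum_(q <- l) q.1 * G q.2 (x k)| <= C) ->
  `|a *: z + \sum_(q <- l) q.1 *: G q.2| <= C.

Hypothesis Gz : gauge_limit mu G z.
Hypothesis Gx : norming_for.

Let f k t := G t (x k).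

Let riemann_coord p k : (riemann_sum mu G p : linfty R S) (x k) =
  riemann_sum mu (f k : T -> R^o) p.
Proof. by rewrite /riemann_sum linfty_sum. Qed.

Let coord_limit : uniform_gauge_limit mu f (fun k => z (x k)).
Proof.
move=> e e0; have [Delta [r [gD r0 rP]]] := Gz e0.
exists Delta, r; split=> // p pD pr k; rewrite -riemann_coord.
exact: le_trans (le_linfty_norm _ _) (rP p pD pr).
Qed.

Lemma birkhoff_partition (e : R) : 0 < e -> exists A : nat -> set T,
  countable_partition A /\ exists c : nat -> R,
  (forall k n t, 0 < m (A n) -> A n t -> `|f k t| <= c n) /\
  forall k, exists o : nat -> R, [/\ forall n, 0 <= o n,
    forall n t t', 0 < m (A n) -> A n t -> A n t' -> `|f k t - f k t'| <= o n &
    forall K s, uniq s -> \sum_(n <- s) m (A n) * o n <=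
      (2 * e + 2 * K%:R) * \sum_(n <- s) m (A n) + 2 * e / 2 ^+ K].
Proof.
move=> e0; have [t|p [lev [N [mp mlev mN N0 [levp flev pk]]]]] :=
  level_partition qr coord_limit e0.
  by exists `|G t| => k; exact: le_linfty_norm.
pose A n := if n is n'.+1 then p @^-1` [set n'] `\` N else N.
have mA n : measurable (A n) by case: n => [|n] //=; exact: measurableD.
have tA : trivIset [set: nat] A.
  apply/trivIsetP => i j _ _ ij; rewrite -subset0 => t [].
  case: i j ij => [|i] [|j] //=.
  - by move=> _ Nt [].
  - by move=> _ [].
  - by move=> ij [ti _] [tj _]; move: ij; rewrite -ti -tj eqxx.
exists A; split.
  split=> //; apply/seteqP; split=> t // _.
  have [Nt|nN] := pselect (N t); first by exists 0%N.
  by exists (p t).+1.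
have [L LP] : {L : nat -> nat & forall n t, A n t -> (0 < n)%N -> lev t = L n}.
  apply: (@choice nat nat (fun n L => forall t, A n t -> (0 < n)%N -> lev t = L)) => n.
  have [[t At]|nA] := pselect (A n !=set0); last by exists 0%N => t At; case: nA; exists t.
  exists (lev t) => t' At'; case: n At At' => //= n [pt _] [pt' _] _; apply: levp.
  by rewrite pt pt'.
exists (fun n => (L n)%:R); split.
  move=> k [|n] t; first by rewrite /= N0 ltxx.
  by move=> _ At; rewrite -(LP n.+1 t)//; exact: flev.
move=> k; have [V [Ve VP]] := pk k.
pose Q n := (0 < n)%N && `[< V n.-1 >].
exists (fun n => if n is n'.+1 then (if `[< V n' >] then 2 * (L n)%:R else 2 * e) else 0).
have e20 : 0 <= 2 * e by rewrite mulr_ge0// ltW.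
split.
- by case=> [|n] //; case: ifP => _ //; rewrite mulr_ge0.
- move=> [|n] t t'; first by rewrite /= N0 ltxx.
  move=> _ At At'; case: ifPn => [_|/asboolPn nV].
    rewrite (le_trans (ler_normB _ _))// mulr_natl mulr2n lerD//.
      by rewrite -(LP n.+1 t)//; exact: flev.
    by rewrite -(LP n.+1 t')//; exact: flev.
  case: At At' => [pt nt] [pt' nt']; apply: VP => //; first by rewrite pt pt'.
  by rewrite pt.
move=> K s us.
have step M : \sum_(n <- s | Q n && (L n == M)) m (A n) * (2 * (L n)%:R) <= e / 2 ^+ M.
  apply: le_trans (Ve M).
  rewrite (eq_bigr (fun n => 2 * M%:R * m (A n))) => [|n /andP[_ /eqP->]]; last by rewrite mulrC.
  rewrite -mulr_sumr ler_wpM2l ?mulr_ge0//; apply: sum_prob_le => //.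
    by apply: measurableI => //; exact: measurable_nat_preimage.
  move=> [|n] // _ /andP[/andP[_ /asboolP Vn] /eqP Ln] t At; split.
    by rewrite /preimage /= (LP n.+1 t).
  by case: At => pt _; rewrite /preimage /= pt.
have tail j : \sum_(n <- s | Q n && (K <= L n < K + j)%N) m (A n) * (2 * (L n)%:R) <=
    2 * e / 2 ^+ K - 2 * e / 2 ^+ (K + j).
  elim: j => [|j IH].
    rewrite addn0 subrr big_pred0// => n.
    by rewrite [(L n < K)%N]ltnNge andbN andbF.
  rewrite (bigID (fun n => L n == K + j)%N) /=.
  apply: (@le_trans _ _ (e / 2 ^+ (K + j) + (2 * e / 2 ^+ K - 2 * e / 2 ^+ (K + j)))).
    apply: lerD.
      rewrite (eq_bigl (fun n => Q n && (L n == K + j)%N)); first exact: step.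
      move=> n; case: eqVneq => [->|]; rewrite ?andbF// !andbT.
      by rewrite leq_addr addnS leqnn !andbT.
    apply: le_trans IH; rewrite le_eqVlt; apply/orP; left; apply/eqP; apply: eq_bigl => n.
    by case: (Q n) => //=; case: (K <= L n)%N => //=; rewrite addnS ltnS [in RHS]ltn_neqAle andbC.
  rewrite addnS exprS; have : 2 ^+ (K + j) != 0 :> R by rewrite expf_neq0.
  move: (2 ^+ (K + j)) => a a0; rewrite le_eqVlt; apply/orP; left; apply/eqP.
  by field; rewrite a0 expf_neq0.
pose J := (\max_(n <- s) L n).+1.
have {}tail : \sum_(n <- s | Q n && (K <= L n)%N) m (A n) * (2 * (L n)%:R) <= 2 * e / 2 ^+ K.
  apply: (@le_trans _ _ (2 * e / 2 ^+ K - 2 * e / 2 ^+ (K + J))); last first.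
    by rewrite gerBl divr_ge0 ?exprn_ge0.
  apply: le_trans (tail J); rewrite big_seq_cond [leRHS]big_seq_cond.
  rewrite le_eqVlt; apply/orP; left; apply/eqP; apply: eq_bigl => n.
  case ns : (n \in s) => //=; congr (_ && _).
  have -> : (L n < K + J)%N by rewrite addnS ltnS (leq_trans (leq_bigmax_seq _ ns isT))// leq_addl.
  by rewrite andbT.
apply: le_trans (lerD (lexx _) tail); rewrite mulr_sumr [X in _ + X]big_mkcond -big_split /=.
apply: ler_sum => -[|n] _ /=; first by rewrite N0 !mulr0 add0r.
have An := prob_ge0 mu (p @^-1` [set n] `\` N).
have KR := ler0n R K.
rewrite /Q /=; case: ifPn => Vn /=; last by rewrite addr0 mulrC ler_wpM2r// lerDl mulr_ge0.
case: ifPn => KL; first by rewrite lerDr mulr_ge0// addr_ge0// mulr_ge0.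
rewrite addr0 mulrC ler_wpM2r//; rewrite -ltnNge in KL.
have : (L n.+1)%:R <= K%:R :> R by rewrite ler_nat ltnW.
lra.
Qed.

Lemma prob_bigU_le_sum (A : nat -> set T) n : (forall i, measurable (A i)) ->
  m (\big[setU/set0]_(i < n) A i) <= \sum_(i < n) m (A i).
Proof.
move=> mA; elim: n => [|n IH]; first by rewrite !big_ord0 prob_set0.
rewrite !big_ord_recr /= (le_trans (prob_setU_le _ _ _))// ?lerD2r//.
exact: bigsetU_measurable.
Qed.

Lemma gauge_limit_birkhoff (e : R) : 0 < e ->
  exists2 A, summable_wrt mu G A & forall y, birkhoff_sums mu G A y -> `|y - z| <= e.
Proof.
move=> e0; have e8 : 0 < e / 8 by rewrite divr_gt0.
have [A [Ap [c [cb osc]]]] := birkhoff_partition e8.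
have mA := cp_measurable Ap; have tA := cp_disjoint Ap.
have est t eta : partition_choice A t -> 0 < eta -> exists2 r, 0 < r &
    forall s, uniq s ->
    (\sum_(n <- s) m (A n) <= r -> forall K,
      `|\sum_(n <- s) m (A n) *: G (t n)| <=
        (2 * (e / 8) + 2 * K%:R) * \sum_(n <- s) m (A n) + 2 * (e / 8) / 2 ^+ K + 2 * eta) /\
    (1 - r <= \sum_(n <- s) m (A n) ->
      `|z - \sum_(n <- s) m (A n) *: G (t n)| <= 4 * (e / 8) + 2 * eta).
  move=> At eta0.
  have At' n : 0 < m (A n) -> A n (t n).
    move=> n0; apply: At; apply: contrapT => /nonemptyPn An0.
    by move: n0; rewrite An0 prob_set0 ltxx.
  have [Delta [r0 [gD r00 rb rs]]] := gauge_limit_small Gz eta0.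
  have r2 : 0 < r0 / 2 by rewrite divr_gt0.
  exists (r0 / 2) => // s us.
  pose zeta := Num.min eta (r0 / 2).
  have zeta0 : 0 < zeta by rewrite lt_min eta0.
  have z1 : zeta <= eta by rewrite /zeta ge_min lexx.
  have z2 : zeta <= r0 / 2 by rewrite /zeta ge_min lexx orbT.
  have [p [pD _ /andP[p1 p2] pk]] := approximating_partition mA tA gD At'
    (fun k n n0 => cb k n (t n) n0 (At' n n0)) us zeta0.
  have est1 k K : `|\sum_(n <- s) m (A n) * f k (t n) -
      riemann_sum mu (f k : T -> R^o) p| <=
      (2 * (e / 8) + 2 * K%:R) * \sum_(n <- s) m (A n) + 2 * (e / 8) / 2 ^+ K + eta.
    have [w [w0 wk wK]] := osc k.
    apply: (le_trans (pk k w w0 _)); first by move=> n t' n0; apply: wk => //; exact: At'.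
    by rewrite lerD// wK.
  have mp := partial_partition_measurable pD.
  split=> [sr K|sr].
    have ps : `|riemann_sum mu G p| <= eta by apply: rs => //; lra.
    have := @Gx 0 [seq (m (A n), t n) | n <- s].
    rewrite scale0r add0r big_map /=; apply => k.
    rewrite mul0r add0r big_map /=.
    have h1 := est1 k K.
    have h2 : `|riemann_sum mu (f k : T -> R^o) p| <= eta.
      by rewrite -riemann_coord (le_trans (le_linfty_norm _ _) ps).
    have lin (x1 x2 b : R) : `|x1 - x2| <= b + eta -> `|x2| <= eta -> `|x1| <= b + 2 * eta.
      by rewrite !ler_norml => /andP[? ?] /andP[? ?]; apply/andP; split; lra.
    exact: lin h1 h2.
  have pz : `|z - riemann_sum mu G p| <= eta.
    by apply: rb => //; rewrite prob_setC//; lra.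
  have := @Gx 1 [seq (- m (A n), t n) | n <- s].
  rewrite scale1r big_map /=; under eq_bigr do rewrite scaleNr.
  rewrite sumrN; apply => k.
  rewrite mul1r big_map /=; under eq_bigr do rewrite mulNr.
  rewrite sumrN.
  have h1 := est1 k 0%N.
  have h2 : `|z (x k) - riemann_sum mu (f k : T -> R^o) p| <= eta.
    by rewrite -riemann_coord; apply: le_trans pz; exact: (le_linfty_norm (z - riemann_sum mu G p)).
  have s1 : \sum_(n <- s) m (A n) <= 1.
    by rewrite -(prob_setT mu); apply: sum_prob_le.
  have h3 : (2 * (e / 8) + 2 * 0%:R) * \sum_(n <- s) m (A n) + 2 * (e / 8) / 2 ^+ 0 <= 4 * (e / 8).
    rewrite mulr0 addr0 expr0 divr1.
    have : 2 * (e / 8) * \sum_(n <- s) m (A n) <= 2 * (e / 8) by rewrite ler_piMr//; lra.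
    lra.
  have lin (x1 x2 x3 b : R) : `|x1 - x2| <= b + eta -> `|x3 - x2| <= eta -> b <= 4 * (e / 8) ->
      `|x3 - x1| <= 4 * (e / 8) + 2 * eta.
    by rewrite !ler_norml => /andP[? ?] /andP[? ?] ?; apply/andP; split; lra.
  exact: lin h1 h2 h3.
have summ : summable_wrt mu G A.
  split=> // t At s sb; apply/cvg_seriesP => e' e'0.
  have e'8 : 0 < e' / 8 by rewrite divr_gt0.
  have [r r0 rP] := est t _ At e'8.
  pose K := Num.truncn (2 * (e / 8) / (e' / 4)).
  have KP : 2 * (e / 8) / 2 ^+ K.+1 <= e' / 4.
    rewrite ler_pdivrMr ?exprn_gt0// [leRHS]mulrC -ler_pdivrMr ?divr_gt0//.
    apply: (@le_trans _ _ K.+1%:R); first exact/ltW/truncnS_gt.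
    by rewrite -natrX ler_nat ltnW// ltn_expl.
  pose b := 2 * (e / 8) + 2 * K.+1%:R.
  have b0 : 0 < b by rewrite addr_gt0// mulr_gt0.
  pose delta := Num.min r (e' / 4 / b).
  have delta0 : 0 < delta by rewrite lt_min r0 !divr_gt0.
  have [N NP] := prob_bigcup_finite mu (fun i => mA (s i)) delta0.
  exists N => k n /andP[Nk kn].
  pose l := [seq s i | i <- index_iota k n].
  have ul : uniq l by rewrite map_inj_uniq ?iota_uniq//; exact: bij_inj.
  have lr : \sum_(j <- l) m (A j) <= delta.
    apply: le_trans (NP N (leqnn N)); apply: sum_prob_le => //.
      apply: measurableD; first by apply: bigcup_measurable.
      by apply: bigsetU_measurable.
    move=> _ /mapP[i + ->] _; rewrite mem_index_iota => /andP[ki _] y Ay.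
    split; first by exists i.
    rewrite -(bigcup_mkord N (fun i => A (s i))) => -[j /= jN Aj].
    have sij : s i != s j.
      rewrite (inj_eq (bij_inj sb)); apply: contraTneq jN => <-.
      by rewrite -leqNgt (leq_trans Nk).
    by move/trivIsetP : tA => /(_ _ _ I I sij)/seteqP[/(_ y) h _]; exact: h.
  have lr' : \sum_(j <- l) m (A j) <= r by rewrite (le_trans lr)// /delta ge_min lexx.
  have [/(_ lr' K.+1) + _] := rP l ul; rewrite big_map.
  move=> /le_trans; apply.
  have : b * \sum_(j <- l) m (A j) <= e' / 4.
    rewrite mulrC -ler_pdivlMr//; apply: le_trans lr _.
    by rewrite /delta ge_min lexx orbT.
  rewrite -/b; move: (b * _) (2 * (e / 8) / 2 ^+ K.+1) KP => q1 q2; lra.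
exists A => // _ [t At <-].
have cs : cvgn (series (birkhoff_term mu G A t)).
  by apply: (summ.2 t At id); exists id.
have [r r0 rP] := est t _ At e8.
have [N NP] := prob_bigcup_finite mu mA r0.
have cn : `|series (birkhoff_term mu G A t) n - z| @[n --> \oo] -->
    `|limn (series (birkhoff_term mu G A t)) - z|.
  by apply: cvg_norm; apply: cvgB => //; exact: cvg_cst.
apply: (cvg_le_near cn); exists N => // n /= Nn.
have un : uniq (iota 0 n) by exact: iota_uniq.
have [_ rPn] := rP _ un.
rewrite distrC (_ : series _ n = \sum_(j <- iota 0 n) m (A j) *: G (t j)); last first.
  by rewrite /series /= /index_iota subn0.
apply: le_trans (rPn _) _; last lra.
have mU : measurable (\big[setU/set0]_(i < n) A i) by exact: bigsetU_measurable.
have : m (\big[setU/set0]_(i < n) A i) <= \sum_(j <- iota 0 n) m (A j).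
  have := prob_bigU_le_sum n mA.
  by rewrite -(big_mkord xpredT (fun j => m (A j))) /index_iota subn0.
have := NP n Nn; rewrite (cp_cover Ap) setTD prob_setC//; lra.
Qed.

End birkhoff_of_gauge_limit.

(** * From Birkhoff to McShane *)

Section unconditional.
Variables (R : realType) (V : completeNormedModType R).

Lemma unconditional_tail (u : nat -> V) (e : R) : unconditionally_cvg u -> 0 < e ->
  exists N, forall s : seq nat, uniq s -> (forall n, n \in s -> (N <= n)%N) ->
    `|\sum_(n <- s) u n| <= e.
Proof.
move=> uu e0; apply: contrapT => h.
have [pick pickP] : {pick : nat -> seq nat & forall N, [/\ uniq (pick N),
    forall n, n \in pick N -> (N <= n)%N & e < `|\sum_(n <- pick N) u n|]}.
  apply: (@choice nat (seq nat) (fun N s => [/\ uniq s,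
    forall n, n \in s -> (N <= n)%N & e < `|\sum_(n <- s) u n|])) => N.
  apply: contrapT => h'; apply: h; exists N => s us sN; rewrite leNgt; apply/negP => es.
  by apply: h'; exists s.
pose step N := (maxn N (\max_(n <- pick N) n)).+1.
pose N k := iter k step 0%N.
have N_lt k : (N k < N k.+1)%N by rewrite /= /step ltnS leq_maxl.
pose b k := pick (N k) ++ [seq i <- iota (N k) (N k.+1 - N k) | i \notin pick (N k)].
have b_perm k : perm_eq (b k) (iota (N k) (N k.+1 - N k)).
  apply: uniq_perm.
  - rewrite cat_uniq filter_uniq ?iota_uniq// andbT; case: (pickP (N k)) => -> _ _ /=.
    by apply/hasPn => i; rewrite mem_filter => /andP[].
  - exact: iota_uniq.
  move=> i; rewrite mem_cat mem_filter mem_iota subnKC; last exact: ltnW.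
  case ik : (i \in pick (N k)) => //=; apply/esym/andP; split.
    by case: (pickP (N k)) => _ + _; apply.
  by rewrite /= /step ltnS (leq_trans (leq_bigmax_seq _ ik isT))// leq_maxr.
have b0 k : (0 < size (b k))%N by rewrite (perm_size (b_perm k)) size_iota subn_gt0.
have pre_perm k : perm_eq (prefix_flatten b k) (iota 0 (N k)).
  elim: k => // k IH; rewrite prefix_flattenS.
  rewrite -[N k.+1](subnKC (ltnW (N_lt k))) iotaD add0n.
  exact: perm_cat.
have N_ge k : (k <= N k)%N by elim: k => // k IH; exact: leq_ltn_trans (N_lt k).
pose s := infinite_flatten 0%N b.
have sE k : mkseq s (size (prefix_flatten b k)) = prefix_flatten b k.
  exact: mkseq_infinite_flatten.
have s_inj : injective s.
  move=> i j; pose k := (maxn i j).+1.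
  have ks : (k <= size (prefix_flatten b k))%N by exact: size_prefix_flatten.
  have iL : (i < size (prefix_flatten b k))%N by rewrite (leq_trans _ ks)// ltnS leq_maxl.
  have jL : (j < size (prefix_flatten b k))%N by rewrite (leq_trans _ ks)// ltnS leq_maxr.
  rewrite /s (nth_infinite_flatten 0%N b0 iL) (nth_infinite_flatten 0%N b0 jL) => /eqP.
  rewrite nth_uniq//; first by move=> /eqP.
  by rewrite (perm_uniq (pre_perm k)) iota_uniq.
have s_surj n : exists i, s i = n.
  have : n \in prefix_flatten b n.+1.
    by rewrite (perm_mem (pre_perm n.+1)) mem_iota add0n; exact: (N_ge n.+1).
  by rewrite -sE => /mapP[i _ ->]; exists i.
have s_bij : bijective s.
  have [g gP] := choice s_surj; exists g => // i; exact: s_inj.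
have /cvg_seriesP/(_ e e0)[M MP] := uu s s_bij.
pose a := size (prefix_flatten b M); pose l := size (pick (N M)).
have Ma : (M <= a)%N by exact: size_prefix_flatten.
have := MP a (a + l)%N; rewrite Ma leq_addr => /(_ isT).
have mE : map s (iota a l) = pick (N M).
  have : mkseq s (a + l) = take (a + l) (prefix_flatten b M.+1).
    apply: mkseq_infinite_flatten_take => //.
    by rewrite prefix_flattenS size_cat leq_add2l /b size_cat leq_addr.
  rewrite prefix_flattenS /b catA take_size_cat ?size_cat// /mkseq iotaD map_cat add0n.
  rewrite -/(mkseq s a) sE => /(congr1 (drop a)).
  by rewrite !drop_size_cat.
rewrite /index_iota addKn -[\sum_(i <- iota a l) _](big_map s xpredT u) mE.
by case: (pickP (N M)) => _ _; rewrite ltNge => /negP.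
Qed.

End unconditional.

Section parts.
Context (d : measure_display) (T : measurableType d) (R : realType) (mu : probability T R).
Local Notation m E := (fine (mu E)).

Lemma sum_by_index (V : lmodType R) (I : Type) (p : seq I) (w : I -> R) (idx : I -> nat)
    (h : nat -> V) K : all (fun q => idx q < K)%N p ->
  \sum_(q <- p) w q *: h (idx q) = \sum_(n < K) (\sum_(q <- p | idx q == n) w q) *: h n.
Proof.
elim: p => [|q p IH] /=.
  by rewrite big_nil big1// => n _; rewrite big_nil scale0r.
move=> /andP[qK /IH E]; rewrite big_cons E.
under [RHS]eq_bigr => n _ do rewrite big_cons.
rewrite (bigD1 (Ordinal qK))//= [RHS](bigD1 (Ordinal qK))//= eqxx scalerDl -addrA.
congr (_ + (_ + _)); apply: eq_bigr => n nq.
by rewrite ifN// eq_sym; apply: contraNneq nq => nq; apply/eqP/val_inj.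
Qed.

Lemma sum_parts_le G (p : seq (set T * T)) (P : pred T) (C : T -> set T) (B : set T) :
  partial_partition G p -> (forall t, measurable (C t)) -> measurable B ->
  (forall q, q \in p -> P q.2 -> q.1 `&` C q.2 `<=` B) ->
  \sum_(q <- p | P q.2) m (q.1 `&` C q.2) <= m B.
Proof.
move=> + mC; elim: p B => [|q p IH] B /=; first by rewrite big_nil prob_ge0.
move=> [mq _ qp Gp] mB pB; rewrite big_cons; case: ifPn => [Pq|_]; last first.
  by apply: IH => // c cp; apply: pB; rewrite inE cp orbT.
have mqC : measurable (q.1 `&` C q.2) by exact: measurableI.
rewrite (prob_setID mu mB mqC) (_ : B `&` _ = q.1 `&` C q.2); last first.
  by apply/setIidr; apply: pB; rewrite ?mem_head.
rewrite lerD2l; apply: IH => //; first exact: measurableD.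
move=> c cp Pc x [cx Cx]; split; first by apply: (pB c) => //; rewrite inE cp orbT.
move=> [qx _]; have : (q.1 `&` supp p) x by split=> //; apply/supp_mem; exists c.
by rewrite qp.
Qed.

Lemma sum_parts_eq G (p : seq (set T * T)) (idx : T -> nat) (A : nat -> set T) n :
  partial_partition G p -> (forall n, measurable (A n)) -> trivIset [set: nat] A ->
  (forall q, q \in p -> q.1 `<=` A (idx q.2)) ->
  \sum_(q <- p | idx q.2 == n) m q.1 = m (supp p `&` A n).
Proof.
move=> + mA tA; elim: p => [|q p IH] /=.
  by rewrite big_nil supp_nil set0I prob_set0.
move=> [mq _ qp Gp] pA.
have E : \sum_(q <- p | idx q.2 == n) m q.1 = m (supp p `&` A n).
  by apply: IH => // c cp; apply: pA; rewrite inE cp orbT.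
have mp := partial_partition_measurable Gp.
have qA : q.1 `<=` A (idx q.2) by apply: pA; rewrite mem_head.
rewrite big_cons E supp_cons setIUl prob_setU; last 3 first.
- exact: measurableI.
- exact: measurableI.
- by rewrite setIACA qp set0I.
case: eqVneq => [<-|qn].
  by congr (m _ + _); apply/esym/setIidl.
rewrite (_ : q.1 `&` A n = set0) ?prob_set0 ?add0r// -subset0 => x [/qA qx nx].
by move/trivIsetP : tA => /(_ _ _ I I qn)/seteqP[/(_ x) h _]; exact: h.
Qed.

Lemma maximizing_choice (p : seq (set T * T)) (idx : T -> nat) (A : nat -> set T)
    (t0 : nat -> T) (g : T -> R) : partition_choice A t0 -> (forall t, A (idx t) t) ->
  exists t', [/\ partition_choice A t', forall n, g (t0 n) <= g (t' n),
    forall q, q \in p -> g q.2 <= g (t' (idx q.2)) &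
    forall n, (forall q, q \in p -> idx q.2 != n) -> t' n = t0 n].
Proof.
move=> At0 Ai; elim: p => [|q p [t' [At' t0t' pt' t'0]]]; first by exists t0; split.
have [qt'|t'q] := leP (g q.2) (g (t' (idx q.2))).
  exists t'; split=> // [c|n pn]; first by rewrite inE => /orP[/eqP->|/pt'].
  by apply: t'0 => c cp; apply: pn; rewrite inE cp orbT.
exists (fun n => if n == idx q.2 then q.2 else t' n); split.
- by move=> n An; case: eqVneq => [->|_]; [exact: Ai|exact: At'].
- by move=> n; case: eqVneq => // ->; rewrite ltW// (le_lt_trans _ t'q).
- move=> c; rewrite inE => /orP[/eqP->|cp]; first by rewrite eqxx.
  by case: eqVneq => [cq|_]; [rewrite ltW// (le_lt_trans _ t'q)// -cq|]; exact: pt'.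
- move=> n pn; rewrite ifN; last by rewrite eq_sym; apply: pn; rewrite mem_head.
  by apply: t'0 => c cp; apply: pn; rewrite inE cp orbT.
Qed.

End parts.

Lemma partition_choice_exists (d : measure_display) (T : measurableType d) (A : nat -> set T) :
  exists t, partition_choice A t.
Proof.
suff [t tP] : {t : nat -> T & forall n, A n !=set0 -> A n (t n)} by exists t.
apply: (@choice nat T (fun n t => A n !=set0 -> A n t)) => n.
by have [[t At]|nA] := pselect (A n !=set0); [exists t|exists point].
Qed.

Section birkhoff_approx.
Context (d : measure_display) (T : measurableType d) (R : realType) (mu : probability T R)
  (S : Type).
Local Notation m E := (fine (mu E)).
Variables (G : T -> linfty R S) (A : nat -> set T) (t0 : nat -> T) (idx : T -> nat) (e : R).
Hypotheses (GA : summable_wrt mu G A) (At0 : partition_choice A t0)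
  (Ai : forall t, A (idx t) t) (e0 : 0 < e)
  (Ae : forall x y, birkhoff_sums mu G A x -> birkhoff_sums mu G A y -> `|x - y| <= e).

Let mA : forall n, measurable (A n).
Proof. by case: GA => -[]. Qed.

Let tA : trivIset [set: nat] A.
Proof. by case: GA => -[]. Qed.

Lemma birkhoff_sum_cvg t : partition_choice A t -> cvgn (series (birkhoff_term mu G A t)).
Proof. by move=> At; apply: (GA.2 t At id); exists id. Qed.

Lemma birkhoff_sum_finite_change t t' K : partition_choice A t -> partition_choice A t' ->
  (forall n, (K <= n)%N -> t' n = t n) ->
  limn (series (birkhoff_term mu G A t')) - limn (series (birkhoff_term mu G A t)) =
  \sum_(n < K) m (A n) *: (G (t' n) - G (t n)).
Proof.
move=> At At' tt'; apply: (@cvg_unique _ (@norm_hausdorff _ _)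
  (series (birkhoff_term mu G A t') n - series (birkhoff_term mu G A t) n @[n --> \oo])).
  by apply: cvgB; exact: birkhoff_sum_cvg.
apply: cvg_near_cst; exists K => // n /= Kn.
rewrite /series /= -sumrB (big_cat_nat (n := K))//= big_mkord.
rewrite [X in _ + X]big_nat_cond [X in _ + X]big1 ?addr0; last first.
  by move=> i /andP[/andP[Ki _] _]; rewrite /birkhoff_term tt'// subrr.
by apply: eq_bigr => i _; rewrite scalerBr.
Qed.

(* Coordinatewise, replacing each tag by the best one of its piece can only
   increase the sum, so the deviation is at most the difference of two Birkhoff
   sums. The sign [b] gives both inequalities. *)
Lemma tags_deviation (p : seq (set T * T)) F K (b : R) s : partial_partition F p ->
  (forall q, q \in p -> q.1 `<=` A (idx q.2)) -> all (fun q => idx q.2 < K)%N p ->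
  `|b| = 1 ->
  b * ((riemann_sum mu G p - \sum_(n < K) m (supp p `&` A n) *: G (t0 n) : linfty R S) s) <= e.
Proof.
move=> Fp pA pK b1.
have [t' [At' t0t' pt' t'0]] := maximizing_choice p (fun t => b * G t s) At0 Ai.
have t'K n : (K <= n)%N -> t' n = t0 n.
  move=> Kn; apply: t'0 => q qp; have /allP/(_ q qp) := pK.
  by move=> h; rewrite ltn_eqF// (leq_trans h).
have W : \sum_(n < K) m (supp p `&` A n) *: G (t0 n) =
    \sum_(q <- p) m q.1 *: G (t0 (idx q.2)).
  rewrite (@sum_by_index _ _ _ p (fun q => m q.1) (fun q => idx q.2) (fun n => G (t0 n)) K pK).
  by apply: eq_bigr => n _; rewrite (sum_parts_eq mu n Fp mA tA pA).
have -> : (riemann_sum mu G p - \sum_(n < K) m (supp p `&` A n) *: G (t0 n) : linfty R S) s =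
    \sum_(q <- p) m q.1 * (G q.2 s - G (t0 (idx q.2)) s).
  rewrite W /riemann_sum -sumrB linfty_sum; apply: eq_bigr => q _.
  by rewrite -scalerBr.
rewrite mulr_sumr.
apply: (@le_trans _ _
  (\sum_(q <- p) m q.1 *: (b * G (t' (idx q.2)) s - b * G (t0 (idx q.2)) s : R^o))).
  rewrite big_seq [leRHS]big_seq; apply: ler_sum => q qp.
  by rewrite mulrCA ler_wpM2l ?prob_ge0// mulrBr lerD2r pt'.
rewrite (@sum_by_index _ _ _ p (fun q => m q.1) (fun q => idx q.2)
  (fun n => b * G (t' n) s - b * G (t0 n) s : R^o) K pK).
apply: (@le_trans _ _ (\sum_(n < K) m (A n) * (b * G (t' n) s - b * G (t0 n) s))).
  apply: ler_sum => n _; rewrite (sum_parts_eq mu n Fp mA tA pA).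
  rewrite ler_wpM2r ?subr_ge0 ?t0t'//; apply: prob_mono => //.
  by apply: measurableI => //; exact: partial_partition_measurable Fp.
have -> : \sum_(n < K) m (A n) * (b * G (t' n) s - b * G (t0 n) s) =
    b * (\sum_(n < K) m (A n) *: (G (t' n) - G (t0 n)) : linfty R S) s.
  by rewrite linfty_sum mulr_sumr; apply: eq_bigr => n _; rewrite -mulrBr mulrCA.
rewrite -(birkhoff_sum_finite_change At0 At' t'K).
apply: (le_trans (ler_norm _)); rewrite normrM b1 mul1r.
apply: le_trans (le_linfty_norm _ _) _; apply: Ae; first by exists t'.
by exists t0.
Qed.

Lemma birkhoff_approx (eta : R) : 0 < eta -> exists N (delta : R), 0 < delta /\
  forall F p, partial_partition F p -> (forall q, q \in p -> q.1 `<=` A (idx q.2)) ->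
    (forall n, (n < N)%N -> m (A n) - delta <= m (supp p `&` A n)) ->
    `|riemann_sum mu G p - limn (series (birkhoff_term mu G A t0))| <= e + eta.
Proof.
move=> eta0; have eta3 : 0 < eta / 3 by rewrite divr_gt0.
set u := birkhoff_term mu G A t0; set z0 := limn _.
have [N NP] := unconditional_tail (GA.2 t0 At0) eta3.
pose M := \sum_(n < N) `|G (t0 n)| + 1.
have M0 : 0 < M by rewrite ltr_wpDl// sumr_ge0.
exists N, (eta / 3 / M); split; first by rewrite divr_gt0.
move=> F p Fp pA pN.
have cu : series u @ \oo --> z0 by exact: birkhoff_sum_cvg.
have [L _ LP] : \forall n \near \oo, `|z0 - series u n| <= eta / 3.
  by move/cvgrPdist_le : cu => /(_ _ eta3).
pose K := (maxn (maxn N L) (\max_(q <- p) (idx q.2).+1))%N.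
have pK : all (fun q => idx q.2 < K)%N p.
  apply/allP => q qp; rewrite /K (leq_trans _ (leq_maxr _ _))//.
  exact: (leq_bigmax_seq (F := fun q : set T * T => (idx q.2).+1) q qp isT).
have NK : (N <= K)%N by rewrite /K !leq_max leqnn.
have LK : (L <= K)%N by rewrite /K !leq_max leqnn orbT.
have mp := partial_partition_measurable Fp.
pose a n := m (supp p `&` A n).
have aA n : a n <= m (A n) by apply: prob_mono => //; exact: measurableI.
have a0 n : 0 <= a n by exact: prob_ge0.
pose w n := m (A n) - a n.
have w0 n : 0 <= w n by rewrite subr_ge0.
have wA n : w n <= m (A n) by rewrite gerBl.
have head s : `|\sum_(n < N) w n * G (t0 n) s| <= eta / 3.
  apply: (@le_trans _ _ (\sum_(n < N) (eta / 3 / M) * `|G (t0 n)|)).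
    rewrite (le_trans (ler_norm_sum _ _ _))//; apply: ler_sum => n _.
    rewrite normrM ger0_norm// ler_pM// ?le_linfty_norm//.
    by have := pN n (ltn_ord n); rewrite /w /a; lra.
  rewrite -mulr_sumr mulrAC ler_pdivrMr// ler_pM2l// /M lerDl; exact: ler01.
have tail1 s b : `|b| = 1 -> b * \sum_(N <= n < K) w n * G (t0 n) s <= eta / 3.
  move=> b1; rewrite mulr_sumr.
  pose l := [seq n <- index_iota N K | 0 <= b * G (t0 n) s].
  apply: (@le_trans _ _ (\sum_(n <- l) b * (m (A n) * G (t0 n) s))).
    rewrite big_filter big_mkcond [leRHS]big_mkcond /=; apply: ler_sum => n _.
    case: ifPn => [h|]; first by rewrite mulrCA [leRHS]mulrCA ler_wpM2r.
    by rewrite -ltNge => /ltW h; rewrite mulrCA mulr_ge0_le0.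
  have -> : \sum_(n <- l) b * (m (A n) * G (t0 n) s) = b * (\sum_(n <- l) u n : linfty R S) s.
    by rewrite linfty_sum mulr_sumr.
  apply: (le_trans (ler_norm _)); rewrite normrM b1 mul1r.
  apply: le_trans (le_linfty_norm _ _) (NP _ _ _).
    by rewrite filter_uniq// iota_uniq.
  by move=> n; rewrite mem_filter mem_index_iota => /andP[_ /andP[]].
have tail s : `|\sum_(N <= n < K) w n * G (t0 n) s| <= eta / 3.
  have := tail1 s 1 (normr1 _); have := tail1 s (-1) (normrN1 _).
  by rewrite mul1r mulN1r ler_norml => ? ?; apply/andP; split; lra.
have dev s : `|(riemann_sum mu G p - \sum_(n < K) a n *: G (t0 n) : linfty R S) s| <= e.
  have := tags_deviation s Fp pA pK (normr1 _).
  have := tags_deviation s Fp pA pK (normrN1 _).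
  by rewrite mul1r mulN1r ler_norml => ? ?; apply/andP; split; lra.
apply: linfty_norm_le => [|s]; first by rewrite addr_ge0// ltW.
have zK : `|(z0 - series u K : linfty R S) s| <= eta / 3.
  by apply: le_trans (le_linfty_norm _ _) _; exact: LP.
have split_sum : (series u K) s = \sum_(n < K) a n * G (t0 n) s +
    (\sum_(n < N) w n * G (t0 n) s + \sum_(N <= n < K) w n * G (t0 n) s).
  rewrite -(big_mkord xpredT (fun n => w n * G (t0 n) s)) -big_cat_nat//= big_mkord -big_split /=.
  rewrite /series /= linfty_sum big_mkord; apply: eq_bigr => n _.
  by rewrite -mulrDl /w addrC subrK.
have := dev s; have := head s; have := tail s; move: zK.
have -> : (riemann_sum mu G p - \sum_(n < K) a n *: G (t0 n) : linfty R S) s =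
    (riemann_sum mu G p : linfty R S) s - \sum_(n < K) a n * G (t0 n) s.
  by rewrite -(linfty_sum (index_enum 'I_K) xpredT (fun n => a n *: G (t0 n))).
have -> : (z0 - series u K : linfty R S) s = z0 s - (\sum_(n < K) a n * G (t0 n) s +
    (\sum_(n < N) w n * G (t0 n) s + \sum_(N <= n < K) w n * G (t0 n) s)).
  by rewrite -split_sum.
have -> : (riemann_sum mu G p - z0 : linfty R S) s = (riemann_sum mu G p : linfty R S) s - z0 s.
  by [].
have lin (x1 x2 x3 x4 x5 : R) : `|x1 - (x2 + (x3 + x4))| <= eta / 3 -> `|x4| <= eta / 3 ->
    `|x3| <= eta / 3 -> `|x5 - x2| <= e -> `|x5 - x1| <= e + eta.
  by rewrite !ler_norml => /andP[? ?] /andP[? ?] /andP[? ?] /andP[? ?]; apply/andP; split; lra.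
exact: lin.
Qed.

End birkhoff_approx.

Section birkhoff_gauge_limit.
Context (d : measure_display) (T : topMeasurableType d) (R : realType) (mu : probability T R)
  (S : Type).
Local Notation m E := (fine (mu E)).
Local Notation fine_in Delta := (partial_partition (fun E t => E `<=` Delta t)).
Hypotheses (qr : quasi_radon mu) (outer : outer_regular mu).

Lemma outer_open (B : set T) (e : R) : measurable B -> 0 < e -> exists W : set T,
  [/\ open W, B `<=` W & m (W `\` B) <= e].
Proof.
move=> mB e0; have : (mu B < (m B + e)%:E)%E by rewrite probE// lte_fin ltrDl.
rewrite {1}outer// => /ereal_inf_lt[_ [W [oW BW] <-]] We.
have mW := qr_open_measurable qr oW.
have {}We : m W < m B + e by rewrite -lte_fin -(probE mu mW).
exists W; split=> //; move: We.
have := prob_setID mu mW mB; rewrite (_ : W `&` B = B); last exact/setIidr.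
lra.
Qed.

Definition trim (idx : T -> nat) (A : nat -> set T) (p : seq (set T * T)) :=
  [seq (q.1 `&` A (idx q.2), q.2) | q <- p].

Lemma partial_partition_trim idx A F p : (forall n, measurable (A n)) ->
  partial_partition F p -> partial_partition (fun _ _ => True) (trim idx A p) /\
  supp (trim idx A p) `<=` supp p.
Proof.
move=> mA; elim: p => [_|q p IH /= [mq _ qp /IH[h1 h2]]]; first by split.
rewrite !supp_cons /=; split; last by move=> x [[qx _]|/h2]; [left|right].
split=> //; first exact: measurableI.
by rewrite -subset0 -qp => x [[qx _] /h2].
Qed.

Lemma birkhoff_near_gauge_limit (G : T -> linfty R S) (e : R) : birkhoff_integrable mu G ->
  0 < e -> exists z Delta (r : R), [/\ gauge Delta, 0 < r &
    forall p, fine_in Delta p -> m (~` supp p) <= r -> `|riemann_sum mu G p - z| <= e].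
Proof.
move=> Gb e0; have e3 : 0 < e / 3 by rewrite divr_gt0.
have [A GA Ae] := Gb _ e3.
have [[mA tA cA] _] := GA.
have [idx Ai] : {idx : T -> nat & forall t, A (idx t) t}.
  apply: (@choice T nat (fun t n => A n t)) => t.
  have [n _ Ant] : (\bigcup_n A n) t by rewrite cA.
  by exists n.
have [t0 At0] := partition_choice_exists A.
have [N [delta [delta0 NP]]] := birkhoff_approx GA At0 Ai e3 Ae e3.
pose c := Num.min (e / 3 / 2) (delta / 2 / 2).
have c0 : 0 < c by rewrite lt_min !divr_gt0.
pose dec i := odflt (0, 0)%N (@unpickle (nat * nat)%type i).
have [W WP] : {W : nat -> set T & forall i, [/\ open (W i), A (dec i).1 `<=` W i &
    m (W i `\` A (dec i).1) <= c / 2 ^+ i / (dec i).2.+1%:R]}.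
  apply: (@choice nat (set T) (fun i W => [/\ open W, A (dec i).1 `<=` W &
    m (W `\` A (dec i).1) <= c / 2 ^+ i / (dec i).2.+1%:R])) => i.
  by apply: outer_open => //; rewrite !divr_gt0// exprn_gt0.
pose k t := Num.truncn `|G t|.
pose code t := pickle (idx t, k t).
have codeK t : dec (code t) = (idx t, k t) by rewrite /dec pickleK.
exists (limn (series (birkhoff_term mu G A t0))), (fun t => W (code t)), (delta / 2).
split; last 2 first.
- by rewrite divr_gt0.
- move=> p pD pr.
  have mp := partial_partition_measurable pD.
  have [p'P p'p] := partial_partition_trim idx mA pD.
  have mp' := partial_partition_measurable p'P.
  have mW i : measurable (W i) by apply: (qr_open_measurable qr); case: (WP i).
  pose out := \sum_(q <- p) m (q.1 `&` ~` A (idx q.2)) * (k q.2).+1%:R.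
  have out_le : out <= 2 * c.
    pose K := (\max_(q <- p) (code q.2).+1)%N.
    have pK : all (fun q => code q.2 < K)%N p.
      apply/allP => q qp.
      exact: (leq_bigmax_seq (F := fun q : set T * T => (code q.2).+1) q qp isT).
    have -> : out = \sum_(q <- p) m (q.1 `&` ~` A (idx q.2)) *: ((dec (code q.2)).2.+1%:R : R^o).
      by apply: eq_bigr => q _; rewrite codeK.
    rewrite (@sum_by_index _ _ _ p (fun q => m (q.1 `&` ~` A (idx q.2))) (fun q => code q.2)
      (fun i => (dec i).2.+1%:R : R^o) K pK).
    apply: (@le_trans _ _ (\sum_(i < K) c / 2 ^+ i)).
      apply: ler_sum => i _; rewrite -[leLHS]/(_ * _) -ler_pdivlMr ?ltr0Sn//.
      case: (WP i) => _ _; apply: le_trans.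
      apply: (@sum_parts_le _ _ _ _ _ p (fun t => code t == i) (fun t => ~` A (idx t)) _ pD).
      - by move=> t; exact: measurableC.
      - exact: measurableD.
      - move=> q qp /eqP qi x [qx nx]; have [_ h] := partial_partition_mem pD qp.
        by rewrite -qi codeK; split=> //; exact: h.
    suff -> : \sum_(i < K) c / 2 ^+ i = 2 * c - 2 * c / 2 ^+ K.
      by rewrite gerBl divr_ge0 ?mulr_ge0 ?exprn_ge0// ltW.
    elim: (K) => [|j IH]; first by rewrite big_ord0 expr0 divr1 subrr.
    by rewrite big_ord_recr /= IH exprS; field; rewrite expf_neq0.
  have c1 : 2 * c <= e / 3.
    have : c <= e / 3 / 2 by rewrite /c ge_min lexx.
    lra.
  have c2 : 2 * c <= delta / 2.
    have : c <= delta / 2 / 2 by rewrite /c ge_min lexx orbT.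
    lra.
  have diff : `|riemann_sum mu G p - riemann_sum mu G (trim idx A p)| <= e / 3.
    apply: le_trans c1; apply: le_trans out_le.
    rewrite /riemann_sum big_map -sumrB (le_trans (ler_norm_sum _ _ _))//.
    rewrite big_seq [leRHS]big_seq; apply: ler_sum => q qp /=.
    have [mq _] := partial_partition_mem pD qp.
    rewrite -scalerBl (prob_setID mu mq (mA (idx q.2))) addrAC subrr add0r setDE.
    rewrite normrZ ger0_norm ?prob_ge0// ler_wpM2l ?prob_ge0//.
    exact/ltW/truncnS_gt.
  have near : `|riemann_sum mu G (trim idx A p) - limn (series (birkhoff_term mu G A t0))| <=
      e / 3 + e / 3.
    apply: NP p'P _ _ => [_ /mapP[q _ ->] /= x [] //|n nN].
    pose O := \big[setU/set0]_(q <- p) (q.1 `&` ~` A (idx q.2)).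
    have [mO Ole] : measurable O /\ m O <= out.
      rewrite /O /out; elim: (p) pD => [|q p1 IH] /=.
        by rewrite !big_nil prob_set0.
      move=> [mq _ _ /IH[mO1 O1le]]; rewrite !big_cons.
      have mqA : measurable (q.1 `&` ~` A (idx q.2)).
        by apply: measurableI => //; exact: measurableC.
      split; first exact: measurableU.
      rewrite (le_trans (prob_setU_le _ _ _))// lerD// ler_peMr ?prob_ge0//.
      by rewrite ler1n.
    have : m (A n) <= m (supp (trim idx A p) `&` A n) + (m (~` supp p) + m O).
      apply: (@le_trans _ _ (m ((supp (trim idx A p) `&` A n) `|` (~` supp p `|` O)))).
        apply: prob_mono => //.
          apply: measurableU; first exact: measurableI.
          by apply: measurableU => //; exact: measurableC.
        move=> x nx; have [/supp_mem[q qp qx]|npx] := pselect (supp p x); last by right; left.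
        have [Ax|nAx] := pselect (A (idx q.2) x).
          left; split=> //; apply/supp_mem; exists (q.1 `&` A (idx q.2), q.2) => //.
          by apply/mapP; exists q.
        right; right; rewrite /O; elim: (p) qp => [|q1 p1 IH] //.
        rewrite inE big_cons => /orP[/eqP<-|/IH]; first by left.
        by right.
      rewrite (le_trans (prob_setU_le _ _ _))//; first exact: measurableI.
        by apply: measurableU => //; exact: measurableC.
      by rewrite lerD2l prob_setU_le//; exact: measurableC.
    lra.
  rewrite -[X in `|X|](subrKA (riemann_sum mu G (trim idx A p))).
  rewrite (le_trans (ler_normD _ _))// (le_trans (lerD diff near))//; lra.
- move=> t; case: (WP (code t)) => oW AW _; split=> //.
  by apply: AW; rewrite codeK; exact: Ai.
Qed.

Lemma birkhoff_gauge_limit (G : T -> linfty R S) : birkhoff_integrable mu G ->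
  exists z, gauge_limit mu G z.
Proof.
move=> Gb; pose e (n : nat) : R := n.+1%:R^-1.
have e_gt0 n : 0 < e n by rewrite invr_gt0.
have [z zP] : {z : nat -> linfty R S & forall n, exists Delta (r : R), [/\ gauge Delta, 0 < r &
    forall p, fine_in Delta p -> m (~` supp p) <= r -> `|riemann_sum mu G p - z n| <= e n]}.
  apply: (@choice nat (linfty R S) (fun n z => exists Delta (r : R), [/\ gauge Delta, 0 < r &
    forall p, fine_in Delta p -> m (~` supp p) <= r -> `|riemann_sum mu G p - z| <= e n])) => n.
  exact: birkhoff_near_gauge_limit.
have [|l lP] := @cauchy_rate_cvg _ (linfty R S) z e (@cvg_harmonic R).
  move=> i j; have [D1 [r1 [g1 r10 P1]]] := zP i; have [D2 [r2 [g2 r20 P2]]] := zP j.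
  pose D t := D1 t `&` D2 t.
  have gD : gauge D.
    move=> t; have [? ?] := g1 t; have [? ?] := g2 t.
    by split; [exact: openI|split].
  have r0 : 0 < Num.min r1 r2 by rewrite lt_min r10.
  have [p pD pr] := gauge_almost_cover qr gD r0.
  have h1 : `|riemann_sum mu G p - z i| <= e i.
    apply: P1; last by rewrite (le_trans pr)// ge_min lexx.
    by apply: partial_partition_sub pD => E t ED x /ED[].
  have h2 : `|riemann_sum mu G p - z j| <= e j.
    apply: P2; last by rewrite (le_trans pr)// ge_min lexx orbT.
    by apply: partial_partition_sub pD => E t ED x /ED[].
  rewrite -(subrKA (riemann_sum mu G p)) (le_trans (ler_normD _ _))// lerD//.
  by rewrite distrC.
exists l => r r0; have r2 : 0 < r / 2 by rewrite divr_gt0.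
have [n _ en] : \forall n \near \oo, `|e n| < r / 2.
  by have /cvgr0Pnorm_lt := @cvg_harmonic R; apply.
have {}en : e n <= r / 2 by rewrite ltW// (le_lt_trans (ler_norm _))// en/=.
have [D [r' [gD r'0 DP]]] := zP n; exists D, r'; split=> // p pD pr.
rewrite distrC -(subrKA (z n)) (le_trans (ler_normD _ _))// [leRHS]splitr lerD//.
  exact: le_trans (DP p pD pr) en.
exact: le_trans (lP n) en.
Qed.

End birkhoff_gauge_limit.

(** * The two integrals coincide *)

Section convex.
Context (R : realType) (Z : completeNormedModType R).

Lemma convex_set_sum (I : eqType) (p : seq I) (D : set Z) (W : R) (w : I -> R)
    (x : I -> Z) (x0 : Z) :
  convex_set D -> (forall i, i \in p -> 0 <= w i) -> \sum_(i <- p) w i <= W ->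
  (forall i, i \in p -> D (W *: x i)) -> D (W *: x0) ->
  D (\sum_(i <- p) w i *: x i + (W - \sum_(i <- p) w i) *: x0).
Proof.
move=> /convex_setP cD; elim: p x0 => [|i p IH] x0 w0 wW Dx Dx0.
  by rewrite !big_nil add0r subr0.
rewrite !big_cons; move: wW; rewrite big_cons; set s := \sum_(j <- p) w j => wW.
have wi : 0 <= w i by apply: w0; exact: mem_head.
have wp j : j \in p -> 0 <= w j by move=> jp; apply: w0; rewrite inE jp orbT.
have Dp j : j \in p -> D (W *: x j) by move=> jp; apply: Dx; rewrite inE jp orbT.
have : 0 <= W - s by lra.
rewrite le_eqVlt => /predU1P[b0|b0].
  have -> : w i = 0 by lra.
  rewrite scale0r !add0r.
  by apply: IH => //; rewrite -/s; lra.
pose a := w i / (W - s).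
have a01 : 0 <= a <= 1.
  by rewrite divr_ge0 ?ler_pdivrMr ?mul1r//=; [lra|exact: ltW].
have Dx' : D (W *: (a *: x i + (1 - a) *: x0)).
  have WC b y : W *: (b *: y) = b *: (W *: y) :> Z by rewrite !scalerA mulrC.
  by rewrite scalerDr !WC; apply: cD => //; apply: Dx; exact: mem_head.
have := IH _ wp _ Dp Dx'; rewrite -/s => /(_ ltac:(lra)).
rewrite scalerDr !scalerA.
have -> : (W - s) * a = w i by rewrite /a mulrCA divff ?mulr1// gt_eqF.
have -> : (W - s) * (1 - a) = W - (w i + s).
  by rewrite mulrBr mulr1 /a mulrCA divff ?gt_eqF// mulr1; ring.
by rewrite addrCA addrA.
Qed.

Lemma convex_set_translate (D : set Z) (b : Z) : convex_set D ->
  convex_set [set w | D (b + w)].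
Proof.
move=> /convex_setP cD; apply/convex_setP => x y a Dx Dy a01 /=.
rewrite (_ : b + _ = a *: (b + x) + (1 - a) *: (b + y)); first exact: cD.
rewrite !scalerDr addrACA -scalerDl.
by rewrite (_ : a + (1 - a) = 1) ?scale1r//; ring.
Qed.

Lemma convex_ball (b : Z) (e : R) : convex_set [set w | `|w - b| <= e].
Proof.
apply/convex_setP => x y a /= xb yb /andP[a0 a1].
rewrite (_ : _ - b = a *: (x - b) + (1 - a) *: (y - b)).
  rewrite (le_trans (ler_normD _ _))// !normrZ !ger0_norm ?subr_ge0//.
  have -> : e = a * e + (1 - a) * e by ring.
  by rewrite lerD// ler_wpM2l// subr_ge0.
rewrite !scalerBr addrACA -opprD -scalerDl.
by rewrite (_ : a + (1 - a) = 1) ?scale1r//; ring.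
Qed.

Lemma closure_norm (A : set Z) (z : Z) :
  closure A z <-> forall e : R, 0 < e -> exists2 y, A y & `|y - z| <= e.
Proof.
split=> [Az e e0|Az B /nbhs_ballP[e /= e0 eB]].
  have [y [Ay]] := Az _ (nbhsx_ballx z e e0).
  by rewrite -ball_normE /= => /ltW; exists y => //; rewrite distrC.
have e2 : 0 < e / 2 by rewrite divr_gt0.
have [y Ay yz] := Az _ e2; exists y; split=> //; apply: eB.
rewrite -ball_normE /= distrC (le_lt_trans yz)//.
by rewrite ltr_pdivrMr// ltr_pMr// ltr1n.
Qed.

Lemma closed_convex_hull_ball (A : set Z) (b y : Z) (e : R) :
  (forall x, A x -> `|x - b| <= e) -> closed_convex_hull A y -> `|y - b| <= e.
Proof.
move=> Ae /closure_norm Hy; apply/ler_addgt0Pr => r r0.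
have [w wA wy] := Hy _ r0.
have wb : `|w - b| <= e.
  by apply: (wA [set w | `|w - b| <= e]); split; [exact: convex_ball|exact: Ae].
rewrite -(subrKA w) (le_trans (ler_normD _ _))// addrC lerD// distrC.
exact: wy.
Qed.

End convex.

Section hull.
Context (d : measure_display) (T : topMeasurableType d) (R : realType) (mu : probability T R)
  (S : Type).
Local Notation m E := (fine (mu E)).
Local Notation fine_in Delta := (partial_partition (fun E t => E `<=` Delta t)).
Local Notation Z := (linfty R S).
Variables (G : T -> Z) (A : nat -> set T).
Hypotheses (qr : quasi_radon mu) (GA : summable_wrt mu G A).
Let mA : forall n, measurable (A n).
Proof. by case: GA => -[]. Qed.
Let tA : trivIset [set: nat] A.
Proof. by case: GA => -[]. Qed.
Let cA : \bigcup_n A n = [set: T].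
Proof. by case: GA => -[]. Qed.

Definition in_term_hull (n : nat) (v : Z) := forall D : set Z, convex_set D ->
  (forall t, partition_choice A t -> D (birkhoff_term mu G A t n)) -> D v.

Lemma convex_birkhoff_sums (C : set Z) v : convex_set C -> birkhoff_sums mu G A `<=` C ->
  (forall n, in_term_hull n (v n)) -> forall k t, partition_choice A t ->
  C (limn (series (birkhoff_term mu G A t)) + \sum_(n < k) (v n - birkhoff_term mu G A t n)).
Proof.
move=> cC JC vH; elim=> [|k IH] t At.
  by rewrite big_ord0 addr0; apply: JC; exists t.
rewrite big_ord_recr /= addrA addrA addrAC.
set b := _ - _.
suff : forall t', partition_choice A t' -> [set w | C (b + w)] (birkhoff_term mu G A t' k).
  by have := vH k _ (convex_set_translate cC (b:=b)); exact.
move=> t' At' /=; rewrite /b {b}.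
pose t'' n := if n == k then t' n else t n.
have At'' : partition_choice A t''.
  by move=> n; rewrite /t''; case: ifP => _; [exact: At'|exact: At].
have tk n : (k.+1 <= n)%N -> t'' n = t n by move=> kn; rewrite /t'' gtn_eqF.
have := birkhoff_sum_finite_change GA At At'' tk.
rewrite big_ord_recr /= big1 => [|n _]; last by rewrite /t'' ltn_eqF// subrr scaler0.
rewrite add0r /t'' eqxx scalerBr => /eqP; rewrite subr_eq => /eqP h.
have := IH _ At''; rewrite h.
rewrite (eq_bigr (fun n : 'I_k => v n - birkhoff_term mu G A t n)); last first.
  by move=> n _; rewrite /birkhoff_term /t'' ltn_eqF.
congr C; rewrite /birkhoff_term.
move: (limn _) (\sum_(i < k) _) (_ *: G (t k)) (_ *: G (t' k)) => x y z w.
by rewrite -addrA -[w - z + _]addrA [RHS]addrC; congr (w + _); exact: addrC.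
Qed.

Lemma term_hull_partition Delta t0 n (e : R) : gauge Delta -> partition_choice A t0 -> 0 < e ->
  exists p, [/\ fine_in Delta p, supp p `<=` A n, m (A n `\` supp p) <= e &
    in_term_hull n (riemann_sum mu G p + (m (A n) - m (supp p)) *: G (t0 n))].
Proof.
move=> gD At0 e0.
have [p pP pe] := gauge_partial_cover qr (A n) gD (mA n) e0; exists p.
have sp : supp p `<=` A n.
  by move=> x /supp_mem[q qp qx]; have [_ [_ h _]] := partial_partition_mem pP qp; exact: h.
have mp := partial_partition_measurable pP.
split=> //.
- by apply: partial_partition_sub pP => E t [].
- rewrite (_ : A n = A n `&` gauge_union Delta (A n))//.
  by apply/esym/setIidl => x Ax; exists x => //; exact: (gD x).2.
- move=> D cD Dt; rewrite (prob_supp mu pP).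
  apply: (convex_set_sum cD).
  + by move=> q _; exact: prob_ge0.
  + by rewrite -(prob_supp mu pP) prob_mono.
  + move=> q qp; have [_ [_ _ Aq]] := partial_partition_mem pP qp.
    pose t i := if i == n then q.2 else t0 i.
    have := Dt t; rewrite /birkhoff_term /t eqxx; apply=> i.
    by case: eqP => [->//|_]; exact: At0.
  + exact: Dt.
Qed.

Lemma hull_partition Delta t0 K (e : R) : gauge Delta -> partition_choice A t0 -> 0 < e ->
  exists p v, [/\ fine_in Delta p, supp p `<=` \bigcup_(n < K) A n,
    m ((\bigcup_(n < K) A n) `\` supp p) <= K%:R * e, forall n, in_term_hull n (v n) &
    `|\sum_(n < K) v n - riemann_sum mu G p| <= e * \sum_(n < K) `|G (t0 n)|].
Proof.
move=> gD At0 e0; elim: K => [|K [p [v [pD sp pe vH vp]]]].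
  exists [::], (birkhoff_term mu G A t0); split=> //.
  - by rewrite supp_nil.
  - by rewrite bigcup_mkord big_ord0 set0D prob_set0 mul0r.
  - by move=> n D _; exact.
  - by rewrite !big_ord0 mulr0 /riemann_sum big_nil subrr normr0.
have [q [qD sq qe qH]] := term_hull_partition K gD At0 e0.
have mp := partial_partition_measurable pD.
have mq := partial_partition_measurable qD.
have mU : measurable (\bigcup_(n < K) A n) by exact: bigcup_measurable.
have US : \bigcup_(n < K.+1) A n = (\bigcup_(n < K) A n) `|` A K.
  by rewrite !bigcup_mkord big_ord_recr.
exists (p ++ q), (fun n => if n == K then riemann_sum mu G q + (m (A K) - m (supp q)) *: G (t0 K)
  else v n); split.
- apply: partial_partition_cat => //; rewrite -subset0 => x [/sp[n /= nK Anx] /sq AKx].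
  by have := tA I I (ex_intro _ x (conj Anx AKx)) => nE; rewrite nE ltnn in nK.
- by rewrite supp_cat US; exact: setUSS.
- rewrite supp_cat US -natr1 mulrDl mul1r.
  apply: (@le_trans _ _ (m ((\bigcup_(n < K) A n) `\` supp p `|` A K `\` supp q))).
    apply: prob_mono.
    + by apply: measurableD; exact: measurableU.
    + by apply: measurableU; exact: measurableD.
    + by move=> x [[Ux|Ax] nx]; [left|right]; split=> // h; apply: nx; [left|right].
  by rewrite (le_trans (prob_setU_le _ _ _)) ?lerD//; exact: measurableD.
- by move=> n; case: eqP => [->|].
rewrite !big_ord_recr /= eqxx riemann_sum_cat mulrDr.
rewrite (eq_bigr (fun n : 'I_K => v n)); last by move=> n _; rewrite ltn_eqF.
have -> : \sum_(n < K) v n + (riemann_sum mu G q + (m (A K) - m (supp q)) *: G (t0 K)) -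
    (riemann_sum mu G p + riemann_sum mu G q) =
    (\sum_(n < K) v n - riemann_sum mu G p) + (m (A K) - m (supp q)) *: G (t0 K).
  rewrite [riemann_sum mu G q + _]addrC opprD addrACA; congr (_ + _).
  by rewrite addrK.
rewrite (le_trans (ler_normD _ _))// lerD// normrZ ler_wpM2r//.
rewrite (prob_setID mu (mA K) mq) (_ : A K `&` supp q = supp q); last exact/setIidr.
by rewrite addrAC subrr add0r ger0_norm ?prob_ge0.
Qed.

Lemma gauge_limit_hull z : gauge_limit mu G z ->
  closed_convex_hull (birkhoff_sums mu G A) z.
Proof.
move=> Gz; apply/closure_norm => e e0; have e3 : 0 < e / 3 by rewrite divr_gt0.
have [Delta [r [gD r0 DP]]] := Gz _ e3.
have [t0 At0] := partition_choice_exists A.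
have cu := birkhoff_sum_cvg GA At0; set x := limn _ in cu.
have [K1 _ K1P] : \forall n \near \oo, `|x - series (birkhoff_term mu G A t0) n| <= e / 3.
  by move/cvgrPdist_le : cu => /(_ _ e3).
have [K2 _ K2P] : \forall n \near \oo, 1 - m (\bigcup_(i < n) A i) <= r / 2.
  have h : (fun n => m (\bigcup_(i < n) A i)) @ \oo --> (1 : R).
    have <- : m (\bigcup_n \bigcup_(i < n) A i) = 1.
      rewrite (_ : \bigcup_n _ = setT) ?prob_setT// -subTset -cA => y [n _ Ay].
      by exists n.+1 => //; exists n => /=.
    apply: prob_cvg_bigcup => [n|n n' nn']; first exact: bigcup_measurable.
    by apply/subsetPset => y [i /= ni Ay]; exists i => //=; exact: leq_trans nn'.
  have r2 : 0 < r / 2 by rewrite divr_gt0.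
  by move/cvgrPdist_le : h => /(_ _ r2); apply: filterS => n; apply: le_trans; exact: ler_norm.
pose K := maxn K1 K2.
pose M := \sum_(n < K) `|G (t0 n)|.
have M0 : 0 <= M by exact: sumr_ge0.
pose c := Num.min (r / 2) (e / 3) / (K%:R + M + 1).
have KM : 0 < K%:R + M + 1 by rewrite ltr_wpDl ?ltr01// addr_ge0.
have c0 : 0 < c by rewrite divr_gt0// lt_min e3 divr_gt0.
have cKM : c * (K%:R + M + 1) = Num.min (r / 2) (e / 3) by rewrite /c divfK ?gt_eqF.
have [p [v [pD sp pe vH vp]]] := hull_partition K gD At0 c0.
have mp := partial_partition_measurable pD.
have mU : measurable (\bigcup_(n < K) A n) by exact: bigcup_measurable.
exists (x + \sum_(n < K) (v n - birkhoff_term mu G A t0 n)).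
  by move=> C [cC JC]; exact: (convex_birkhoff_sums cC JC vH K At0).
have pr : m (~` supp p) <= r.
  have := K2P K (leq_maxr _ _); rewrite /= -(prob_setC mu mU) => h1.
  apply: (@le_trans _ _ (m (~` (\bigcup_(n < K) A n) `|` (\bigcup_(n < K) A n) `\` supp p))).
    apply: prob_mono.
    + exact: measurableC.
    + by apply: measurableU; [exact: measurableC|exact: measurableD].
    + by move=> y ny; have [?|?] := pselect ((\bigcup_(n < K) A n) y); [right|left].
  apply: (le_trans (prob_setU_le _ _ _)); [exact: measurableC|exact: measurableD|].
  rewrite [leRHS]splitr lerD//; apply: (le_trans pe).
  have : c * (K%:R + M + 1) <= r / 2 by rewrite cKM ge_min lexx.
  apply: le_trans; rewrite mulrC ler_wpM2l ?(ltW c0)// -addrA lerDl addr_ge0//; exact: ler01.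
have h1 := DP p pD pr.
have h2 : `|\sum_(n < K) v n - riemann_sum mu G p| <= e / 3.
  apply: (le_trans vp); have : c * (K%:R + M + 1) <= e / 3 by rewrite cKM ge_min lexx orbT.
  apply: le_trans; rewrite ler_wpM2l ?(ltW c0)// -/M addrAC addrC lerDl addr_ge0//; exact: ler01.
have h3 := K1P K (leq_maxl _ _); rewrite /= /series /= big_mkord in h3.
rewrite sumrB.
have -> : x + (\sum_(n < K) v n - \sum_(n < K) birkhoff_term mu G A t0 n) - z =
    (x - \sum_(n < K) birkhoff_term mu G A t0 n) +
    ((\sum_(n < K) v n - riemann_sum mu G p) - (z - riemann_sum mu G p)).
  by rewrite opprB subrKA addrACA !addrA.
rewrite (le_trans (ler_normD _ _))// (le_trans (lerD h3 (ler_normB _ _)))//.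
by rewrite (le_trans (lerD (lexx _) (lerD h2 h1)))//; lra.
Qed.

End hull.

Section integrals.
Context (d : measure_display) (T : topMeasurableType d) (R : realType) (mu : probability T R)
  (S : Type).
Hypothesis qr : quasi_radon mu.

Lemma gauge_limit_birkhoff_integral (G : T -> linfty R S) z :
  birkhoff_integrable mu G -> gauge_limit mu G z -> is_birkhoff_integral mu G z.
Proof.
move=> Gb Gz; split=> //; apply/seteqP; split=> [y Hy|_ -> A GA]; last first.
  exact: gauge_limit_hull.
apply/eqP; rewrite -subr_eq0 -normr_le0; apply/ler_addgt0Pr => e e0; rewrite add0r.
have e2 : 0 < e / 2 by rewrite divr_gt0.
have [A GA Ae] := Gb _ e2.
have [t At] := partition_choice_exists A.
set b := limn (series (birkhoff_term mu G A t)).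
have bA : birkhoff_sums mu G A b by exists t.
have Ab x : birkhoff_sums mu G A x -> `|x - b| <= e / 2 by move=> Ax; exact: Ae.
rewrite -(subrKA b) (le_trans (ler_normD _ _))// [leRHS]splitr lerD//.
  exact: closed_convex_hull_ball (Hy A GA).
rewrite distrC; apply: closed_convex_hull_ball Ab _; exact: gauge_limit_hull.
Qed.

End integrals.

Section radstrom.
Context (d : measure_display) (T : topMeasurableType d) (R : realType) (mu : probability T R)
  (X : completeNormedModType R).

Lemma radstrom_norming (F : T -> cwk X) (I : cwk X) :
  separable_set (dual_ball X : set (weak_star_dual X)) ->
  exists x, norming_for (@radstrom R X \o F) (radstrom I) x.
Proof.
move=> /countable_norming[x xP]; exists x => a l C lC.
pose c n := if n is k.+1 then (nth (0, point) l k).1 else a.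
pose A n := if n is k.+1 then F (nth (0, point) l k).2 else I.
have -> : a *: radstrom I + \sum_(q <- l) q.1 *: (@radstrom R X \o F) q.2 =
    \sum_(i < (size l).+1) c i *: radstrom (A i).
  by rewrite big_ord_recl /= (big_nth (0, point)) big_mkord.
apply: xP => k; rewrite linfty_sum big_ord_recl /=.
by have := lC k; rewrite (big_nth (0, point)) big_mkord.
Qed.

Lemma radstrom_riemann_sum (F : T -> cwk X) p :
  exists C, radstrom C = riemann_sum mu (@radstrom R X \o F) p.
Proof.
pose c i := fine (mu (nth (set0, point) p i).1).
have c0 i : 0 <= c i by exact: prob_ge0.
have [C _ CE] := minkowski_sumP (size p) (fun i => F (nth (set0, point) p i).2) c0.
by exists C; rewrite CE /riemann_sum (big_nth (set0, point)) big_mkord.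
Qed.

Lemma gauge_limit_radstrom (F : T -> cwk X) z : quasi_radon mu ->
  gauge_limit mu (@radstrom R X \o F) z -> exists I, radstrom I = z.
Proof.
move=> qr Fz; apply: radstrom_closed => e e0.
have [Delta [r [gD r0 DP]]] := Fz _ e0.
have [p pD pr] := gauge_almost_cover qr gD r0.
have [C CE] := radstrom_riemann_sum F p; exists C; rewrite CE distrC; exact: DP.
Qed.

End radstrom.

Theorem corollary4p2 (R : realType) (d : measure_display)
    (Omega : topMeasurableType d) (mu : probability Omega R)
    (X : completeNormedModType R) :
  quasi_radon mu -> outer_regular mu ->
  separable_set (dual_ball X : set (weak_star_dual X)) ->
  forall F : Omega -> cwk X,
    (mcshane_integrable mu F <-> cwk_birkhoff_integrable mu F) /\
    (mcshane_integrable mu F ->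
     forall I : cwk X,
       is_mcshane_integral mu F I <-> is_cwk_birkhoff_integral mu F I).
Proof.
move=> qr outer sep F.
have birk I : is_mcshane_integral mu F I -> cwk_birkhoff_integrable mu F.
  move=> /(mcshane_integralP qr) FI e e0.
  have [x xP] := radstrom_norming F I sep.
  have e2 : 0 < e / 2 by rewrite divr_gt0.
  have [A FA Ae] := gauge_limit_birkhoff qr FI xP e2; exists A => // y y' Ay Ay'.
  rewrite -(subrKA (radstrom I)) (le_trans (ler_normD _ _))// [leRHS]splitr lerD ?Ae//.
  by rewrite distrC Ae.
split; [split=> [[I /birk]//|Fb]|move=> _ I; split=> [FI|[Fb FI]]].
- have [z Fz] := birkhoff_gauge_limit qr outer Fb.
  have [I Iz] := gauge_limit_radstrom qr Fz.
  by exists I; apply/(mcshane_integralP qr); rewrite Iz.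
- apply: gauge_limit_birkhoff_integral => //; first exact: birk FI.
  exact/(mcshane_integralP qr).
- have [z Fz] := birkhoff_gauge_limit qr outer Fb.
  have [_ FE] := gauge_limit_birkhoff_integral qr Fb Fz.
  apply/(mcshane_integralP qr).
  suff -> : radstrom I = z by [].
  by have : [set z] (radstrom I) by rewrite -FE FI.
Qed.
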